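(* Let $b\in\mathbb{R}$, $\rho_0>0$ and $u_0\in H^{1,\rho_0}$. Then there exists $\beta>0$ such that for every $\rho$ with $0<\rho<\rho_0$ there exists a unique solution $u$, continuously differentiable with respect to time, of the Cauchy problem $$u_t+uu_x=-(1-\partial_x^2)^{-1}\Big(\tfrac{b}{2}u^2+\tfrac{3-b}{2}u_x^2\Big)_x,\qquad u(\cdot,0)=u_0,$$ equivalently of the integral equation $$u(\cdot,t)=u_0-\int_0^t\Big[uu_x+(1-\partial_x^2)^{-1}\Big(\tfrac{b}{2}u^2+\tfrac{3-b}{2}u_x^2\Big)_x\Big](\cdot,t')\,dt',$$ such that $u(\cdot,t)\in H^{1,\rho}$ and $\partial_t u(\cdot,t)\in H^{1,\rho}$ for all $t\in\big[0,\frac{\rho_0-\rho}{\beta}\big]$.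
   Context: The $b$-family equation is $m_t+um_x+bmu_x=0$ with $m=u-u_{xx}$, $b$ a real parameter, equivalently $u_t-u_{txx}+(b+1)uu_x=bu_xu_{xx}+uu_{xxx}$, equivalently the nonlocal form displayed in the claim. For $\rho>0$ and an integer $k\ge 0$, $H^{k,\rho}$ denotes the space of functions $f$ analytic in the complex strip $D(\rho)=\{x\in\mathbb{C}:|\operatorname{Im}x|\le\rho\}$ such that $\partial_x^j f(\cdot+iy)\in L^2(\mathbb{R})$ for $0\le j\le k$ and $|y|<\rho$, with $\sup_{|y|<\rho}\|\partial_x^jf(\cdot+iy)\|_{L^2}<\infty$; equivalently, in terms of the Fourier transform $\hat f$, those $f$ with finite norm $$\|f\|_{k,\rho}=\Big(\int_{\mathbb{R}}e^{2\rho|\xi|}(1+|\xi|^2)^k|\hat f(\xi)|^2\,d\xi\Big)^{1/2}.$$ *)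

(* Defs.v *)
From Stdlib Require Import Reals.
Open Scope R_scope.

Definition Cx : Type := (R * R)%type.
Definition Cadd (z w : Cx) : Cx := (fst z + fst w, snd z + snd w).
Definition Csub (z w : Cx) : Cx := (fst z - fst w, snd z - snd w).
Definition Cmul (z w : Cx) : Cx :=
  (fst z * fst w - snd z * snd w, fst z * snd w + snd z * fst w).
Definition Cscal (r : R) (z : Cx) : Cx := (r * fst z, r * snd z).
Definition Cnorm2 (z : Cx) : R := fst z * fst z + snd z * snd z.

(** Complex differentiability of F : (x,y) |-> F(x+iy) at x+iy with
    complex derivative L (epsilon-delta definition, squared moduli). *)
Definition cderiv (F : R -> R -> Cx) (x y : R) (L : Cx) : Prop :=
  forall eps, 0 < eps -> exists delta, 0 < delta /\
    forall h1 h2, 0 < h1 * h1 + h2 * h2 < delta * delta ->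
      Cnorm2 (Csub (Csub (F (x + h1) (y + h2)) (F x y)) (Cmul L (h1, h2)))
        <= eps * eps * (h1 * h1 + h2 * h2).

Definition derivC (f : R -> Cx) (x : R) (l : Cx) : Prop :=
  derivable_pt_lim (fun s => fst (f s)) x (fst l) /\
  derivable_pt_lim (fun s => snd (f s)) x (snd l).

Definition L2le (g : R -> Cx) (M : R) : Prop :=
  forall a b, a <= b ->
    exists pr : Riemann_integrable (fun x => Cnorm2 (g x)) a b, RiemannInt pr <= M.

Definition strip_ext (rho : R) (f : R -> Cx) (F F' : R -> R -> Cx) : Prop :=
  (forall x, F x 0 = f x) /\
  (forall x y, Rabs y < rho -> cderiv F x y (F' x y)).

Definition in_H1 (rho : R) (f : R -> Cx) : Prop :=
  exists F F', strip_ext rho f F F' /\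
    exists M, forall y, Rabs y < rho ->
      L2le (fun x => F x y) M /\ L2le (fun x => F' x y) M.

(** The (equivalent) H^{1,rho} norm of f is at most eps:
    sup_{|y|<rho} max(||f(.+iy)||_L2, ||f'(.+iy)||_L2) <= eps. *)
Definition H1_le (rho : R) (f : R -> Cx) (eps : R) : Prop :=
  exists F F', strip_ext rho f F F' /\
    forall y, Rabs y < rho ->
      L2le (fun x => F x y) (eps * eps) /\ L2le (fun x => F' x y) (eps * eps).

Definition RInt_line (g : R -> R) (l : R) : Prop :=
  forall eps, 0 < eps -> exists N, forall a b, a <= - N -> N <= b ->
    exists pr : Riemann_integrable g a b, Rabs (RiemannInt pr - l) < eps.

(** w = (1 - d_x^2)^{-1} g, i.e. w(x) = (1/2) int_R e^{-|x-y|} g(y) dy. *)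
Definition LambdaInv (g w : R -> Cx) : Prop :=
  forall x,
    RInt_line (fun y => exp (- Rabs (x - y)) / 2 * fst (g y)) (fst (w x)) /\
    RInt_line (fun y => exp (- Rabs (x - y)) / 2 * snd (g y)) (snd (w x)).

Definition bfam_eq (b : R) (u v : R -> Cx) : Prop :=
  exists ux : R -> Cx, (forall x, derivC u x (ux x)) /\
  exists w : R -> Cx,
    LambdaInv (fun x => Cadd (Cscal (b / 2) (Cmul (u x) (u x)))
                             (Cscal ((3 - b) / 2) (Cmul (ux x) (ux x)))) w /\
    forall x, exists dw, derivC w x dw /\
      v x = Cscal (-1) (Cadd (Cmul (u x) (ux x)) dw).

Definition is_solution (b rho T : R) (u0 : R -> Cx) (u v : R -> R -> Cx) : Prop :=
  (forall x, u 0 x = u0 x) /\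
  (forall t, 0 <= t <= T -> in_H1 rho (u t) /\ in_H1 rho (v t)) /\
  (forall t, 0 <= t <= T -> forall eps, 0 < eps -> exists delta, 0 < delta /\
     forall s, 0 <= s <= T -> s <> t -> Rabs (s - t) < delta ->
       H1_le rho (fun x => Csub (Cscal (/ (s - t)) (Csub (u s x) (u t x))) (v t x)) eps) /\
  (forall t, 0 <= t <= T -> forall eps, 0 < eps -> exists delta, 0 < delta /\
     forall s, 0 <= s <= T -> Rabs (s - t) < delta ->
       H1_le rho (fun x => Csub (v s x) (v t x)) eps) /\
  (forall t, 0 <= t <= T -> bfam_eq b (u t) (v t)).

(* Main.v *)
Require Import Defs.
From Stdlib Require Import Reals Lra Lia Classical ClassicalEpsilon.
From Coquelicot Require Import Coquelicot.
Open Scope R_scope.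

(** The equation is u_t = Q(u,u), where Q is bilinear and loses one derivative:
    by Cauchy's estimate it maps H^(1,s) to H^(1,s') with norm at most C/(s - s') for s' < s.
    Existence: the Taylor coefficients in time, U_(n+1) = (n+1)^(-1) sum_k Q(U_k, U_(n-k)), satisfy
    |U_n|_s <= M (n+1)^(-2) (K/(rho0-s))^n by induction, choosing s - s' = (rho0-s')/(n+2), and the power
    series converges in H^(1,rho) as long as t < (rho0-rho)/K.
    Uniqueness: by the identity theorem a solution satisfies the equation in the whole strip.
    The difference D of two solutions that agree at time t0 satisfies
    |D(t,z)| <= S (K(t-t0)/(r-|Im z|))^n for every n, again by Cauchy's estimate and induction on n,
    so it vanishes for a short time, and a supremum argument in time concludes. *)

(** * Complex calculus *)

(** Losing a derivative rules out a fixed-point argument in one space, so every estimate pays with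
    strip width. In the existence part the step (rho0-s)/(n+2) costs a factor n+2, which the
    division by n+1 in the recursion absorbs up to a factor 2, and it magnifies the geometric bound
    only by ((n+2)/(n+1))^n <= 3. The weight (n+1)^(-2) is there because its convolution with itself
    is at most 8 (n+2)^(-2), so the bound reproduces itself. As K involves only b, rho0 and a bound
    of u0 on the whole strip, beta can be fixed before rho. Uniqueness cannot use series: a
    competitor is merely C^1 in time, satisfies the equation only on the real line, and comes with a
    strip extension chosen separately at each time. This is why an identity theorem is needed, and
    why the iteration runs in sup norms weighted by r-|Im z|: the nonlocal operator mixes only
    points of one horizontal line, where the weight is constant. Taking r = rho/2 leaves room to
    bound the x-derivatives of the two solutions themselves by Cauchy's estimate. *)

Lemma Cnorm2_Cmod (z : C) : Cnorm2 z = Cmod z * Cmod z.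
Proof.
  unfold Cnorm2, Cmod. rewrite sqrt_sqrt; [ring | nra].
Qed.

Lemma Cmod_le_of_Cnorm2 (z : C) (a : R) : 0 <= a -> Cnorm2 z <= a * a -> Cmod z <= a.
Proof.
  intros Ha H. rewrite Cnorm2_Cmod in H. pose proof (Cmod_ge_0 z). nra.
Qed.

Lemma Cnorm2_le_of_Cmod (z : C) (a : R) : Cmod z <= a -> Cnorm2 z <= a * a.
Proof.
  intros H. rewrite Cnorm2_Cmod. pose proof (Cmod_ge_0 z). nra.
Qed.

Lemma Cnorm2_ge_0 (z : C) : 0 <= Cnorm2 z.
Proof. unfold Cnorm2. nra. Qed.

Lemma Rabs_fst_Cmod (z : C) : Rabs (fst z) <= Cmod z.
Proof. exact (re_le_Cmod z). Qed.

Lemma Rabs_snd_Cmod (z : C) : Rabs (snd z) <= Cmod z.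
Proof. eapply Rle_trans; [apply Rmax_r | apply Rmax_Cmod]. Qed.

Lemma Cmod_minus (z w : C) : Cmod (z - w)%C <= Cmod z + Cmod w.
Proof.
  unfold Cminus. eapply Rle_trans; [apply Cmod_triangle |]. rewrite Cmod_opp. lra.
Qed.

Lemma Cmod_minus_sym (z w : C) : Cmod (z - w)%C = Cmod (w - z)%C.
Proof. rewrite <- (Cmod_opp (w - z)). f_equal. ring. Qed.

Lemma Cmod_triangle_minus (z w : C) : Cmod z <= Cmod w + Cmod (z - w)%C.
Proof.
  replace z with (w + (z - w))%C at 1 by ring. apply Cmod_triangle.
Qed.

Lemma Cmod_Rpair (x : R) : Cmod (x, 0) = Rabs x.
Proof. exact (Cmod_R x). Qed.

Lemma Cmod_Ipair (x : R) : Cmod (0, x) = Rabs x.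
Proof.
  unfold Cmod; simpl. rewrite <- sqrt_Rsqr_abs. f_equal. unfold Rsqr. ring.
Qed.

Lemma Cmod_le_sum (z : C) : Cmod z <= Rabs (fst z) + Rabs (snd z).
Proof.
  replace z with ((fst z, 0) + (0, snd z))%C at 1
    by (apply injective_projections; simpl; ring).
  eapply Rle_trans; [apply Cmod_triangle |]. rewrite Cmod_Rpair, Cmod_Ipair. lra.
Qed.

(** Free of quotients, so that a zero increment needs no separate case in the product and chain
    rules; [cdiff_cderiv] and [cderiv_cdiff] relate it to the squared moduli of [cderiv]. *)
Definition cdiff (F : C -> C) (z l : C) : Prop :=
  forall eps, 0 < eps -> exists delta, 0 < delta /\
    forall h : C, Cmod h < delta -> Cmod (F (z + h) - F z - l * h)%C <= eps * Cmod h.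

Lemma cdiff_ext_loc (F G : C -> C) (z l : C) (r : R) :
  0 < r -> (forall w, Cmod (w - z)%C < r -> F w = G w) -> cdiff F z l -> cdiff G z l.
Proof.
  intros Hr E H eps He. destruct (H eps He) as [d [Hd H']].
  exists (Rmin d r). split; [now apply Rmin_pos |]. intros h Hh.
  rewrite <- !E. apply H'. eapply Rlt_le_trans; [exact Hh | apply Rmin_l].
  replace (z - z)%C with (RtoC 0) by ring. rewrite Cmod_0. exact Hr.
  replace (z + h - z)%C with h by ring. eapply Rlt_le_trans; [exact Hh | apply Rmin_r].
Qed.

Lemma cdiff_ext (F G : C -> C) (z l : C) :
  (forall w, F w = G w) -> cdiff F z l -> cdiff G z l.
Proof. intros E. apply (cdiff_ext_loc F G z l 1); [lra | auto]. Qed.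

Lemma cdiff_const (c z : C) : cdiff (fun _ => c) z 0.
Proof.
  intros eps He. exists 1. split; [lra |]. intros h _.
  replace (c - c - 0 * h)%C with (RtoC 0) by ring. rewrite Cmod_0.
  pose proof (Cmod_ge_0 h). nra.
Qed.

Lemma cdiff_id (z : C) : cdiff (fun w => w) z 1.
Proof.
  intros eps He. exists 1. split; [lra |]. intros h _.
  replace (z + h - z - 1 * h)%C with (RtoC 0) by ring. rewrite Cmod_0.
  pose proof (Cmod_ge_0 h). nra.
Qed.

Lemma cdiff_plus (F G : C -> C) (z l m : C) :
  cdiff F z l -> cdiff G z m -> cdiff (fun w => F w + G w)%C z (l + m)%C.
Proof.
  intros HF HG eps He.
  destruct (HF (eps / 2)) as [d1 [Hd1 H1]]; [lra |].
  destruct (HG (eps / 2)) as [d2 [Hd2 H2]]; [lra |].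
  exists (Rmin d1 d2). split; [now apply Rmin_pos |]. intros h Hh.
  pose proof (Rmin_l d1 d2). pose proof (Rmin_r d1 d2).
  replace (F (z + h) + G (z + h) - (F z + G z) - (l + m) * h)%C
    with ((F (z + h) - F z - l * h) + (G (z + h) - G z - m * h))%C by ring.
  eapply Rle_trans; [apply Cmod_triangle |].
  specialize (H1 h ltac:(lra)). specialize (H2 h ltac:(lra)). lra.
Qed.

Lemma cdiff_cont (F : C -> C) (z l : C) : cdiff F z l ->
  forall eps, 0 < eps -> exists delta, 0 < delta /\
    forall h : C, Cmod h < delta -> Cmod (F (z + h) - F z)%C <= eps.
Proof.
  intros H eps He. destruct (H 1) as [d [Hd H1]]; [lra |].
  assert (Hl := Cmod_ge_0 l).
  exists (Rmin d (eps / (1 + Cmod l))). split.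
  { apply Rmin_pos; auto. apply Rdiv_lt_0_compat; lra. }
  intros h Hh. pose proof (Rmin_l d (eps / (1 + Cmod l))).
  pose proof (Rmin_r d (eps / (1 + Cmod l))).
  specialize (H1 h ltac:(lra)).
  replace (F (z + h) - F z)%C with ((F (z + h) - F z - l * h) + l * h)%C by ring.
  eapply Rle_trans; [apply Cmod_triangle |]. rewrite Cmod_mult.
  assert (Cmod h * (1 + Cmod l) <= eps); [| nra].
  apply Rle_trans with (eps / (1 + Cmod l) * (1 + Cmod l)); [| right; field; lra].
  apply Rmult_le_compat_r; lra.
Qed.

Lemma cdiff_mult (F G : C -> C) (z l m : C) :
  cdiff F z l -> cdiff G z m -> cdiff (fun w => F w * G w)%C z (l * G z + F z * m)%C.
Proof.
  intros HF HG eps He.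
  assert (Ha := Cmod_ge_0 (F z)). assert (Hb := Cmod_ge_0 (G z)).
  assert (Hl := Cmod_ge_0 l).
  set (k := 1 + Cmod (F z) + Cmod (G z) + Cmod l).
  assert (Hk : 0 < k) by (unfold k; lra).
  assert (He' : 0 < eps / (3 * k)) by (apply Rdiv_lt_0_compat; lra).
  destruct (HF (Rmin 1 (eps / (3 * k)))) as [d1 [Hd1 H1]]; [apply Rmin_pos; lra |].
  destruct (HG (eps / (3 * k))) as [d2 [Hd2 H2]]; [auto |].
  destruct (cdiff_cont G z m HG (eps / (3 * k)) He') as [d3 [Hd3 H3]].
  exists (Rmin d1 (Rmin d2 d3)). split; [repeat apply Rmin_pos; auto |]. intros h Hh.
  pose proof (Rmin_l d1 (Rmin d2 d3)). pose proof (Rmin_r d1 (Rmin d2 d3)).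
  pose proof (Rmin_l d2 d3). pose proof (Rmin_r d2 d3).
  specialize (H1 h ltac:(lra)). specialize (H2 h ltac:(lra)). specialize (H3 h ltac:(lra)).
  replace (F (z + h) * G (z + h) - F z * G z - (l * G z + F z * m) * h)%C
    with ((F (z + h) - F z - l * h) * G z + F z * (G (z + h) - G z - m * h)
          + (F (z + h) - F z) * (G (z + h) - G z))%C by ring.
  eapply Rle_trans; [apply Cmod_triangle |].
  eapply Rle_trans; [apply Rplus_le_compat_r, Cmod_triangle |].
  rewrite !Cmod_mult. assert (Hh0 := Cmod_ge_0 h).
  pose proof (Rmin_l 1 (eps / (3 * k))). pose proof (Rmin_r 1 (eps / (3 * k))).
  assert (Hf : Cmod (F (z + h) - F z)%C <= k * Cmod h).
  { eapply Rle_trans; [apply (Cmod_triangle_minus _ (l * h)%C) |].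
    rewrite Cmod_mult. unfold k. nra. }
  set (e := eps / (3 * k)) in *.
  assert (Hek : e * k = eps / 3) by (unfold e; field; lra).
  assert (Cmod (F (z + h) - F z - l * h)%C * Cmod (G z) <= eps / 3 * Cmod h).
  { rewrite <- Hek. apply Rle_trans with ((e * Cmod h) * k); [| right; ring].
    apply Rmult_le_compat; try apply Cmod_ge_0; [nra | unfold k; lra]. }
  assert (Cmod (F z) * Cmod (G (z + h) - G z - m * h)%C <= eps / 3 * Cmod h).
  { rewrite <- Hek. apply Rle_trans with (k * (e * Cmod h)); [| right; ring].
    apply Rmult_le_compat; try apply Cmod_ge_0; [unfold k; lra | nra]. }
  assert (Cmod (F (z + h) - F z)%C * Cmod (G (z + h) - G z)%C <= eps / 3 * Cmod h).
  { rewrite <- Hek. apply Rle_trans with ((k * Cmod h) * e); [| right; ring].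
    apply Rmult_le_compat; try apply Cmod_ge_0; auto. }
  lra.
Qed.

Lemma cdiff_scal (c : C) (F : C -> C) (z l : C) :
  cdiff F z l -> cdiff (fun w => c * F w)%C z (c * l)%C.
Proof.
  intros H. replace (c * l)%C with (0 * F z + c * l)%C by ring.
  apply (cdiff_mult (fun _ => c) F); auto. apply cdiff_const.
Qed.

Lemma cdiff_minus (F G : C -> C) (z l m : C) :
  cdiff F z l -> cdiff G z m -> cdiff (fun w => F w - G w)%C z (l - m)%C.
Proof.
  intros HF HG. apply (cdiff_ext (fun w => F w + (-(1)) * G w)%C); [intros; ring |].
  replace (l - m)%C with (l + (-(1)) * m)%C by ring.
  apply cdiff_plus; auto. now apply cdiff_scal.
Qed.

Lemma cdiff_comp (F G : C -> C) (z l m : C) :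
  cdiff F (G z) l -> cdiff G z m -> cdiff (fun w => F (G w)) z (l * m)%C.
Proof.
  intros HF HG eps He.
  assert (Hm := Cmod_ge_0 m). assert (Hl := Cmod_ge_0 l).
  assert (He1 : 0 < eps / (2 * (1 + Cmod m))) by (apply Rdiv_lt_0_compat; lra).
  assert (He2 : 0 < eps / (2 * (1 + Cmod l))) by (apply Rdiv_lt_0_compat; lra).
  destruct (HF _ He1) as [d1 [Hd1 H1]].
  destruct (HG (Rmin 1 (eps / (2 * (1 + Cmod l))))) as [d2 [Hd2 H2]];
    [apply Rmin_pos; lra |].
  exists (Rmin d2 (d1 / (1 + Cmod m))). split.
  { apply Rmin_pos; auto. apply Rdiv_lt_0_compat; lra. }
  intros h Hh. pose proof (Rmin_l d2 (d1 / (1 + Cmod m))).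
  pose proof (Rmin_r d2 (d1 / (1 + Cmod m))).
  specialize (H2 h ltac:(lra)).
  pose proof (Rmin_l 1 (eps / (2 * (1 + Cmod l)))).
  pose proof (Rmin_r 1 (eps / (2 * (1 + Cmod l)))).
  set (k := (G (z + h) - G z)%C).
  assert (Hh0 := Cmod_ge_0 h).
  assert (Hk : Cmod k <= (1 + Cmod m) * Cmod h).
  { eapply Rle_trans; [apply (Cmod_triangle_minus _ (m * h)%C) |].
    rewrite Cmod_mult. fold k in H2. nra. }
  assert (Hkd : Cmod k < d1).
  { eapply Rle_lt_trans; [exact Hk |].
    apply Rlt_le_trans with ((1 + Cmod m) * (d1 / (1 + Cmod m))); [| right; field; lra].
    apply Rmult_lt_compat_l; lra. }
  specialize (H1 k Hkd).
  replace (G (z + h)%C) with (G z + k)%C by (unfold k; ring).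
  replace (F (G z + k) - F (G z) - l * m * h)%C
    with ((F (G z + k) - F (G z) - l * k) + l * (k - m * h))%C by ring.
  eapply Rle_trans; [apply Cmod_triangle |]. rewrite Cmod_mult.
  assert (eps / (2 * (1 + Cmod m)) * Cmod k <= eps / 2 * Cmod h).
  { apply Rle_trans with (eps / (2 * (1 + Cmod m)) * ((1 + Cmod m) * Cmod h)).
    apply Rmult_le_compat_l; lra. right; field; lra. }
  assert (Cmod l * Cmod (k - m * h)%C <= eps / 2 * Cmod h).
  { apply Rle_trans with ((1 + Cmod l) * (eps / (2 * (1 + Cmod l)) * Cmod h)).
    apply Rmult_le_compat; try apply Cmod_ge_0; [lra |].
    unfold k. nra. right; field; lra. }
  lra.
Qed.

(** * Differentiability and continuity of curves in the complex plane *)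

Definition pder (f : R -> C) (t : R) (l : C) : Prop :=
  is_derive (fun s => fst (f s)) t (fst l) /\ is_derive (fun s => snd (f s)) t (snd l).

Definition ccont (f : R -> C) (t : R) : Prop :=
  continuous (fun s => fst (f s)) t /\ continuous (fun s => snd (f s)) t.

Lemma is_derive_eps (f : R -> R) (t l : R) :
  (forall eps, 0 < eps -> exists delta, 0 < delta /\
     forall h, Rabs h < delta -> Rabs (f (t + h) - f t - l * h) <= eps * Rabs h) ->
  is_derive f t l.
Proof.
  intros H. apply is_derive_Reals. intros eps He.
  destruct (H (eps / 2)) as [d [Hd H1]]; [lra |].
  exists (mkposreal d Hd). intros h Hh0 Hh. simpl in Hh.
  replace ((f (t + h) - f t) / h - l) with ((f (t + h) - f t - l * h) / h) by (field; auto).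
  unfold Rdiv. rewrite Rabs_mult, Rabs_inv.
  assert (0 < Rabs h) by now apply Rabs_pos_lt.
  apply Rle_lt_trans with (eps / 2 * Rabs h * / Rabs h).
  apply Rmult_le_compat_r; auto. left. now apply Rinv_0_lt_compat.
  rewrite Rmult_assoc, Rinv_r; lra.
Qed.

Lemma is_derive_eps_inv (f : R -> R) (t l : R) : is_derive f t l ->
  forall eps, 0 < eps -> exists delta, 0 < delta /\
     forall h, Rabs h < delta -> Rabs (f (t + h) - f t - l * h) <= eps * Rabs h.
Proof.
  intros H eps He. apply is_derive_Reals in H. destruct (H eps He) as [d H1].
  exists d. split; [apply cond_pos |]. intros h Hh.
  destruct (Req_dec h 0) as [-> | Hh0].
  { rewrite Rplus_0_r. rewrite Rabs_R0. replace (f t - f t - l * 0) with 0 by ring.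
    rewrite Rabs_R0. lra. }
  specialize (H1 h Hh0 Hh).
  replace (f (t + h) - f t - l * h) with (((f (t + h) - f t) / h - l) * h) by (field; auto).
  rewrite Rabs_mult. apply Rmult_le_compat_r; [apply Rabs_pos | lra].
Qed.

Lemma pder_eps (f : R -> C) (t : R) (l : C) :
  (forall eps, 0 < eps -> exists delta, 0 < delta /\
     forall h, Rabs h < delta -> Cmod (f (t + h)%R - f t - l * RtoC h)%C <= eps * Rabs h) ->
  pder f t l.
Proof.
  intros H. split; apply is_derive_eps; intros eps He;
  destruct (H eps He) as [d [Hd H1]]; exists d; split; auto; intros h Hh;
  (eapply Rle_trans; [| apply (H1 h Hh)]).
  - eapply Rle_trans; [| apply Rabs_fst_Cmod]. right. f_equal. simpl. ring.
  - eapply Rle_trans; [| apply Rabs_snd_Cmod]. right. f_equal. simpl. ring.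
Qed.

Lemma pder_eps_inv (f : R -> C) (t : R) (l : C) : pder f t l ->
  forall eps, 0 < eps -> exists delta, 0 < delta /\
     forall h, Rabs h < delta -> Cmod (f (t + h)%R - f t - l * RtoC h)%C <= eps * Rabs h.
Proof.
  intros [H1 H2] eps He.
  destruct (is_derive_eps_inv _ _ _ H1 (eps / 2)) as [d1 [Hd1 K1]]; [lra |].
  destruct (is_derive_eps_inv _ _ _ H2 (eps / 2)) as [d2 [Hd2 K2]]; [lra |].
  exists (Rmin d1 d2). split; [now apply Rmin_pos |]. intros h Hh.
  pose proof (Rmin_l d1 d2). pose proof (Rmin_r d1 d2).
  specialize (K1 h ltac:(lra)). specialize (K2 h ltac:(lra)).
  eapply Rle_trans; [apply Cmod_le_sum |].
  replace (fst (f (t + h)%R - f t - l * RtoC h)%C)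
    with (fst (f (t + h)) - fst (f t) - fst l * h) by (simpl; ring).
  replace (snd (f (t + h)%R - f t - l * RtoC h)%C)
    with (snd (f (t + h)) - snd (f t) - snd l * h) by (simpl; ring).
  lra.
Qed.

Lemma pder_ccont (f : R -> C) (t : R) (l : C) : pder f t l -> ccont f t.
Proof.
  intros [H1 H2]. split; apply (ex_derive_continuous (K := R_AbsRing) (V := R_NormedModule)).
  now exists (fst l). now exists (snd l).
Qed.

Lemma pder_comp (F : C -> C) (g : R -> C) (t : R) (l m : C) :
  cdiff F (g t) l -> pder g t m -> pder (fun s => F (g s)) t (l * m)%C.
Proof.
  intros HF Hg. apply pder_eps. intros eps He.
  assert (Hm := Cmod_ge_0 m). assert (Hl := Cmod_ge_0 l).
  assert (He1 : 0 < eps / (2 * (1 + Cmod m))) by (apply Rdiv_lt_0_compat; lra).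
  assert (He2 : 0 < eps / (2 * (1 + Cmod l))) by (apply Rdiv_lt_0_compat; lra).
  destruct (HF _ He1) as [d1 [Hd1 H1]].
  destruct (pder_eps_inv _ _ _ Hg (Rmin 1 (eps / (2 * (1 + Cmod l))))) as [d2 [Hd2 H2]];
    [apply Rmin_pos; lra |].
  exists (Rmin d2 (d1 / (1 + Cmod m))). split.
  { apply Rmin_pos; auto. apply Rdiv_lt_0_compat; lra. }
  intros h Hh. pose proof (Rmin_l d2 (d1 / (1 + Cmod m))).
  pose proof (Rmin_r d2 (d1 / (1 + Cmod m))).
  specialize (H2 h ltac:(lra)).
  pose proof (Rmin_l 1 (eps / (2 * (1 + Cmod l)))).
  pose proof (Rmin_r 1 (eps / (2 * (1 + Cmod l)))).
  set (k := (g (t + h)%R - g t)%C).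
  assert (Hh0 := Rabs_pos h).
  assert (Hk : Cmod k <= (1 + Cmod m) * Rabs h).
  { eapply Rle_trans; [apply (Cmod_triangle_minus _ (m * RtoC h)%C) |].
    rewrite Cmod_mult, Cmod_R. fold k in H2. nra. }
  assert (Hkd : Cmod k < d1).
  { eapply Rle_lt_trans; [exact Hk |].
    apply Rlt_le_trans with ((1 + Cmod m) * (d1 / (1 + Cmod m))); [| right; field; lra].
    apply Rmult_lt_compat_l; lra. }
  specialize (H1 k Hkd).
  replace (g (t + h)%R) with (g t + k)%C by (unfold k; ring).
  replace (F (g t + k) - F (g t) - l * m * RtoC h)%C
    with ((F (g t + k) - F (g t) - l * k) + l * (k - m * RtoC h))%C by ring.
  eapply Rle_trans; [apply Cmod_triangle |]. rewrite Cmod_mult.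
  assert (eps / (2 * (1 + Cmod m)) * Cmod k <= eps / 2 * Rabs h).
  { apply Rle_trans with (eps / (2 * (1 + Cmod m)) * ((1 + Cmod m) * Rabs h)).
    apply Rmult_le_compat_l; lra. right; field; lra. }
  assert (Cmod l * Cmod (k - m * RtoC h)%C <= eps / 2 * Rabs h).
  { apply Rle_trans with ((1 + Cmod l) * (eps / (2 * (1 + Cmod l)) * Rabs h)).
    apply Rmult_le_compat; try apply Cmod_ge_0; [lra |].
    unfold k. nra. right; field; lra. }
  lra.
Qed.

Lemma cdiff_cderiv (F : C -> C) (x y : R) (l : C) :
  cdiff F (x, y) l -> cderiv (fun x y => F (x, y)) x y l.
Proof.
  intros H eps He. destruct (H eps He) as [d [Hd H1]]. exists d. split; auto.
  intros h1 h2 Hh.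
  assert (E : h1 * h1 + h2 * h2 = Cmod (h1, h2) * Cmod (h1, h2)).
  { rewrite <- Cnorm2_Cmod. reflexivity. }
  rewrite E in *. pose proof (Cmod_ge_0 (h1, h2)).
  specialize (H1 (h1, h2) ltac:(nra)).
  replace (eps * eps * (Cmod (h1, h2) * Cmod (h1, h2)))
    with ((eps * Cmod (h1, h2)) * (eps * Cmod (h1, h2))) by ring.
  now apply Cnorm2_le_of_Cmod.
Qed.

Lemma cderiv_cdiff (F : R -> R -> C) (x y : R) (l : C) :
  cderiv F x y l -> cdiff (fun z => F (fst z) (snd z)) (x, y) l.
Proof.
  intros H eps He. destruct (H eps He) as [d [Hd H1]]. exists d. split; auto.
  (* [cderiv] says nothing about a zero increment, where the inequality is trivial. *)
  intros [h1 h2] Hh. destruct (Req_dec (Cmod (h1, h2)) 0) as [E | E].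
  { rewrite E. rewrite Rmult_0_r. apply Cmod_eq_0 in E. rewrite E.
    replace (Cplus (x, y) (RtoC 0)) with (x, y) by (apply injective_projections; simpl; ring).
    match goal with |- Cmod ?z <= _ => replace z with (RtoC 0) by (apply injective_projections; simpl; ring) end.
    rewrite Cmod_0. lra. }
  pose proof (Cmod_ge_0 (h1, h2)).
  assert (E' : h1 * h1 + h2 * h2 = Cmod (h1, h2) * Cmod (h1, h2)).
  { rewrite <- Cnorm2_Cmod. reflexivity. }
  apply Cmod_le_of_Cnorm2; [nra |].
  replace (eps * Cmod (h1, h2) * (eps * Cmod (h1, h2)))
    with (eps * eps * (h1 * h1 + h2 * h2)) by (rewrite E'; ring).
  apply (H1 h1 h2). rewrite E'. nra.
Qed.

(* Total: the derivative along horizontal lines, so that [Cd F] on a line depends only on [F] on that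
   line; it is the complex derivative wherever [F] is complex differentiable. *)
Definition Cd (F : C -> C) (z : C) : C :=
  (Derive (fun x => fst (F (x, snd z))) (fst z), Derive (fun x => snd (F (x, snd z))) (fst z)).

Lemma pder_line (x y : R) : pder (fun s => (s, y)) x 1.
Proof. split; simpl; [apply (is_derive_id x) | apply (is_derive_const (V := R_NormedModule))]. Qed.

Lemma cdiff_pder_line (F : C -> C) (z l : C) :
  cdiff F z l -> pder (fun x => F (x, snd z)) (fst z) l.
Proof.
  intros H. replace l with (l * 1)%C by ring. apply (pder_comp F (fun x => (x, snd z))).
  now destruct z. apply pder_line.
Qed.

Lemma pder_Cd (F : C -> C) (z l : C) : pder (fun x => F (x, snd z)) (fst z) l -> Cd F z = l.
Proof.
  intros [H1 H2]. unfold Cd. destruct l as [l1 l2]. f_equal; now apply is_derive_unique.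
Qed.

Lemma cdiff_Cd (F : C -> C) (z l : C) : cdiff F z l -> Cd F z = l.
Proof. intros H. now apply pder_Cd, cdiff_pder_line. Qed.

(** * Integrals of complex-valued functions *)

Definition CI (f : R -> C) (a b : R) : C :=
  (RInt (fun s => fst (f s)) a b, RInt (fun s => snd (f s)) a b).

Definition cconts (f : R -> C) (a b : R) : Prop :=
  forall t, Rmin a b <= t <= Rmax a b -> ccont f t.

Definition ex_CI (f : R -> C) (a b : R) : Prop :=
  ex_RInt (fun s => fst (f s)) a b /\ ex_RInt (fun s => snd (f s)) a b.

Lemma ex_CI_cont (f : R -> C) (a b : R) : cconts f a b -> ex_CI f a b.
Proof.
  intros H. split; apply (ex_RInt_continuous (V := R_CompleteNormedModule)); intros t Ht; now apply H.
Qed.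

Lemma CI_ext (f g : R -> C) (a b : R) :
  (forall t, Rmin a b < t < Rmax a b -> f t = g t) -> CI f a b = CI g a b.
Proof.
  intros H. unfold CI. f_equal; apply RInt_ext; intros t Ht; now rewrite H.
Qed.

Lemma CI_plus (f g : R -> C) (a b : R) : ex_CI f a b -> ex_CI g a b ->
  CI (fun t => f t + g t)%C a b = (CI f a b + CI g a b)%C.
Proof.
  intros [F1 F2] [G1 G2]. unfold CI, Cplus. simpl.
  f_equal; apply (RInt_plus (V := R_CompleteNormedModule)); auto.
Qed.

Lemma CI_scal (c : C) (f : R -> C) (a b : R) : ex_CI f a b ->
  CI (fun t => c * f t)%C a b = (c * CI f a b)%C.
Proof.
  intros [F1 F2]. unfold CI, Cmult. simpl. f_equal.
  - rewrite (RInt_minus (V := R_CompleteNormedModule) (fun s => fst c * fst (f s)) (fun s => snd c * snd (f s))).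
    + rewrite !(RInt_scal (V := R_CompleteNormedModule)); auto.
    + now apply (ex_RInt_scal (V := R_NormedModule)).
    + now apply (ex_RInt_scal (V := R_NormedModule)).
  - rewrite (RInt_plus (V := R_CompleteNormedModule) (fun s => fst c * snd (f s)) (fun s => snd c * fst (f s))).
    + rewrite !(RInt_scal (V := R_CompleteNormedModule)); auto.
    + now apply (ex_RInt_scal (V := R_NormedModule)).
    + now apply (ex_RInt_scal (V := R_NormedModule)).
Qed.

Lemma ex_CI_scal (c : C) (f : R -> C) (a b : R) : ex_CI f a b -> ex_CI (fun t => c * f t)%C a b.
Proof.
  intros [F1 F2]. split.
  - apply (ex_RInt_minus (V := R_NormedModule) (fun s => fst c * fst (f s)) (fun s => snd c * snd (f s)));
      now apply (ex_RInt_scal (V := R_NormedModule)).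
  - apply (ex_RInt_plus (V := R_NormedModule) (fun s => fst c * snd (f s)) (fun s => snd c * fst (f s)));
      now apply (ex_RInt_scal (V := R_NormedModule)).
Qed.

Lemma ex_CI_plus (f g : R -> C) (a b : R) : ex_CI f a b -> ex_CI g a b ->
  ex_CI (fun t => f t + g t)%C a b.
Proof.
  intros [F1 F2] [G1 G2]. split; now apply (ex_RInt_plus (V := R_NormedModule)).
Qed.

Lemma CI_Chasles (f : R -> C) (a b c : R) : ex_CI f a b -> ex_CI f b c ->
  (CI f a b + CI f b c)%C = CI f a c.
Proof.
  intros [F1 F2] [G1 G2]. unfold CI, Cplus. simpl.
  f_equal; now apply (RInt_Chasles (V := R_CompleteNormedModule)).
Qed.

Lemma CI_const (c : C) (a b : R) : CI (fun _ => c) a b = (RtoC (b - a) * c)%C.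
Proof.
  unfold CI. rewrite !(RInt_const (V := R_CompleteNormedModule)).
  apply injective_projections; simpl; unfold scal; simpl; unfold mult; simpl; ring.
Qed.

Lemma ex_CI_const (c : C) (a b : R) : ex_CI (fun _ => c) a b.
Proof. split; apply (ex_RInt_const (V := R_NormedModule)). Qed.

Lemma CI_derive (f df : R -> C) (a b : R) :
  (forall t, Rmin a b <= t <= Rmax a b -> pder f t (df t)) -> cconts df a b ->
  CI df a b = (f b - f a)%C.
Proof.
  intros H Hc. unfold CI. apply injective_projections; simpl; apply is_RInt_unique.
  - apply (is_RInt_derive (V := R_CompleteNormedModule) (fun s => fst (f s))); intros t Ht.
    now apply H. now apply Hc.
  - apply (is_RInt_derive (V := R_CompleteNormedModule) (fun s => snd (f s))); intros t Ht.
    now apply H. now apply Hc.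
Qed.

(** With w the integral of f, |w|^2 is the real part of the integral of conj(w) f, hence at most |w|
    times the integral of g. Estimating the two components separately would lose a constant. *)
Lemma CI_norm (f : R -> C) (g : R -> R) (a b : R) :
  a <= b -> ex_CI f a b -> ex_RInt g a b -> (forall t, a < t < b -> Cmod (f t) <= g t) ->
  Cmod (CI f a b) <= RInt g a b.
Proof.
  intros Hab Hf Hg H. set (w := CI f a b).
  assert (Hg0 : 0 <= RInt g a b).
  { apply RInt_ge_0; auto. intros t Ht. eapply Rle_trans; [apply Cmod_ge_0 | now apply H]. }
  assert (E : Cmod w * Cmod w = fst (CI (fun t => Cconj w * f t)%C a b)).
  { rewrite CI_scal by auto. fold w. rewrite <- Cnorm2_Cmod. unfold Cnorm2. simpl. ring. }
  assert (Hw := Cmod_ge_0 w).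
  assert (Hl : fst (CI (fun t => Cconj w * f t)%C a b) <= RInt (fun t => Cmod w * g t) a b).
  { unfold CI; simpl fst. apply RInt_le; auto.
    - apply (ex_CI_scal (Cconj w) f a b Hf).
    - now apply (ex_RInt_scal (V := R_NormedModule)).
    - intros t Ht. eapply Rle_trans; [apply Rle_abs |].
      eapply Rle_trans; [apply (Rabs_fst_Cmod (Cconj w * f t)%C) |].
      rewrite Cmod_mult, Cmod_conj. apply Rmult_le_compat_l; auto. }
  rewrite (RInt_scal (V := R_CompleteNormedModule)) in Hl by auto.
  change (scal (Cmod w) (RInt g a b)) with (Cmod w * RInt g a b) in Hl.
  destruct Hw as [Hw | Hw]; [| now rewrite <- Hw].
  apply Rmult_le_reg_l with (Cmod w); auto. now rewrite E.
Qed.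

Lemma CI_norm_const (f : R -> C) (M a b : R) :
  a <= b -> ex_CI f a b -> (forall t, a < t < b -> Cmod (f t) <= M) ->
  Cmod (CI f a b) <= M * (b - a).
Proof.
  intros Hab Hf H. eapply Rle_trans.
  - apply (CI_norm f (fun _ => M)); auto. apply (ex_RInt_const (V := R_NormedModule)).
  - rewrite (RInt_const (V := R_CompleteNormedModule)).
    unfold scal; simpl; unfold mult; simpl. lra.
Qed.

(** * Goursat's lemma and Cauchy's formula *)

(** Compactness of a rectangle in the form of an induction principle: a rectangle without P has a
    quarter without P, and such nested quarters shrink to a point, near which P holds. It serves
    Goursat's lemma and the boundedness of holomorphic functions alike. *)
Lemma rect_ind (P : R -> R -> R -> R -> Prop) (a b c d : R) : a <= b -> c <= d ->
  (forall a' b' c' d', a <= a' -> a' <= b' -> b' <= b -> c <= c' -> c' <= d' -> d' <= d ->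
     P a' ((a' + b') / 2) c' ((c' + d') / 2) -> P ((a' + b') / 2) b' c' ((c' + d') / 2) ->
     P a' ((a' + b') / 2) ((c' + d') / 2) d' -> P ((a' + b') / 2) b' ((c' + d') / 2) d' ->
     P a' b' c' d') ->
  (forall x y, a <= x <= b -> c <= y <= d -> exists delta, 0 < delta /\
     forall a' b' c' d', a <= a' <= x -> x <= b' <= b -> c <= c' <= y -> y <= d' <= d ->
       b' - a' < delta -> d' - c' < delta -> P a' b' c' d') ->
  P a b c d.
Proof.
  intros Hab Hcd Hsplit Hloc. apply NNPP. intros Hbad.
  set (w := b - a). set (h := d - c).
  assert (Hw : 0 <= w) by (unfold w; lra). assert (Hh : 0 <= h) by (unfold h; lra).
  set (half := fun n => (1 / 2) ^ n).
  assert (Hhalf : forall n, 0 < half n) by (intros n; apply pow_lt; lra).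
  assert (HhalfS : forall n, half (S n) = half n / 2) by (intros n; unfold half; simpl; field).
  (* At stage n the sides are those of the original rectangle times 2^(-n), so the lower left corner
     p determines the rectangle. *)
  set (bad := fun n (p : R * R) =>
    a <= fst p /\ fst p + w * half n <= b /\ c <= snd p /\ snd p + h * half n <= d /\
    ~ P (fst p) (fst p + w * half n) (snd p) (snd p + h * half n)).
  set (nest := fun n (p q : R * R) =>
    fst p <= fst q /\ fst q + w * half (S n) <= fst p + w * half n /\
    snd p <= snd q /\ snd q + h * half (S n) <= snd p + h * half n).
  assert (Hstep : forall n p, bad n p -> exists q, bad (S n) q /\ nest n p q).
  { intros n [x y] (B1 & B2 & B3 & B4 & B5). simpl in *.
    pose proof (Hhalf n) as Hn. pose proof (HhalfS n) as Hs.
    assert (Ew : w * half n = 2 * (w * half (S n))) by (rewrite Hs; field).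
    assert (Eh : h * half n = 2 * (h * half (S n))) by (rewrite Hs; field).
    assert (0 <= w * half (S n)) by (apply Rmult_le_pos; [auto | left; apply Hhalf]).
    assert (0 <= h * half (S n)) by (apply Rmult_le_pos; [auto | left; apply Hhalf]).
    set (w' := w * half (S n)) in *. set (h' := h * half (S n)) in *.
    apply NNPP. intros Hno. apply B5.
    assert (Hall : forall q : R * R, nest n (x, y) q -> P (fst q) (fst q + w') (snd q) (snd q + h')).
    { intros q Hq. apply NNPP. intros HnP. apply Hno. exists q. split; auto.
      destruct Hq as (Q1 & Q2 & Q3 & Q4). simpl in *. fold w' in Q2. fold h' in Q4.
      unfold bad. fold w' h'. repeat split; auto; lra. }
    unfold nest in Hall. simpl fst in Hall. simpl snd in Hall. fold w' h' in Hall.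
    rewrite Ew, Eh in *.
    apply Hsplit; try lra.
    - replace ((x + (x + 2 * w')) / 2) with (x + w') by field.
      replace ((y + (y + 2 * h')) / 2) with (y + h') by field.
      apply (Hall (x, y)); simpl; lra.
    - replace ((x + (x + 2 * w')) / 2) with (x + w') by field.
      replace ((y + (y + 2 * h')) / 2) with (y + h') by field.
      replace (x + 2 * w') with (x + w' + w') by ring.
      apply (Hall (x + w', y)); simpl; lra.
    - replace ((x + (x + 2 * w')) / 2) with (x + w') by field.
      replace ((y + (y + 2 * h')) / 2) with (y + h') by field.
      replace (y + 2 * h') with (y + h' + h') by ring.
      apply (Hall (x, y + h')); simpl; lra.
    - replace ((x + (x + 2 * w')) / 2) with (x + w') by field.
      replace ((y + (y + 2 * h')) / 2) with (y + h') by field.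
      replace (x + 2 * w') with (x + w' + w') by ring.
      replace (y + 2 * h') with (y + h' + h') by ring.
      apply (Hall (x + w', y + h')); simpl; lra. }
  (* [epsilon] picks a bad quarter at each stage; [Hstep] guarantees that one exists. *)
  set (X := fix X n : R * R := match n with
    | O => (a, c)
    | S n => epsilon (inhabits (a, c)) (fun q => bad (S n) q /\ nest n (X n) q) end).
  assert (HX0 : bad 0%nat (X 0%nat)).
  { unfold bad, half. simpl. replace (a + w * 1) with b by (unfold w; ring).
    replace (c + h * 1) with d by (unfold h; ring). repeat split; auto; lra. }
  assert (HX : forall n, bad n (X n) /\ nest n (X n) (X (S n))).
  { assert (Hs : forall n, bad n (X n) -> bad (S n) (X (S n)) /\ nest n (X n) (X (S n))).
    { intros n Hn. simpl. apply (epsilon_spec (inhabits (a, c)) (fun q => bad (S n) q /\ nest n (X n) q)).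
      now apply Hstep. }
    intros n. assert (Hb : bad n (X n)).
    { induction n; auto. now apply Hs. }
    split; auto. now apply Hs. }
  assert (Hmono : forall n k, fst (X n) <= fst (X (n + k)%nat) /\
    fst (X (n + k)%nat) + w * half (n + k)%nat <= fst (X n) + w * half n /\
    snd (X n) <= snd (X (n + k)%nat) /\
    snd (X (n + k)%nat) + h * half (n + k)%nat <= snd (X n) + h * half n).
  { intros n k. induction k.
    - rewrite Nat.add_0_r. lra.
    - rewrite Nat.add_succ_r. destruct (HX (n + k)%nat) as [_ (N1 & N2 & N3 & N4)]. lra. }
  (* Every lower corner lies below every upper corner, so the suprema x and y of the lower corners
     belong to all the rectangles. *)
  assert (Hcross : forall n m, fst (X m) <= fst (X n) + w * half n /\
                               snd (X m) <= snd (X n) + h * half n).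
  { intros n m. destruct (Nat.le_ge_cases n m) as [L | L].
    - destruct (Hmono n (m - n)%nat) as (M1 & M2 & M3 & M4).
      replace (n + (m - n))%nat with m in * by lia.
      assert (0 <= w * half m) by (apply Rmult_le_pos; [auto | left; apply Hhalf]).
      assert (0 <= h * half m) by (apply Rmult_le_pos; [auto | left; apply Hhalf]). lra.
    - destruct (Hmono m (n - m)%nat) as (M1 & M2 & M3 & M4).
      replace (m + (n - m))%nat with n in * by lia.
      assert (0 <= w * half n) by (apply Rmult_le_pos; [auto | left; apply Hhalf]).
      assert (0 <= h * half n) by (apply Rmult_le_pos; [auto | left; apply Hhalf]). lra. }
  destruct (completeness (fun r => exists n, r = fst (X n))) as [x [Hx1 Hx2]].
  { exists (fst (X 0%nat) + w * half 0%nat). intros r [n ->]. apply Hcross. }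
  { exists (fst (X 0%nat)). now exists 0%nat. }
  destruct (completeness (fun r => exists n, r = snd (X n))) as [y [Hy1 Hy2]].
  { exists (snd (X 0%nat) + h * half 0%nat). intros r [n ->]. apply Hcross. }
  { exists (snd (X 0%nat)). now exists 0%nat. }
  assert (Hx : forall n, fst (X n) <= x <= fst (X n) + w * half n).
  { intros n. split. apply Hx1. now exists n. apply Hx2. intros r [m ->]. apply Hcross. }
  assert (Hy : forall n, snd (X n) <= y <= snd (X n) + h * half n).
  { intros n. split. apply Hy1. now exists n. apply Hy2. intros r [m ->]. apply Hcross. }
  destruct (Hloc x y) as [delta [Hd HP]].
  { destruct (HX 0%nat) as [(B1 & B2 & _) _]. specialize (Hx 0%nat). lra. }
  { destruct (HX 0%nat) as [(B1 & B2 & B3 & B4 & _) _]. specialize (Hy 0%nat). lra. }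
  destruct (pow_lt_1_zero (1 / 2)) with (y := delta / (w + h + 1)) as [n Hn].
  { rewrite Rabs_pos_eq; lra. }
  { apply Rdiv_lt_0_compat; lra. }
  specialize (Hn n (le_n n)). fold (half n) in Hn. rewrite Rabs_pos_eq in Hn by (left; apply Hhalf).
  assert (Hn' : (w + h + 1) * half n < delta).
  { apply Rlt_le_trans with ((w + h + 1) * (delta / (w + h + 1))); [| right; field; lra].
    apply Rmult_lt_compat_l; lra. }
  destruct (HX n) as [(B1 & B2 & B3 & B4 & B5) _]. apply B5.
  specialize (Hx n). specialize (Hy n). pose proof (Hhalf n). apply HP; try lra; nra.
Qed.

(** The contour integral along the boundary, counterclockwise: bottom minus top, plus i times right
    minus left. *)
Definition rect_int (F : C -> C) (a b c d : R) : C :=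
  (CI (fun x => F (x, c)) a b - CI (fun x => F (x, d)) a b
   + Ci * (CI (fun y => F (b, y)) c d - CI (fun y => F (a, y)) c d))%C.

Lemma pder_vline (x y : R) : pder (fun s => (x, s)) y Ci.
Proof. split; simpl; [apply (is_derive_const (V := R_NormedModule)) | apply (is_derive_id y)]. Qed.

Lemma cdiff_ccont_h (F : C -> C) (x y : R) (l : C) :
  cdiff F (x, y) l -> ccont (fun s => F (s, y)) x.
Proof.
  intros H. apply (pder_ccont _ _ (l * 1)%C). apply (pder_comp F (fun s => (s, y))); auto.
  apply pder_line.
Qed.

Lemma cdiff_ccont_v (F : C -> C) (x y : R) (l : C) :
  cdiff F (x, y) l -> ccont (fun s => F (x, s)) y.
Proof.
  intros H. apply (pder_ccont _ _ (l * Ci)%C). apply (pder_comp F (fun s => (x, s))); auto.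
  apply pder_vline.
Qed.

Definition cdiff_rect (F : C -> C) (a b c d : R) : Prop :=
  forall x y, a <= x <= b -> c <= y <= d -> exists l, cdiff F (x, y) l.

Lemma cdiff_rect_h (F : C -> C) (a b c d x1 x2 y : R) : cdiff_rect F a b c d ->
  a <= x1 -> x1 <= x2 -> x2 <= b -> c <= y <= d -> ex_CI (fun x => F (x, y)) x1 x2.
Proof.
  intros H H1 H2 H3 Hy. apply ex_CI_cont. intros t Ht.
  rewrite Rmin_left, Rmax_right in Ht by lra.
  destruct (H t y) as [l Hl]; [lra | auto |]. eapply cdiff_ccont_h, Hl.
Qed.

Lemma cdiff_rect_v (F : C -> C) (a b c d y1 y2 x : R) : cdiff_rect F a b c d ->
  c <= y1 -> y1 <= y2 -> y2 <= d -> a <= x <= b -> ex_CI (fun y => F (x, y)) y1 y2.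
Proof.
  intros H H1 H2 H3 Hx. apply ex_CI_cont. intros t Ht.
  rewrite Rmin_left, Rmax_right in Ht by lra.
  destruct (H x t) as [l Hl]; [auto | lra |]. eapply cdiff_ccont_v, Hl.
Qed.

Lemma rect_int_split (F : C -> C) (a b c d m n : R) : cdiff_rect F a b c d ->
  a <= m <= b -> c <= n <= d ->
  rect_int F a b c d = (rect_int F a m c n + rect_int F m b c n
                        + rect_int F a m n d + rect_int F m b n d)%C.
Proof.
  intros H Hm Hn. unfold rect_int.
  assert (Hh : forall y, c <= y <= d ->
    CI (fun x => F (x, y)) a b = (CI (fun x => F (x, y)) a m + CI (fun x => F (x, y)) m b)%C).
  { intros y Hy. symmetry. apply CI_Chasles; apply (cdiff_rect_h F a b c d); auto; lra. }
  assert (Hv : forall x, a <= x <= b ->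
    CI (fun y => F (x, y)) c d = (CI (fun y => F (x, y)) c n + CI (fun y => F (x, y)) n d)%C).
  { intros x Hx. symmetry. apply CI_Chasles; apply (cdiff_rect_v F a b c d); auto; lra. }
  rewrite (Hh c), (Hh d), (Hv a), (Hv b) by lra. ring.
Qed.

Lemma cdiff_sub (F : C -> C) (z l : C) : cdiff F z l ->
  forall eps, 0 < eps -> exists delta, 0 < delta /\ forall w : C, Cmod (w - z)%C < delta ->
    Cmod (F w - (F z + l * (w - z)))%C <= eps * Cmod (w - z)%C.
Proof.
  intros H eps He. destruct (H eps He) as [d [Hd H1]]. exists d. split; auto.
  intros w Hw. specialize (H1 (w - z)%C Hw).
  replace (z + (w - z))%C with w in H1 by ring.
  replace (F w - (F z + l * (w - z)))%C with (F w - F z - l * (w - z))%C by ring. auto.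
Qed.

(** An affine function has a primitive, the [G] below, so each side contributes a difference of
    values of [G] and these cancel around the boundary. *)
Lemma rect_int_affine (p q : C) (a b c d : R) :
  rect_int (fun z => p + q * z)%C a b c d = 0.
Proof.
  set (G := fun z : C => (p * z + q * (z * z) * (/ 2)%R)%C).
  assert (HG : forall z, cdiff G z (p + q * z)%C).
  { intros z. unfold G.
    replace (p + q * z)%C with (p * 1 + (q * (/ 2)%R) * (1 * z + z * 1))%C.
    2:{ replace (p * 1 + q * (/ 2)%R * (1 * z + z * 1))%C
          with (p + q * z * ((/ 2)%R * (1 + 1)))%C by ring.
        replace ((/ 2)%R * (1 + 1))%C with (RtoC 1)
          by (apply injective_projections; simpl; field). ring. }
    apply (cdiff_ext (fun z => p * z + (q * (/ 2)%R) * (z * z))%C); [intros; ring |].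
    apply cdiff_plus; apply cdiff_scal. apply cdiff_id.
    apply (cdiff_mult (fun w => w) (fun w => w)); apply cdiff_id. }
  assert (Hc : forall z, cdiff (fun z => p + q * z)%C z (0 + q * 1)%C).
  { intros z. apply cdiff_plus. apply cdiff_const. apply cdiff_scal, cdiff_id. }
  assert (Hh : forall y, CI (fun x => p + q * (x, y))%C a b = (G (b, y) - G (a, y))%C).
  { intros y. apply (CI_derive (fun x => G (x, y))).
    - intros t _. pose proof (pder_comp G (fun s => (s, y)) t _ _ (HG _) (pder_line t y)) as K.
      now rewrite Cmult_1_r in K.
    - intros t _. eapply (cdiff_ccont_h (fun z => p + q * z)%C), Hc. }
  assert (Hv : forall x, (Ci * CI (fun y => p + q * (x, y)) c d)%C = (G (x, d) - G (x, c))%C).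
  { intros x. rewrite <- CI_scal.
    - apply (CI_derive (fun y => G (x, y))).
      + intros t _. pose proof (pder_comp G (fun s => (x, s)) t _ _ (HG _) (pder_vline x t)) as K.
        now rewrite Cmult_comm in K.
      + intros t _. eapply (cdiff_ccont_v (fun z => Ci * (p + q * z))%C), cdiff_scal, Hc.
    - apply ex_CI_cont. intros t _. eapply (cdiff_ccont_v (fun z => p + q * z)%C), Hc. }
  unfold rect_int. rewrite !Hh.
  replace (Ci * (CI (fun y => p + q * (b, y)) c d - CI (fun y => p + q * (a, y)) c d))%C
    with (Ci * CI (fun y => p + q * (b, y)) c d - Ci * CI (fun y => p + q * (a, y)) c d)%C by ring.
  rewrite !Hv. ring.
Qed.

Lemma rect_int_bound (F : C -> C) (M a b c d : R) : cdiff_rect F a b c d ->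
  a <= b -> c <= d ->
  (forall x y, a <= x <= b -> c <= y <= d -> Cmod (F (x, y)) <= M) ->
  Cmod (rect_int F a b c d) <= 2 * M * ((b - a) + (d - c)).
Proof.
  intros H Hab Hcd HM. unfold rect_int.
  assert (H1 : Cmod (CI (fun x => F (x, c)) a b) <= M * (b - a)).
  { apply CI_norm_const; auto. apply (cdiff_rect_h F a b c d); auto; lra.
    intros; apply HM; lra. }
  assert (H2 : Cmod (CI (fun x => F (x, d)) a b) <= M * (b - a)).
  { apply CI_norm_const; auto. apply (cdiff_rect_h F a b c d); auto; lra.
    intros; apply HM; lra. }
  assert (H3 : Cmod (CI (fun y => F (a, y)) c d) <= M * (d - c)).
  { apply CI_norm_const; auto. apply (cdiff_rect_v F a b c d); auto; lra.
    intros; apply HM; lra. }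
  assert (H4 : Cmod (CI (fun y => F (b, y)) c d) <= M * (d - c)).
  { apply CI_norm_const; auto. apply (cdiff_rect_v F a b c d); auto; lra.
    intros; apply HM; lra. }
  eapply Rle_trans; [apply Cmod_triangle |]. rewrite Cmod_mult, Cmod_Ci.
  pose proof (Cmod_minus (CI (fun x => F (x, c)) a b) (CI (fun x => F (x, d)) a b)).
  pose proof (Cmod_minus (CI (fun y => F (b, y)) c d) (CI (fun y => F (a, y)) c d)).
  lra.
Qed.

Lemma rect_int_plus (F G : C -> C) (a b c d : R) : cdiff_rect F a b c d -> cdiff_rect G a b c d ->
  a <= b -> c <= d ->
  rect_int (fun z => F z + G z)%C a b c d = (rect_int F a b c d + rect_int G a b c d)%C.
Proof.
  intros HF HG Hab Hcd. unfold rect_int.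
  assert (Hh : forall y, c <= y <= d -> CI (fun x => F (x, y) + G (x, y))%C a b
    = (CI (fun x => F (x, y)) a b + CI (fun x => G (x, y)) a b)%C).
  { intros y Hy. apply CI_plus.
    apply (cdiff_rect_h F a b c d); auto; lra. apply (cdiff_rect_h G a b c d); auto; lra. }
  assert (Hv : forall x, a <= x <= b -> CI (fun y => F (x, y) + G (x, y))%C c d
    = (CI (fun y => F (x, y)) c d + CI (fun y => G (x, y)) c d)%C).
  { intros x Hx. apply CI_plus.
    apply (cdiff_rect_v F a b c d); auto; lra. apply (cdiff_rect_v G a b c d); auto; lra. }
  rewrite !Hh, !Hv by lra. ring.
Qed.

Lemma Cmod_triangle4 (p q r s : C) :
  Cmod (p + q + r + s)%C <= Cmod p + Cmod q + Cmod r + Cmod s.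
Proof.
  pose proof (Cmod_triangle (p + q + r) s). pose proof (Cmod_triangle (p + q) r).
  pose proof (Cmod_triangle p q). lra.
Qed.

(** Near a point, F differs from its affine approximation by at most eps times the size of the
    rectangle, and the affine part integrates to zero; so small rectangles satisfy a bound eps times
    the square of the half-perimeter. The square is what survives bisection: four quarters, each
    with a quarter of the bound. *)
Theorem goursat (F : C -> C) (a b c d : R) : a <= b -> c <= d ->
  cdiff_rect F a b c d -> rect_int F a b c d = 0.
Proof.
  intros Hab Hcd H. apply Cmod_eq_0. apply Rle_antisym; [| apply Cmod_ge_0].
  apply Rle_trans with (0 * ((b - a) + (d - c)) ^ 2); [| lra].
  assert (Hall : forall eps, 0 < eps -> Cmod (rect_int F a b c d) <= eps * ((b - a) + (d - c)) ^ 2).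
  { intros eps He.
    apply (rect_ind (fun a b c d => Cmod (rect_int F a b c d) <= eps * ((b - a) + (d - c)) ^ 2)); auto.
    - intros a' b' c' d' A1 A2 A3 C1 C2 C3 P1 P2 P3 P4.
      assert (H' : cdiff_rect F a' b' c' d') by (intros x y Hx Hy; apply H; lra).
      rewrite (rect_int_split F a' b' c' d' ((a' + b') / 2) ((c' + d') / 2)) by (auto; lra).
      pose proof (Cmod_triangle4 (rect_int F a' ((a' + b') / 2) c' ((c' + d') / 2))
        (rect_int F ((a' + b') / 2) b' c' ((c' + d') / 2))
        (rect_int F a' ((a' + b') / 2) ((c' + d') / 2) d')
        (rect_int F ((a' + b') / 2) b' ((c' + d') / 2) d')) as K.
      eapply Rle_trans; [exact K |].
      eapply Rle_trans; [apply Rplus_le_compat; [apply Rplus_le_compat; [apply Rplus_le_compat |] |]; eassumption |].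
      right. field.
    - intros x y Hx Hy. destruct (H x y Hx Hy) as [l Hl].
      destruct (cdiff_sub F _ _ Hl (eps / 2)) as [dl [Hd1 Hd2]]; [lra |].
      exists (dl / 2). split; [lra |].
      intros a' b' c' d' A1 A2 C1 C2 L1 L2.
      assert (Ha : a' <= b') by lra. assert (Hc : c' <= d') by lra.
      assert (H' : cdiff_rect F a' b' c' d') by (intros x' y' Hx' Hy'; apply H; lra).
      (* p + q z is minus the affine approximation of [F] at (x, y). *)
      set (p := (- (F (x, y) + l * - (x, y)))%C). set (q := (- l)%C).
      assert (Haff : cdiff_rect (fun z => p + q * z)%C a' b' c' d').
      { intros x' y' _ _. exists (0 + q * 1)%C. apply cdiff_plus. apply cdiff_const.
        apply cdiff_scal, cdiff_id. }
      replace (rect_int F a' b' c' d')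
        with (rect_int (fun z => F z + (p + q * z))%C a' b' c' d').
      2:{ rewrite (rect_int_plus F (fun z => p + q * z)%C), rect_int_affine by auto. ring. }
      eapply Rle_trans.
      + apply (rect_int_bound _ (eps / 2 * ((b' - a') + (d' - c')))); auto.
        * intros x' y' Hx' Hy'. destruct (H' x' y' Hx' Hy') as [l1 K1].
          destruct (Haff x' y' Hx' Hy') as [l2 K2]. exists (l1 + l2)%C. now apply cdiff_plus.
        * intros x' y' Hx' Hy'.
          assert (E1 : Cmod ((x', y') - (x, y))%C <= (b' - a') + (d' - c')).
          { eapply Rle_trans; [apply Cmod_le_sum |].
            change (Rabs (x' - x) + Rabs (y' - y) <= b' - a' + (d' - c')).
            apply Rplus_le_compat; apply Rabs_le; lra. }
          replace (F (x', y') + (p + q * (x', y')))%C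
            with (F (x', y') - (F (x, y) + l * ((x', y') - (x, y))))%C by (unfold p, q; ring).
          eapply Rle_trans; [apply Hd2; lra |]. apply Rmult_le_compat_l; lra.
      + right. field. }
  rewrite Rmult_0_l. apply le_epsilon. intros e He.
  set (w := ((b - a) + (d - c)) ^ 2) in *.
  assert (0 <= w) by apply pow2_ge_0.
  specialize (Hall (e / (w + 1)) ltac:(apply Rdiv_lt_0_compat; lra)).
  eapply Rle_trans; [exact Hall |]. rewrite Rplus_0_l.
  apply Rle_trans with (e / (w + 1) * (w + 1)); [| right; field; lra].
  apply Rmult_le_compat_l; [| lra]. left. apply Rdiv_lt_0_compat; lra.
Qed.

(** Continuity bounds F near each point, and the maximum of four bounds passes from the quarters to
    the whole rectangle. *)
Lemma cdiff_rect_bounded (F : C -> C) (a b c d : R) : a <= b -> c <= d ->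
  cdiff_rect F a b c d ->
  exists M, forall x y, a <= x <= b -> c <= y <= d -> Cmod (F (x, y)) <= M.
Proof.
  intros Hab Hcd H.
  apply (rect_ind (fun a b c d => exists M, forall x y, a <= x <= b -> c <= y <= d -> Cmod (F (x, y)) <= M)); auto.
  - intros a' b' c' d' _ _ _ _ _ _ [M1 P1] [M2 P2] [M3 P3] [M4 P4].
    exists (Rmax (Rmax M1 M2) (Rmax M3 M4)). intros x y Hx Hy.
    pose proof (Rmax_l (Rmax M1 M2) (Rmax M3 M4)). pose proof (Rmax_r (Rmax M1 M2) (Rmax M3 M4)).
    pose proof (Rmax_l M1 M2). pose proof (Rmax_r M1 M2).
    pose proof (Rmax_l M3 M4). pose proof (Rmax_r M3 M4).
    destruct (Rle_dec x ((a' + b') / 2)), (Rle_dec y ((c' + d') / 2)).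
    + specialize (P1 x y). lra.
    + specialize (P3 x y). lra.
    + specialize (P2 x y). lra.
    + specialize (P4 x y). lra.
  - intros x y Hx Hy. destruct (H x y Hx Hy) as [l Hl].
    destruct (cdiff_cont F _ _ Hl 1) as [dl [Hd1 Hd2]]; [lra |].
    exists (dl / 2). split; [lra |]. intros a' b' c' d' A1 A2 C1 C2 L1 L2.
    exists (Cmod (F (x, y)) + 1). intros x' y' Hx' Hy'.
    assert (E1 : Cmod ((x', y') - (x, y))%C < dl).
    { eapply Rle_lt_trans; [apply Cmod_le_sum |].
      change (Rabs (x' - x) + Rabs (y' - y) < dl).
      assert (Rabs (x' - x) <= b' - a') by (apply Rabs_le; lra).
      assert (Rabs (y' - y) <= d' - c') by (apply Rabs_le; lra). lra. }
    specialize (Hd2 _ E1).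
    replace ((x, y) + ((x', y') - (x, y)))%C with ((x', y') : C) in Hd2
      by (apply injective_projections; simpl; ring).
    pose proof (Cmod_triangle_minus (F (x', y')) (F (x, y))). lra.
Qed.

(** * The complex exponential and Cauchy's integral formula *)

Definition cexp (w : C) : C := (exp (fst w) * cos (snd w), exp (fst w) * sin (snd w)).

Definition cis (t : R) : C := (cos t, sin t).

Lemma cexp_plus (z w : C) : cexp (z + w)%C = (cexp z * cexp w)%C.
Proof.
  unfold cexp. apply injective_projections; simpl; rewrite exp_plus, ?cos_plus, ?sin_plus; ring.
Qed.

Lemma cexp_0 : cexp 0 = 1.
Proof. unfold cexp; simpl. rewrite exp_0, cos_0, sin_0. apply injective_projections; simpl; ring. Qed.

Lemma cdiff_cexp_0 : cdiff cexp 0 1.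
Proof.
  assert (De : is_derive exp 0 1) by (auto_derive; auto; rewrite exp_0; ring).
  assert (Dc : is_derive cos 0 0) by (auto_derive; auto; rewrite sin_0; ring).
  assert (Ds : is_derive sin 0 1) by (auto_derive; auto; rewrite cos_0; ring).
  intros eps He. set (e := Rmin 1 (eps / 6)).
  assert (He0 : 0 < e) by (apply Rmin_pos; lra).
  assert (He1 : e <= 1) by apply Rmin_l. assert (He2 : e <= eps / 6) by apply Rmin_r.
  destruct (is_derive_eps_inv _ _ _ De e He0) as [d1 [Hd1 H1]].
  destruct (is_derive_eps_inv _ _ _ Dc e He0) as [d2 [Hd2 H2]].
  destruct (is_derive_eps_inv _ _ _ Ds e He0) as [d3 [Hd3 H3]].
  exists (Rmin (Rmin d1 (e / 2)) (Rmin d2 d3)). split.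
  { repeat apply Rmin_pos; lra. }
  intros [a b] Hh.
  pose proof (Rmin_l (Rmin d1 (e / 2)) (Rmin d2 d3)). pose proof (Rmin_r (Rmin d1 (e / 2)) (Rmin d2 d3)).
  pose proof (Rmin_l d1 (e / 2)). pose proof (Rmin_r d1 (e / 2)).
  pose proof (Rmin_l d2 d3). pose proof (Rmin_r d2 d3).
  pose proof (Rabs_fst_Cmod (a, b)) as Ra. pose proof (Rabs_snd_Cmod (a, b)) as Rb. simpl in Ra, Rb.
  specialize (H1 a ltac:(lra)). specialize (H2 b ltac:(lra)). specialize (H3 b ltac:(lra)).
  rewrite !Rplus_0_l, ?exp_0, ?cos_0, ?sin_0 in *.
  assert (Ha0 := Rabs_pos a). assert (Hb0 := Rabs_pos b).
  assert (H1' : Rabs (exp a - 1) <= e).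
  { replace (exp a - 1) with ((exp a - 1 - 1 * a) + a) by ring.
    eapply Rle_trans; [apply Rabs_triang |]. nra. }
  assert (H1'' : Rabs (exp a) <= 2).
  { replace (exp a) with (1 + (exp a - 1)) by ring.
    eapply Rle_trans; [apply Rabs_triang |]. rewrite Rabs_R1. lra. }
  rewrite cexp_0. eapply Rle_trans; [apply Cmod_le_sum |].
  replace (fst (cexp (0 + (a, b)) - 1 - 1 * (a, b))%C)
    with ((exp a - 1 - 1 * a) + exp a * (cos b - 1 - 0 * b)).
  2:{ unfold cexp; simpl. rewrite !Rplus_0_l. ring. }
  replace (snd (cexp (0 + (a, b)) - 1 - 1 * (a, b))%C)
    with (exp a * (sin b - 0 - 1 * b) + (exp a - 1) * b).
  2:{ unfold cexp; simpl. rewrite !Rplus_0_l. ring. }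
  assert (K1 : Rabs ((exp a - 1 - 1 * a) + exp a * (cos b - 1 - 0 * b)) <= e * Rabs a + 2 * (e * Rabs b)).
  { eapply Rle_trans; [apply Rabs_triang |]. apply Rplus_le_compat; auto.
    rewrite Rabs_mult. apply Rmult_le_compat; auto using Rabs_pos. }
  assert (K2 : Rabs (exp a * (sin b - 0 - 1 * b) + (exp a - 1) * b) <= 2 * (e * Rabs b) + e * Rabs b).
  { eapply Rle_trans; [apply Rabs_triang |]. rewrite !Rabs_mult.
    apply Rplus_le_compat; apply Rmult_le_compat; auto using Rabs_pos. lra. }
  assert (e * Rabs a <= eps / 6 * Cmod (a, b)) by (apply Rmult_le_compat; lra).
  assert (e * Rabs b <= eps / 6 * Cmod (a, b)) by (apply Rmult_le_compat; lra).
  lra.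
Qed.

Lemma cdiff_shift (F : C -> C) (c z l : C) :
  cdiff F (z + c)%C l -> cdiff (fun w => F (w + c)%C) z l.
Proof.
  intros H. replace l with (l * (1 + 0))%C by ring.
  apply (cdiff_comp F (fun w => w + c)%C); auto. apply cdiff_plus. apply cdiff_id. apply cdiff_const.
Qed.

Lemma cdiff_cexp (w : C) : cdiff cexp w (cexp w).
Proof.
  apply (cdiff_ext (fun z => cexp w * cexp (z + - w))%C).
  { intros z. rewrite <- cexp_plus. f_equal. ring. }
  pose proof (cdiff_scal (cexp w) (fun z => cexp (z + - w)%C) w 1) as K.
  rewrite Cmult_1_r in K. apply K, cdiff_shift.
  replace (w + - w)%C with (RtoC 0) by ring. apply cdiff_cexp_0.
Qed.

Lemma Cmod_cis (t : R) : Cmod (cis t) = 1.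
Proof.
  unfold Cmod, cis; simpl. replace (cos t * (cos t * 1) + sin t * (sin t * 1)) with 1.
  apply sqrt_1. pose proof (sin2_cos2 t). unfold Rsqr in *. lra.
Qed.

Lemma cis_opp_r (t : R) : (cis t * cis (- t))%C = 1.
Proof.
  unfold cis. rewrite cos_neg, sin_neg. pose proof (sin2_cos2 t). unfold Rsqr in *.
  apply injective_projections; simpl; lra.
Qed.

Lemma pder_cis (t : R) : pder cis t (Ci * cis t)%C.
Proof.
  split; simpl; auto_derive; auto; ring.
Qed.

Lemma cexp_ln (r t : R) : 0 < r -> cexp (ln r, t) = (RtoC r * cis t)%C.
Proof.
  intros H. unfold cexp, cis. simpl. rewrite exp_ln by auto.
  apply injective_projections; simpl; ring.
Qed.

Lemma cexp_opp_ln (r t : R) : 0 < r -> cexp (- (ln r, t))%C = (RtoC (/ r) * cis (- t))%C.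
Proof.
  intros H. unfold cexp, cis. simpl. rewrite exp_Ropp, exp_ln by auto.
  apply injective_projections; simpl; ring.
Qed.

Definition holb (z : C) (r : R) (F : C -> C) : Prop :=
  forall w : C, Cmod (w - z)%C < r -> exists l, cdiff F w l.

(** The formula is the one for the first derivative: with w = z + r e^(it), this is r/i times the
    contour integral of F(w)/(w-z)^2 dw, hence 2 pi r F'(z). *)
Definition cauchy_int (F : C -> C) (z : C) (r : R) : C :=
  CI (fun t => F (z + RtoC r * cis t) * cis (- t))%C 0 (2 * PI).

Lemma pder_circle (z : C) (r t : R) : pder (fun t => z + RtoC r * cis t)%C t (RtoC r * (Ci * cis t))%C.
Proof.
  replace (RtoC r * (Ci * cis t))%C with ((0 + RtoC r * 1) * (Ci * cis t))%C by ring.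
  apply (pder_comp (fun w => z + RtoC r * w)%C cis). 2: apply pder_cis.
  apply cdiff_plus. apply cdiff_const. apply cdiff_scal, cdiff_id.
Qed.

Lemma pder_cis_opp (t : R) : pder (fun t => cis (- t)) t (- Ci * cis (- t))%C.
Proof.
  split; simpl; auto_derive; auto; ring.
Qed.

Lemma ccont_eps (f : R -> C) (t : R) :
  (forall eps, 0 < eps -> exists delta, 0 < delta /\
     forall h, Rabs h < delta -> Cmod (f (t + h)%R - f t)%C <= eps) -> ccont f t.
Proof.
  intros H.
  assert (K : forall p : C -> R, (forall z w, Rabs (p z - p w) <= Cmod (z - w)%C) ->
    continuous (fun s => p (f s)) t).
  { intros p Hp. apply continuity_pt_filterlim. intros e He.
    destruct (H (e / 2)) as [d [Hd H1]]; [lra |]. exists d. split; auto.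
    intros s [_ Hs]. simpl in *. unfold R_dist in *. eapply Rle_lt_trans; [apply Hp |].
    change (Rabs (s - t) < d) in Hs.
    specialize (H1 (s - t) Hs). replace (t + (s - t)) with s in H1 by ring. lra. }
  split; apply K; intros z w.
  - apply (Rabs_fst_Cmod (z - w)%C).
  - apply (Rabs_snd_Cmod (z - w)%C).
Qed.

Lemma ccont_eps_inv (f : R -> C) (t : R) : ccont f t ->
  forall eps, 0 < eps -> exists delta, 0 < delta /\
     forall h, Rabs h < delta -> Cmod (f (t + h)%R - f t)%C <= eps.
Proof.
  intros [H1 H2] eps He. apply continuity_pt_filterlim in H1. apply continuity_pt_filterlim in H2.
  destruct (H1 (eps / 2)) as [d1 [Hd1 K1]]; [lra |].
  destruct (H2 (eps / 2)) as [d2 [Hd2 K2]]; [lra |].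
  exists (Rmin d1 d2). split; [now apply Rmin_pos |]. intros h Hh.
  destruct (Req_dec h 0) as [-> | Hh0].
  { rewrite Rplus_0_r. replace (f t - f t)%C with (RtoC 0) by ring. rewrite Cmod_0. lra. }
  pose proof (Rmin_l d1 d2). pose proof (Rmin_r d1 d2).
  assert (D : D_x no_cond t (t + h)) by (split; [exact I | lra]).
  assert (E : R_dist (t + h) t = Rabs h) by (unfold R_dist; f_equal; ring).
  assert (K1' : R_dist (fst (f (t + h))) (fst (f t)) < eps / 2).
  { apply K1. split; [exact D |]. change (R_dist (t + h) t < d1). rewrite E. lra. }
  assert (K2' : R_dist (snd (f (t + h))) (snd (f t)) < eps / 2).
  { apply K2. split; [exact D |]. change (R_dist (t + h) t < d2). rewrite E. lra. }
  eapply Rle_trans; [apply Cmod_le_sum |]. unfold R_dist in *.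
  change (Rabs (fst (f (t + h)) - fst (f t)) + Rabs (snd (f (t + h)) - snd (f t)) <= eps). lra.
Qed.

Lemma ccont_plus (f g : R -> C) (t : R) : ccont f t -> ccont g t -> ccont (fun s => f s + g s)%C t.
Proof.
  intros [F1 F2] [G1 G2]. split; simpl;
  now apply (continuous_plus (V := R_NormedModule)).
Qed.

Lemma ccont_mult (f g : R -> C) (t : R) : ccont f t -> ccont g t -> ccont (fun s => f s * g s)%C t.
Proof.
  intros [F1 F2] [G1 G2]. split; simpl.
  - apply (continuous_minus (V := R_NormedModule)); now apply (continuous_mult (K := R_AbsRing)).
  - apply (continuous_plus (V := R_NormedModule)); now apply (continuous_mult (K := R_AbsRing)).
Qed.

Lemma ccont_const (c : C) (t : R) : ccont (fun _ => c) t.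
Proof. split; apply continuous_const. Qed.

Lemma circle_dist (z : C) (r t : R) : 0 <= r -> Cmod (z + RtoC r * cis t - z)%C = r.
Proof.
  intros Hr. replace (z + RtoC r * cis t - z)%C with (RtoC r * cis t)%C by ring.
  rewrite Cmod_mult, Cmod_cis, Cmod_R, Rabs_pos_eq; lra.
Qed.

Lemma cauchy_ccont (F : C -> C) (z : C) (r rr t : R) : 0 < r < rr -> holb z rr F ->
  ccont (fun t => F (z + RtoC r * cis t) * cis (- t))%C t.
Proof.
  intros Hr H. destruct (H (z + RtoC r * cis t)%C) as [l Hl].
  { rewrite circle_dist; lra. }
  apply ccont_mult.
  - eapply pder_ccont. apply (pder_comp F (fun t => z + RtoC r * cis t)%C). exact Hl. apply pder_circle.
  - eapply pder_ccont, pder_cis_opp.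
Qed.

(* Goursat's lemma on the rectangle [ln e, ln r] x [0, 2 pi] for [w |-> F (z + exp w) exp (- w)];
   the two horizontal sides cancel by periodicity. *)
Lemma cauchy_int_radius (F : C -> C) (z : C) (e r rr : R) : 0 < e <= r -> r < rr -> holb z rr F ->
  (RtoC (/ r) * cauchy_int F z r)%C = (RtoC (/ e) * cauchy_int F z e)%C.
Proof.
  intros He Hr H. set (G := fun w => (F (z + cexp w) * cexp (- w))%C).
  assert (Hln : ln e <= ln r).
  { destruct (Req_dec e r) as [-> | N]; [lra |]. left. apply ln_increasing; lra. }
  pose proof PI_RGT_0 as HPI.
  assert (HG : cdiff_rect G (ln e) (ln r) 0 (2 * PI)).
  { intros x y Hx Hy. destruct (H (z + cexp (x, y))%C) as [l Hl].
    - replace (z + cexp (x, y) - z)%C with (cexp (x, y)) by ring.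
      rewrite <- (ln_exp x). rewrite cexp_ln by apply exp_pos.
      rewrite Cmod_mult, Cmod_cis, Cmod_R, Rabs_pos_eq by (left; apply exp_pos).
      apply Rle_lt_trans with r; [| lra]. rewrite <- (exp_ln r) by lra.
      destruct (Req_dec x (ln r)) as [-> | N]; [lra |]. rewrite Rmult_1_r. left. apply exp_increasing. lra.
    - eexists. apply (cdiff_mult (fun w => F (z + cexp w))%C (fun w => cexp (- w))%C).
      + apply (cdiff_comp F (fun w => z + cexp w)%C). exact Hl.
        apply cdiff_plus. apply cdiff_const. apply cdiff_cexp.
      + apply (cdiff_comp cexp (fun w => - w)%C). apply cdiff_cexp.
        apply (cdiff_ext (fun w => (- (1)) * w)%C); [intros; ring |].
        apply cdiff_scal, cdiff_id. }
  assert (K := goursat G (ln e) (ln r) 0 (2 * PI) Hln ltac:(lra) HG).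
  unfold rect_int in K.
  assert (E1 : CI (fun x => G (x, 2 * PI)) (ln e) (ln r) = CI (fun x => G (x, 0)) (ln e) (ln r)).
  { apply CI_ext. intros x _. unfold G, cexp. simpl.
    rewrite sin_neg, cos_neg, Ropp_0, sin_2PI, cos_2PI, sin_0, cos_0.
    replace (- 0) with 0 by ring. reflexivity. }
  assert (E2 : forall s, 0 < s <= r -> CI (fun y => G (ln s, y)) 0 (2 * PI) = (RtoC (/ s) * cauchy_int F z s)%C).
  { intros s Hs. unfold cauchy_int. rewrite <- CI_scal.
    - apply CI_ext. intros t _. unfold G. rewrite cexp_ln, cexp_opp_ln by lra. ring.
    - apply ex_CI_cont. intros t _. apply (cauchy_ccont F z s rr); auto; lra. }
  rewrite E1, !E2 in K by lra.
  apply (f_equal (Cmult (- Ci))) in K.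
  replace (- Ci * (CI (fun x => G (x, 0)) (ln e) (ln r) - CI (fun x => G (x, 0)) (ln e) (ln r)
    + Ci * (RtoC (/ r) * cauchy_int F z r - RtoC (/ e) * cauchy_int F z e)))%C
    with (RtoC (/ r) * cauchy_int F z r - RtoC (/ e) * cauchy_int F z e)%C in K.
  2:{ apply injective_projections; simpl; ring. }
  replace (RtoC (/ r) * cauchy_int F z r)%C
    with (RtoC (/ r) * cauchy_int F z r - RtoC (/ e) * cauchy_int F z e + RtoC (/ e) * cauchy_int F z e)%C by ring.
  rewrite K. ring.
Qed.

(** Since [cauchy_int F z e] divided by e does not depend on e, it can be computed for e tending to
    0 from the first-order expansion at z: the constant term is killed by the mean of e^(-it), and
    the linear term contributes 2 pi l. *)
Theorem cauchy_formula (F : C -> C) (z l : C) (r rr : R) : 0 < r < rr -> holb z rr F ->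
  cdiff F z l -> cauchy_int F z r = (RtoC (2 * PI * r) * l)%C.
Proof.
  intros Hr H Hl. pose proof PI_RGT_0 as HPI.
  assert (K : (RtoC (/ r) * cauchy_int F z r - RtoC (2 * PI) * l)%C = 0).
  { apply Cmod_eq_0, Rle_antisym; [| apply Cmod_ge_0]. apply le_epsilon. intros eps He.
    rewrite Rplus_0_l.
    destruct (Hl (eps / (2 * PI))) as [d [Hd H1]]; [apply Rdiv_lt_0_compat; lra |].
    set (e := Rmin r (d / 2)). assert (He0 : 0 < e) by (apply Rmin_pos; lra).
    assert (He1 : e <= r) by apply Rmin_l. assert (He2 : e <= d / 2) by apply Rmin_r.
    rewrite (cauchy_int_radius F z e r rr) by (auto; lra).
    set (g := fun t => ((F (z + RtoC e * cis t) - F z - l * (RtoC e * cis t)) * cis (- t))%C).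
    assert (Hg : cconts g 0 (2 * PI)).
    { intros t _. unfold g. apply ccont_mult; [| eapply pder_ccont, pder_cis_opp].
      destruct (H (z + RtoC e * cis t)%C) as [l' Hl']; [rewrite circle_dist; lra |].
      apply ccont_plus; [apply ccont_plus |].
      - eapply pder_ccont. apply (pder_comp F (fun t => z + RtoC e * cis t)%C). exact Hl'. apply pder_circle.
      - apply ccont_const.
      - eapply pder_ccont. apply (pder_comp (fun w => - (l * (RtoC e * w)))%C cis); [| apply pder_cis].
        apply (cdiff_ext (fun w => (- l * RtoC e) * w)%C); [intros; ring |]. apply cdiff_scal, cdiff_id. }
    assert (I1 : ex_CI (fun t => cis (- t)) 0 (2 * PI)).
    { apply ex_CI_cont. intros t _. eapply pder_ccont, pder_cis_opp. }
    assert (I2 : CI (fun t => cis (- t)) 0 (2 * PI) = 0).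
    { rewrite (CI_ext _ (fun t => Ci * (- Ci * cis (- t)))%C)
        by (intros t _; apply injective_projections; simpl; ring).
      rewrite CI_scal.
      - rewrite (CI_derive (fun t => cis (- t))).
        + replace (cis (- (2 * PI))) with (cis (- 0)). ring.
          unfold cis. now rewrite Ropp_0, cos_neg, sin_neg, cos_2PI, sin_2PI, cos_0, sin_0, Ropp_0.
        + intros t _. apply pder_cis_opp.
        + intros t _. apply ccont_mult. apply ccont_const. eapply pder_ccont, pder_cis_opp.
      - apply ex_CI_scal; auto. }
    assert (E : cauchy_int F z e = (CI g 0 (2 * PI) + RtoC (2 * PI) * (l * RtoC e))%C).
    { unfold cauchy_int. rewrite (CI_ext _ (fun t => (g t + F z * cis (- t)) + l * RtoC e)%C).
      - rewrite CI_plus, CI_plus, CI_scal, CI_const, I2; auto using ex_CI_cont, ex_CI_scal, ex_CI_const.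
        + replace (2 * PI - 0) with (2 * PI) by ring. ring.
        + apply ex_CI_plus; auto using ex_CI_cont, ex_CI_scal.
      - intros t _. unfold g. rewrite <- (Cmult_1_r (l * RtoC e)), <- (cis_opp_r t). ring. }
    rewrite E.
    replace (RtoC (/ e) * (CI g 0 (2 * PI) + RtoC (2 * PI) * (l * RtoC e)) - RtoC (2 * PI) * l)%C
      with (RtoC (/ e) * CI g 0 (2 * PI))%C.
    2:{ replace (RtoC (/ e) * (CI g 0 (2 * PI) + RtoC (2 * PI) * (l * RtoC e)))%C
          with (RtoC (/ e) * CI g 0 (2 * PI) + RtoC (2 * PI) * l * (RtoC (/ e) * RtoC e))%C by ring.
        rewrite <- RtoC_mult, Rinv_l by lra. ring. }
    rewrite Cmod_mult, Cmod_R, Rabs_pos_eq by (left; now apply Rinv_0_lt_compat).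
    apply Rle_trans with (/ e * (eps / (2 * PI) * e * (2 * PI - 0))); [| right; field; lra].
    apply Rmult_le_compat_l; [left; now apply Rinv_0_lt_compat |].
    apply CI_norm_const; [lra | now apply ex_CI_cont |].
    intros t _. unfold g. rewrite Cmod_mult, Cmod_cis, Rmult_1_r.
    assert (Em : Cmod (RtoC e * cis t)%C = e).
    { rewrite Cmod_mult, Cmod_cis, Cmod_R, Rabs_pos_eq; lra. }
    specialize (H1 (RtoC e * cis t)%C). rewrite Em in H1. apply H1. lra. }
  replace (cauchy_int F z r) with (RtoC r * (RtoC (/ r) * cauchy_int F z r - RtoC (2 * PI) * l)
     + RtoC (2 * PI * r) * l)%C.
  { rewrite K. ring. }
  rewrite (RtoC_mult (2 * PI) r).
  replace (RtoC r * (RtoC (/ r) * cauchy_int F z r - RtoC (2 * PI) * l) + RtoC (2 * PI) * RtoC r * l)%C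
    with ((RtoC r * RtoC (/ r)) * cauchy_int F z r)%C by ring.
  replace (RtoC r * RtoC (/ r))%C with (RtoC 1); [ring |].
  rewrite <- RtoC_mult. f_equal. field. lra.
Qed.

(** The circles of Cauchy's formula have radii strictly below rr, so the estimate at rr itself is
    obtained as a limit. *)
Lemma cauchy_bound (F : C -> C) (z l : C) (S rr : R) : 0 < rr -> holb z rr F -> cdiff F z l ->
  (forall w : C, Cmod (w - z)%C < rr -> Cmod (F w) <= S) -> Cmod l <= S / rr.
Proof.
  intros Hrr H Hl HS. pose proof PI_RGT_0 as HPI.
  assert (K : forall r, 0 < r < rr -> r * Cmod l <= S).
  { intros r Hr. apply Rmult_le_reg_l with (2 * PI); [lra |].
    replace (2 * PI * (r * Cmod l)) with (Cmod (cauchy_int F z r)).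
    2:{ rewrite (cauchy_formula F z l r rr), Cmod_mult, Cmod_R, Rabs_pos_eq; auto; [lra |].
        apply Rmult_le_pos; lra. }
    replace (2 * PI * S) with (S * (2 * PI - 0)) by ring.
    apply CI_norm_const; [lra | |].
    - apply ex_CI_cont. intros t _. now apply (cauchy_ccont F z r rr).
    - intros t _. rewrite Cmod_mult, Cmod_cis, Rmult_1_r. apply HS. rewrite circle_dist; lra. }
  apply Rmult_le_reg_r with rr; auto. replace (S / rr * rr) with S by (field; lra).
  apply Rnot_lt_le. intros N.
  assert (Hl0 := Cmod_ge_0 l). assert (K2 := K (rr / 2) ltac:(lra)).
  assert (Hlp : 0 < Cmod l) by nra.
  assert (HS0 : 0 <= S) by nra.
  (* Were the claim false, this radius would lie strictly between S/|l| and rr, contradicting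
     [K]. *)
  set (r := (S / Cmod l + rr) / 2).
  assert (Hq : S / Cmod l < rr).
  { apply Rmult_lt_reg_r with (Cmod l); auto. replace (S / Cmod l * Cmod l) with S by (field; lra). lra. }
  assert (Hq0 : 0 <= S / Cmod l) by (apply Rdiv_le_0_compat; auto).
  specialize (K r ltac:(unfold r; lra)).
  assert (S / Cmod l * Cmod l < r * Cmod l) by (apply Rmult_lt_compat_r; unfold r; lra).
  replace (S / Cmod l * Cmod l) with S in * by (field; lra). lra.
Qed.

(** * Mean value inequalities, Cauchy estimates and holomorphy of the derivative *)

Lemma derive_nonpos_le (f df : R -> R) (a b : R) : a <= b ->
  (forall t, a < t < b -> is_derive f t (df t) /\ df t <= 0) ->
  (forall t, a <= t <= b -> continuous f t) -> f b <= f a.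
Proof.
  intros Hab Hd Hc.
  (* The mean value point may be an endpoint, where nothing is known about [df]; the default 0 has
     the right sign there. *)
  destruct (MVT_gen f a b (fun t => if Rlt_dec a t then if Rlt_dec t b then df t else 0 else 0))
    as [c [_ E]].
  - rewrite Rmin_left, Rmax_right by lra. intros t Ht.
    destruct (Rlt_dec a t), (Rlt_dec t b); try lra. now apply Hd.
  - rewrite Rmin_left, Rmax_right by lra. intros t Ht. apply continuity_pt_filterlim. now apply Hc.
  - cut ((if Rlt_dec a c then if Rlt_dec c b then df c else 0 else 0) <= 0); [nra |].
    destruct (Rlt_dec a c), (Rlt_dec c b); try lra. apply Hd. lra.
Qed.

(** Projecting onto the direction e = f(b) - f(a) reduces to real functions: Re(conj(e) f) - |e| g
    is nonincreasing. *)
Lemma pder_mvt (f df : R -> C) (g dg : R -> R) (a b : R) : a <= b ->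
  (forall t, a < t < b -> pder f t (df t) /\ is_derive g t (dg t) /\ Cmod (df t) <= dg t) ->
  (forall t, a <= t <= b -> ccont f t /\ continuous g t) ->
  Cmod (f b - f a)%C <= g b - g a.
Proof.
  intros Hab Hd Hc. set (e := (f b - f a)%C).
  assert (K1 : - g b <= - g a).
  { apply (derive_nonpos_le (fun t => - g t) (fun t => - dg t)); auto.
    - intros t Ht. destruct (Hd t Ht) as (_ & D & B). split.
      now apply (is_derive_opp (V := R_NormedModule) g). pose proof (Cmod_ge_0 (df t)). lra.
    - intros t Ht. apply (continuous_opp (V := R_NormedModule) g). now apply Hc. }
  assert (K2 : fst e * fst (f b) + snd e * snd (f b) - Cmod e * g b
            <= fst e * fst (f a) + snd e * snd (f a) - Cmod e * g a).
  { apply (derive_nonpos_le (fun s => fst e * fst (f s) + snd e * snd (f s) - Cmod e * g s)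
      (fun t => fst e * fst (df t) + snd e * snd (df t) - Cmod e * dg t)); auto.
    - intros t Ht. destruct (Hd t Ht) as ([D1 D2] & D3 & B). split.
      + apply (is_derive_minus (V := R_NormedModule)
          (fun s => fst e * fst (f s) + snd e * snd (f s)) (fun s => Cmod e * g s)).
        * apply (is_derive_plus (V := R_NormedModule)
            (fun s => fst e * fst (f s)) (fun s => snd e * snd (f s))).
          now apply (is_derive_scal (fun s => fst (f s))).
          now apply (is_derive_scal (fun s => snd (f s))).
        * now apply (is_derive_scal g).
      + pose proof (Rabs_fst_Cmod (Cconj e * df t)%C) as K. rewrite Cmod_mult, Cmod_conj in K.
        change (Rabs (fst e * fst (df t) - - snd e * snd (df t)) <= Cmod e * Cmod (df t)) in K.
        pose proof (Rle_abs (fst e * fst (df t) - - snd e * snd (df t))).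
        pose proof (Rmult_le_compat_l (Cmod e) _ _ (Cmod_ge_0 e) B). lra.
    - intros t Ht. destruct (Hc t Ht) as [[D1 D2] D3].
      apply (continuous_minus (V := R_NormedModule)
          (fun s => fst e * fst (f s) + snd e * snd (f s)) (fun s => Cmod e * g s)).
      + apply (continuous_plus (V := R_NormedModule)
            (fun s => fst e * fst (f s)) (fun s => snd e * snd (f s))).
        now apply (continuous_scal_r (V := R_NormedModule) (fst e) (fun s => fst (f s))).
        now apply (continuous_scal_r (V := R_NormedModule) (snd e) (fun s => snd (f s))).
      + now apply (continuous_scal_r (V := R_NormedModule) (Cmod e) g). }
  assert (E : Cmod e * Cmod e = fst e * (fst (f b) - fst (f a)) + snd e * (snd (f b) - snd (f a))).
  { rewrite <- Cnorm2_Cmod. unfold Cnorm2, e. simpl. ring. }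
  pose proof (Cmod_ge_0 e) as He. destruct He as [He | He]; [| lra].
  apply Rmult_le_reg_l with (Cmod e); auto. lra.
Qed.

Lemma pder_affine (z h : C) (t : R) : pder (fun s => z + RtoC s * h)%C t h.
Proof.
  split; simpl; auto_derive; auto; ring.
Qed.

Lemma continuous_scal_id (K t : R) : continuous (fun s => K * s) t.
Proof.
  apply (ex_derive_continuous (K := R_AbsRing) (V := R_NormedModule)). auto_derive. auto.
Qed.

Lemma segment_dist (z h : C) (s : R) : 0 <= s <= 1 -> Cmod (z + RtoC s * h - z)%C <= Cmod h.
Proof.
  intros Hs. replace (z + RtoC s * h - z)%C with (RtoC s * h)%C by ring.
  rewrite Cmod_mult, Cmod_R, Rabs_pos_eq by lra. pose proof (Cmod_ge_0 h). nra.
Qed.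

Lemma segment_mvt (F dF : C -> C) (z h : C) (K : R) :
  (forall w, Cmod (w - z)%C <= Cmod h -> cdiff F w (dF w) /\ Cmod (dF w) <= K) ->
  Cmod (F (z + h) - F z)%C <= K * Cmod h.
Proof.
  intros H. set (g := fun s => F (z + RtoC s * h)%C).
  assert (Hg : forall t, 0 <= t <= 1 -> pder g t (dF (z + RtoC t * h) * h)%C).
  { intros t Ht. apply (pder_comp F (fun s => z + RtoC s * h)%C); [| apply pder_affine].
    apply H. now apply segment_dist. }
  replace (F (z + h)%C) with (g 1) by (unfold g; f_equal; ring).
  replace (F z) with (g 0) by (unfold g; f_equal; ring).
  replace (K * Cmod h) with (K * Cmod h * 1 - K * Cmod h * 0) by ring.
  apply (pder_mvt g (fun t => dF (z + RtoC t * h) * h)%C (fun t => K * Cmod h * t) (fun _ => K * Cmod h)).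
  - lra.
  - intros t Ht. split; [| split]. apply Hg; lra.
    + auto_derive; auto. ring.
    + rewrite Cmod_mult. apply Rmult_le_compat_r; [apply Cmod_ge_0 |].
      apply H. apply segment_dist; lra.
  - intros t Ht. split. eapply pder_ccont, Hg; lra. apply continuous_scal_id.
Qed.

Lemma holb_Cd (z : C) (r : R) (F : C -> C) : holb z r F ->
  forall w : C, Cmod (w - z)%C < r -> cdiff F w (Cd F w).
Proof.
  intros H w Hw. destruct (H w Hw) as [l Hl]. now rewrite (cdiff_Cd _ _ _ Hl).
Qed.

Lemma holb_sub (z w : C) (r r' : R) (F : C -> C) : holb z r F -> Cmod (w - z)%C + r' <= r -> holb w r' F.
Proof.
  intros H Hr v Hv. apply H. replace (v - z)%C with ((v - w) + (w - z))%C by ring.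
  eapply Rle_lt_trans; [apply Cmod_triangle |]. lra.
Qed.

Lemma Cmod_dist_triangle (u v w : C) : Cmod (u - w)%C <= Cmod (u - v)%C + Cmod (v - w)%C.
Proof.
  replace (u - w)%C with ((u - v) + (v - w))%C by ring. apply Cmod_triangle.
Qed.

Lemma Cd_bound (F : C -> C) (z : C) (S rr r : R) : 0 < rr -> holb z r F ->
  (forall w : C, Cmod (w - z)%C < r -> Cmod (F w) <= S) ->
  forall w, Cmod (w - z)%C + rr <= r -> Cmod (Cd F w) <= S / rr.
Proof.
  intros Hrr H HS w Hw.
  apply (cauchy_bound F w); auto.
  - eapply holb_sub; eauto.
  - apply (holb_Cd z r); auto. lra.
  - intros v Hv. apply HS. pose proof (Cmod_dist_triangle v w z). lra.
Qed.

(** A second derivative is not yet available. Instead, the increment F(w+k) - F(w) is at most S|k|/d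
    on the disc of radius 2d by the mean value inequality, and Cauchy's estimate applied to this
    increment bounds the increment of F'. *)
Lemma Cd_lipschitz (F : C -> C) (z : C) (S d : R) : 0 < d -> holb z (4 * d) F ->
  (forall w : C, Cmod (w - z)%C < 4 * d -> Cmod (F w) <= S) ->
  forall k : C, Cmod k < d -> Cmod (Cd F (z + k) - Cd F z)%C <= S / (d * d) * Cmod k.
Proof.
  intros Hd H HS k Hk.
  assert (HC : forall w, Cmod (w - z)%C <= 3 * d -> Cmod (Cd F w) <= S / d).
  { intros w Hw. apply (Cd_bound F z S d (4 * d)); auto. lra. }
  assert (E0 : Cmod (z - z)%C = 0) by (replace (z - z)%C with (RtoC 0) by ring; apply Cmod_0).
  assert (Hk0 := Cmod_ge_0 k).
  set (G := fun w => (F (w + k) - F w)%C).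
  assert (HG : forall w, Cmod (w - z)%C < 2 * d -> cdiff G w (Cd F (w + k) - Cd F w)%C).
  { intros w Hw. apply cdiff_minus.
    - apply cdiff_shift. apply (holb_Cd z (4 * d)); auto.
      pose proof (Cmod_dist_triangle (w + k)%C w z). replace (w + k - w)%C with k in * by ring. lra.
    - apply (holb_Cd z (4 * d)); auto. lra. }
  apply Rle_trans with (S / d * Cmod k / (2 * d)).
  - apply (cauchy_bound G z).
    + lra.
    + intros w Hw. eexists. now apply HG.
    + apply HG. lra.
    + intros w Hw. unfold G. apply (segment_mvt F (Cd F)). intros v Hv.
      pose proof (Cmod_dist_triangle v w z). split.
      * apply (holb_Cd z (4 * d)); auto. lra.
      * apply HC. lra.
  - assert (HS0 : 0 <= S).
    { eapply Rle_trans; [apply (Cmod_ge_0 (F z)) |]. apply HS. lra. }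
    replace (S / d * Cmod k / (2 * d)) with (S / (d * d) * Cmod k / 2) by (field; lra).
    assert (0 <= S / (d * d)) by (apply Rdiv_le_0_compat; nra). nra.
Qed.

(** Mean value inequality for F(w) - F'(z) w, whose derivative F'(w) - F'(z) is small by the
    Lipschitz bound. The constant depends only on S and d, which makes the estimate usable under
    integrals and limits. *)
Lemma taylor2_bound (F : C -> C) (z : C) (S d : R) : 0 < d -> holb z (4 * d) F ->
  (forall w : C, Cmod (w - z)%C < 4 * d -> Cmod (F w) <= S) ->
  forall h : C, Cmod h < d -> Cmod (F (z + h) - F z - Cd F z * h)%C <= S / (d * d) * (Cmod h * Cmod h).
Proof.
  intros Hd H HS h Hh. assert (Hh0 := Cmod_ge_0 h).
  set (G := fun w => (F w - Cd F z * w)%C).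
  replace (F (z + h) - F z - Cd F z * h)%C with (G (z + h) - G z)%C by (unfold G; ring).
  rewrite <- Rmult_assoc.
  apply (segment_mvt G (fun w => Cd F w - Cd F z * 1)%C). intros w Hw. split.
  - apply cdiff_minus. apply (holb_Cd z (4 * d)); auto. lra. apply cdiff_scal, cdiff_id.
  - assert (HS0 : 0 <= S).
    { eapply Rle_trans; [apply (Cmod_ge_0 (F w)) |]. apply HS. lra. }
    pose proof (Cd_lipschitz F z S d Hd H HS (w - z)%C) as K.
    replace (z + (w - z))%C with w in K by ring. rewrite Cmult_1_r.
    eapply Rle_trans; [apply K; lra |]. apply Rmult_le_compat_l; auto. apply Rdiv_le_0_compat; nra.
Qed.

Lemma cdiff_taylor2 (F : C -> C) (z l : C) (K d : R) : 0 < d ->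
  (forall h : C, Cmod h < d -> Cmod (F (z + h) - F z - l * h)%C <= K * (Cmod h * Cmod h)) ->
  cdiff F z l.
Proof.
  intros Hd H eps He. pose proof (Rabs_pos K) as HK.
  exists (Rmin d (eps / (1 + Rabs K))). split.
  { apply Rmin_pos; auto. apply Rdiv_lt_0_compat; lra. }
  intros h Hh. pose proof (Rmin_l d (eps / (1 + Rabs K))). pose proof (Rmin_r d (eps / (1 + Rabs K))).
  eapply Rle_trans; [apply H; lra |]. assert (Hh0 := Cmod_ge_0 h).
  rewrite <- Rmult_assoc. apply Rmult_le_compat_r; auto.
  apply Rle_trans with ((1 + Rabs K) * (eps / (1 + Rabs K))); [| right; field; lra].
  pose proof (Rle_abs K).
  apply Rle_trans with ((1 + Rabs K) * Cmod h); [apply Rmult_le_compat_r; lra |].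
  apply Rmult_le_compat_l; lra.
Qed.

(** Cauchy's formula writes F'(z+h) as an integral of F over a circle about z+h; [taylor2_bound] is
    uniform along the circle, so the formula can be differentiated under the integral sign. The
    radius 6d leaves a disc of radius 4d about every point within 2d of z. *)
Lemma holb_Cd_diff (F : C -> C) (z : C) (S d : R) : 0 < d -> holb z (6 * d) F ->
  (forall w : C, Cmod (w - z)%C < 6 * d -> Cmod (F w) <= S) -> exists l, cdiff (Cd F) z l.
Proof.
  intros Hd H HS. pose proof PI_RGT_0 as HPI.
  assert (Hloc : forall w, Cmod (w - z)%C < 2 * d -> holb w (4 * d) F).
  { intros w Hw. eapply holb_sub; eauto. lra. }
  assert (HlocS : forall w, Cmod (w - z)%C < 2 * d -> forall v, Cmod (v - w)%C < 4 * d -> Cmod (F v) <= S).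
  { intros w Hw v Hv. apply HS. pose proof (Cmod_dist_triangle v w z). lra. }
  assert (HS0 : 0 <= S).
  { eapply Rle_trans; [apply (Cmod_ge_0 (F z)) |]. apply HS.
    replace (z - z)%C with (RtoC 0) by ring. rewrite Cmod_0. lra. }
  assert (HSd : 0 <= S / (d * d)) by (apply Rdiv_le_0_compat; nra).
  assert (Hformula : forall h : C, Cmod h < d ->
    cauchy_int F (z + h)%C d = (RtoC (2 * PI * d) * Cd F (z + h))%C).
  { intros h Hh. apply (cauchy_formula F _ _ d (2 * d)); [lra | |].
    - apply (holb_sub z _ (6 * d)); auto. replace (z + h - z)%C with h by ring. lra.
    - apply (holb_Cd z (6 * d)); auto. replace (z + h - z)%C with h by ring. lra. }
  assert (HcC : forall t, ccont (fun t => Cd F (z + RtoC d * cis t) * cis (- t))%C t).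
  { intros t. apply ccont_mult; [| eapply pder_ccont, pder_cis_opp].
    apply ccont_eps. intros eps He.
    destruct (ccont_eps_inv (fun t => z + RtoC d * cis t)%C t (pder_ccont _ _ _ (pder_circle z d t))
      (Rmin (d / 2) (eps / (1 + S / (d * d))))) as [dl [Hdl Hc]].
    { apply Rmin_pos; [lra | apply Rdiv_lt_0_compat; lra]. }
    exists dl. split; auto. intros h Hh. specialize (Hc h Hh). cbv beta in Hc.
    set (w := (z + RtoC d * cis t)%C) in *. set (k := (z + RtoC d * cis (t + h) - w)%C) in *.
    pose proof (Rmin_l (d / 2) (eps / (1 + S / (d * d)))).
    pose proof (Rmin_r (d / 2) (eps / (1 + S / (d * d)))).
    replace (z + RtoC d * cis (t + h))%C with (w + k)%C by (unfold k; ring).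
    assert (Hw : Cmod (w - z)%C < 2 * d) by (unfold w; rewrite circle_dist; lra).
    eapply Rle_trans; [apply (Cd_lipschitz F w S d Hd (Hloc w Hw) (HlocS w Hw)) |].
    { eapply Rle_lt_trans; [exact Hc |]. lra. }
    set (q := S / (d * d)) in *. apply Rle_trans with ((1 + q) * (eps / (1 + q))); [| right; field; lra].
    apply Rmult_le_compat; try apply Cmod_ge_0; lra. }
  set (I := CI (fun t => Cd F (z + RtoC d * cis t) * cis (- t))%C 0 (2 * PI)).
  exists (RtoC (/ (2 * PI * d)) * I)%C.
  apply (cdiff_taylor2 _ _ _ (S / (d * d) / d) d Hd). intros h Hh.
  assert (Hc : forall k : C, Cmod k < d -> forall t, ccont (fun t => F (z + k + RtoC d * cis t) * cis (- t))%C t).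
  { intros k Hk t. apply (cauchy_ccont F (z + k)%C d (2 * d)); [lra |].
    apply (holb_sub z _ (6 * d)); auto. replace (z + k - z)%C with k by ring. lra. }
  assert (Ediv : forall w : C, w = (RtoC (/ (2 * PI * d)) * (RtoC (2 * PI * d) * w))%C).
  { intros w. rewrite Cmult_assoc, <- RtoC_mult, Rinv_l, Cmult_1_l; auto. nra. }
  rewrite (Ediv (Cd F (z + h)%C)), <- Hformula by auto.
  rewrite (Ediv (Cd F z)). replace (Cd F z) with (Cd F (z + 0)%C) by (f_equal; ring).
  rewrite <- Hformula by (rewrite Cmod_0; auto).
  set (g := fun t => ((F (z + h + RtoC d * cis t) * cis (- t)
    + (- (1)) * (F (z + 0 + RtoC d * cis t) * cis (- t))) + (- h) * (Cd F (z + RtoC d * cis t) * cis (- t)))%C).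
  assert (E : (cauchy_int F (z + h) d - cauchy_int F (z + 0) d - I * h)%C = CI g 0 (2 * PI)).
  { assert (X1 : ex_CI (fun t => F (z + h + RtoC d * cis t) * cis (- t))%C 0 (2 * PI)).
    { apply ex_CI_cont. intros t _. now apply Hc. }
    assert (X2 : ex_CI (fun t => F (z + 0 + RtoC d * cis t) * cis (- t))%C 0 (2 * PI)).
    { apply ex_CI_cont. intros t _. apply Hc. rewrite Cmod_0; auto. }
    assert (X3 : ex_CI (fun t => Cd F (z + RtoC d * cis t) * cis (- t))%C 0 (2 * PI)).
    { apply ex_CI_cont. intros t _. now apply HcC. }
    unfold g. rewrite CI_plus, CI_plus, !CI_scal; auto using ex_CI_plus, ex_CI_scal.
    unfold I, cauchy_int. ring. }
  replace (RtoC (/ (2 * PI * d)) * cauchy_int F (z + h) d - RtoC (/ (2 * PI * d)) * cauchy_int F (z + 0) d -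
    RtoC (/ (2 * PI * d)) * I * h)%C with
    (RtoC (/ (2 * PI * d)) * (cauchy_int F (z + h) d - cauchy_int F (z + 0) d - I * h))%C by ring.
  rewrite E, Cmod_mult, Cmod_R, Rabs_pos_eq.
  2:{ left. apply Rinv_0_lt_compat. nra. }
  apply Rle_trans with (/ (2 * PI * d) * (S / (d * d) * (Cmod h * Cmod h) * (2 * PI - 0))).
  - apply Rmult_le_compat_l. left. apply Rinv_0_lt_compat; nra.
    apply CI_norm_const; [lra | |].
    + apply ex_CI_cont. intros t _. apply ccont_plus; [apply ccont_plus |].
      * now apply Hc.
      * apply ccont_mult. apply ccont_const. apply Hc. rewrite Cmod_0; auto.
      * apply ccont_mult. apply ccont_const. apply HcC.
    + intros t _. unfold g. set (w := (z + RtoC d * cis t)%C).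
      replace (z + h + RtoC d * cis t)%C with (w + h)%C by (unfold w; ring).
      replace (z + 0 + RtoC d * cis t)%C with w by (unfold w; ring).
      replace (F (w + h) * cis (- t) + (- (1)) * (F w * cis (- t)) + - h * (Cd F w * cis (- t)))%C
        with ((F (w + h) - F w - Cd F w * h) * cis (- t))%C by ring.
      rewrite Cmod_mult, Cmod_cis, Rmult_1_r.
      assert (Hw : Cmod (w - z)%C < 2 * d) by (unfold w; rewrite circle_dist; lra).
      apply (taylor2_bound F w S d Hd (Hloc w Hw) (HlocS w Hw)); auto.
  - right. field. split; nra.
Qed.

(** * Holomorphic functions on strips *)

Definition hol (s : R) (F : C -> C) : Prop := forall z : C, Rabs (snd z) < s -> exists l, cdiff F z l.

Lemma hol_cdiff (s : R) (F : C -> C) : hol s F -> forall z : C, Rabs (snd z) < s -> cdiff F z (Cd F z).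
Proof.
  intros H z Hz. destruct (H z Hz) as [l Hl]. now rewrite (cdiff_Cd _ _ _ Hl).
Qed.

Lemma hol_intro (s : R) (F dF : C -> C) : (forall z : C, Rabs (snd z) < s -> cdiff F z (dF z)) ->
  hol s F /\ forall z : C, Rabs (snd z) < s -> Cd F z = dF z.
Proof.
  intros H. split; intros z Hz. exists (dF z); auto. apply cdiff_Cd; auto.
Qed.

Lemma hol_le (s s' : R) (F : C -> C) : s' <= s -> hol s F -> hol s' F.
Proof. intros Hs H z Hz. apply H. lra. Qed.

Lemma snd_dist (z w : C) : Rabs (snd w) <= Rabs (snd z) + Cmod (w - z)%C.
Proof.
  replace (snd w) with (snd z + snd (w - z)%C) by (simpl; ring).
  eapply Rle_trans; [apply Rabs_triang |]. pose proof (Rabs_snd_Cmod (w - z)%C). lra.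
Qed.

Lemma hol_holb (s : R) (F : C -> C) (z : C) (r : R) : hol s F -> r <= s - Rabs (snd z) -> holb z r F.
Proof. intros H Hr w Hw. apply H. pose proof (snd_dist z w). lra. Qed.

(** F need not be bounded on the strip; the bound required by [holb_Cd_diff] comes from a closed
    square about z. *)
Lemma hol_Cd (s : R) (F : C -> C) : hol s F -> hol s (Cd F).
Proof.
  intros H z Hz. set (r := (s - Rabs (snd z)) / 2). assert (Hr : 0 < r) by (unfold r; lra).
  destruct (cdiff_rect_bounded F (fst z - r) (fst z + r) (snd z - r) (snd z + r)) as [M HM]; try lra.
  { intros x y Hx Hy. apply H. simpl. assert (Rabs (y - snd z) <= r) by (apply Rabs_le; lra).
    replace y with (snd z + (y - snd z)) by ring. eapply Rle_lt_trans; [apply Rabs_triang |].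
    unfold r in *. lra. }
  apply (holb_Cd_diff F z M (r / 6)); [lra | |].
  - apply (hol_holb s); auto. unfold r. lra.
  - intros w Hw. rewrite (surjective_pairing w).
    pose proof (Rabs_fst_Cmod (w - z)%C) as K1. pose proof (Rabs_snd_Cmod (w - z)%C) as K2.
    simpl in K1, K2. apply Rabs_le_between in K1. apply Rabs_le_between in K2. apply HM; lra.
Qed.

Definition bnd (s S : R) (F : C -> C) : Prop := forall z : C, Rabs (snd z) < s -> Cmod (F z) <= S.

Lemma hol_Cd_bound (s S : R) (F : C -> C) (z : C) : hol s F -> bnd s S F -> Rabs (snd z) < s ->
  Cmod (Cd F z) <= S / (s - Rabs (snd z)).
Proof.
  intros H HS Hz. apply (Cd_bound F z S (s - Rabs (snd z)) (s - Rabs (snd z))); [lra | | |].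
  - apply (hol_holb s); auto. lra.
  - intros w Hw. apply HS. pose proof (snd_dist z w). lra.
  - replace (z - z)%C with (RtoC 0) by ring. rewrite Cmod_0. lra.
Qed.

Lemma hol_taylor2 (s S : R) (F : C -> C) (z h : C) (d : R) : hol s F -> bnd s S F -> 0 < d ->
  4 * d <= s - Rabs (snd z) -> Cmod h < d ->
  Cmod (F (z + h) - F z - Cd F z * h)%C <= S / (d * d) * (Cmod h * Cmod h).
Proof.
  intros H HS Hd Hz Hh. apply taylor2_bound; auto.
  - apply (hol_holb s); auto.
  - intros w Hw. apply HS. pose proof (snd_dist z w). lra.
Qed.

(** * L2 norms on horizontal lines *)

(** The bound is on the norm and not on its square. [RInt] is total, so integrability is not part of
    the notion; [contline] supplies it where it matters. *)
Definition L2B (g : R -> C) (m : R) : Prop :=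
  forall a b, a <= b -> RInt (fun x => Cnorm2 (g x)) a b <= m * m.

Definition line (F : C -> C) (y x : R) : C := F (x, y).

Definition contline (g : R -> C) : Prop := forall x, ccont g x.

Lemma continuous_Cnorm2 (f : R -> C) (t : R) : ccont f t -> continuous (fun s => Cnorm2 (f s)) t.
Proof.
  intros [H1 H2]. apply (continuous_plus (V := R_NormedModule)
    (fun s => fst (f s) * fst (f s)) (fun s => snd (f s) * snd (f s)));
  now apply (continuous_mult (K := R_AbsRing)).
Qed.

Lemma ex_RInt_Cnorm2 (f : R -> C) (a b : R) : contline f -> ex_RInt (fun s => Cnorm2 (f s)) a b.
Proof.
  intros H. apply (ex_RInt_continuous (V := R_CompleteNormedModule)). intros t _.
  now apply continuous_Cnorm2.
Qed.

Lemma hol_contline (s y : R) (F : C -> C) : hol s F -> Rabs y < s -> contline (line F y).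
Proof. intros H Hy x. destruct (H (x, y) Hy) as [l Hl]. eapply cdiff_ccont_h, Hl. Qed.

Lemma L2B_le (g : R -> C) (m m' : R) : 0 <= m <= m' -> L2B g m -> L2B g m'.
Proof. intros Hm H a b Hab. specialize (H a b Hab). nra. Qed.

Lemma L2B_ext (f g : R -> C) (m : R) : (forall x, f x = g x) -> L2B f m -> L2B g m.
Proof.
  intros E H a b Hab. rewrite (RInt_ext _ (fun x => Cnorm2 (f x))); auto.
  intros x _. now rewrite E.
Qed.

Lemma L2B_dom (f g : R -> C) (k m : R) : contline f -> contline g -> 0 <= k ->
  (forall x, Cmod (f x) <= k * Cmod (g x)) -> L2B g m -> L2B f (k * m).
Proof.
  intros Hf Hg Hk H Hm a b Hab. specialize (Hm a b Hab).
  assert (K : RInt (fun x => Cnorm2 (f x)) a b <= RInt (fun x => (k * k) * Cnorm2 (g x)) a b).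
  { apply RInt_le; auto using ex_RInt_Cnorm2.
    - apply (ex_RInt_scal (V := R_NormedModule) (fun x => Cnorm2 (g x))). now apply ex_RInt_Cnorm2.
    - intros x _. rewrite !Cnorm2_Cmod. specialize (H x).
      pose proof (Cmod_ge_0 (f x)). pose proof (Cmod_ge_0 (g x)).
      replace (k * k * (Cmod (g x) * Cmod (g x))) with ((k * Cmod (g x)) * (k * Cmod (g x))) by ring.
      apply Rmult_le_compat; auto. }
  rewrite (RInt_scal (V := R_CompleteNormedModule) (fun x => Cnorm2 (g x))) in K by now apply ex_RInt_Cnorm2.
  change (scal (k * k) (RInt (fun x => Cnorm2 (g x)) a b))
    with (k * k * RInt (fun x => Cnorm2 (g x)) a b) in K.
  replace (k * m * (k * m)) with (k * k * (m * m)) by ring.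
  eapply Rle_trans; [exact K |]. apply Rmult_le_compat_l; nra.
Qed.

Lemma contline_plus (f g : R -> C) : contline f -> contline g -> contline (fun x => f x + g x)%C.
Proof. intros Hf Hg x. now apply ccont_plus. Qed.

Lemma contline_mult (f g : R -> C) : contline f -> contline g -> contline (fun x => f x * g x)%C.
Proof. intros Hf Hg x. now apply ccont_mult. Qed.

Lemma contline_scal (c : C) (f : R -> C) : contline f -> contline (fun x => c * f x)%C.
Proof. intros Hf x. apply ccont_mult; auto. apply ccont_const. Qed.

Lemma L2B_scal (c : C) (f : R -> C) (m : R) : contline f -> L2B f m -> L2B (fun x => c * f x)%C (Cmod c * m).
Proof.
  intros Hf H. apply (L2B_dom _ f); auto using contline_scal, Cmod_ge_0.
  intros x. rewrite Cmod_mult. lra.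
Qed.

Lemma L2B_mult (f g : R -> C) (k m : R) : contline f -> contline g ->
  (forall x, Cmod (f x) <= k) -> L2B g m -> L2B (fun x => f x * g x)%C (k * m).
Proof.
  intros Hf Hg H. apply L2B_dom; auto using contline_mult.
  - eapply Rle_trans; [apply (Cmod_ge_0 (f 0)) | auto].
  - intros x. rewrite Cmod_mult. apply Rmult_le_compat_r; auto using Cmod_ge_0.
Qed.

(* Minkowski, through |p + q|^2 <= (1 + m'/m) |p|^2 + (1 + m/m') |q|^2. *)
Lemma L2B_plus (f g : R -> C) (m m' : R) : contline f -> contline g -> 0 < m -> 0 < m' ->
  L2B f m -> L2B g m' -> L2B (fun x => f x + g x)%C (m + m').
Proof.
  intros Hf Hg Hm Hm' H H' a b Hab. specialize (H a b Hab). specialize (H' a b Hab).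
  set (p := 1 + m' / m). set (q := 1 + m / m').
  assert (P : 0 < m' / m) by now apply Rdiv_lt_0_compat.
  assert (Q : 0 < m / m') by now apply Rdiv_lt_0_compat.
  assert (PQ : m' / m * (m / m') = 1) by (field; lra).
  assert (If := ex_RInt_Cnorm2 f a b Hf). assert (Ig := ex_RInt_Cnorm2 g a b Hg).
  assert (K : RInt (fun x => Cnorm2 (f x + g x)%C) a b
    <= RInt (fun x => p * Cnorm2 (f x) + q * Cnorm2 (g x)) a b).
  { apply RInt_le; auto.
    - apply ex_RInt_Cnorm2. now apply contline_plus.
    - apply (ex_RInt_plus (V := R_NormedModule) (fun x => p * Cnorm2 (f x)) (fun x => q * Cnorm2 (g x))).
      now apply (ex_RInt_scal (V := R_NormedModule) (fun x => Cnorm2 (f x))).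
      now apply (ex_RInt_scal (V := R_NormedModule) (fun x => Cnorm2 (g x))).
    - assert (Y : forall u v, (u + v) * (u + v) <= p * (u * u) + q * (v * v)).
      { intros u v. unfold p, q. set (s := m' / m) in *. set (t := m / m') in *.
        assert (0 <= s * (u - t * v) * (u - t * v)).
        { rewrite Rmult_assoc. apply Rmult_le_pos; [now left | apply Rle_0_sqr]. }
        replace (s * (u - t * v) * (u - t * v)) with (s * (u * u) - 2 * (s * t) * (u * v) + (s * t) * t * (v * v)) in * by ring.
        rewrite PQ in *. nra. }
      intros x _. unfold Cnorm2, Cplus. simpl. pose proof (Y (fst (f x)) (fst (g x))).
      pose proof (Y (snd (f x)) (snd (g x))). lra. }
  rewrite (RInt_plus (V := R_CompleteNormedModule) (fun x => p * Cnorm2 (f x)) (fun x => q * Cnorm2 (g x))) in K.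
  2: now apply (ex_RInt_scal (V := R_NormedModule) (fun x => Cnorm2 (f x))).
  2: now apply (ex_RInt_scal (V := R_NormedModule) (fun x => Cnorm2 (g x))).
  rewrite (RInt_scal (V := R_CompleteNormedModule) (fun x => Cnorm2 (f x))) in K by auto.
  rewrite (RInt_scal (V := R_CompleteNormedModule) (fun x => Cnorm2 (g x))) in K by auto.
  eapply Rle_trans; [exact K |].
  change (p * RInt (fun x => Cnorm2 (f x)) a b + q * RInt (fun x => Cnorm2 (g x)) a b <= (m + m') * (m + m')).
  replace ((m + m') * (m + m')) with (p * (m * m) + q * (m' * m')) by (unfold p, q; field; lra).
  apply Rplus_le_compat; apply Rmult_le_compat_l; auto; unfold p, q; lra.
Qed.

(** With I the modulus of the integral, the inequality |f| <= 1/(2k) + (k/2)|f|^2 is integrated; k =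
    (b-a)/I makes its first term contribute exactly I/2. *)
Lemma CI_cauchy_schwarz (f : R -> C) (a b : R) : a < b -> contline f ->
  Cnorm2 (CI f a b) <= (b - a) * RInt (fun t => Cnorm2 (f t)) a b.
Proof.
  intros Hab Hf. rewrite Cnorm2_Cmod. set (I := Cmod (CI f a b)). set (N := RInt (fun t => Cnorm2 (f t)) a b).
  assert (If := ex_RInt_Cnorm2 f a b Hf).
  assert (HN : 0 <= N) by (apply RInt_ge_0; auto; [lra | intros; apply Cnorm2_ge_0]).
  assert (HI : 0 <= I) by apply Cmod_ge_0.
  destruct HI as [HI | HI].
  2:{ rewrite <- HI. rewrite Rmult_0_l. apply Rmult_le_pos; lra. }
  set (k := (b - a) / I). assert (Hk : 0 < k) by (apply Rdiv_lt_0_compat; lra).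
  assert (K : I <= RInt (fun t => / (2 * k) + k / 2 * Cnorm2 (f t)) a b).
  { apply CI_norm; auto.
    - lra.
    - apply ex_CI_cont. intros t _. apply Hf.
    - apply (ex_RInt_plus (V := R_NormedModule) (fun _ => / (2 * k)) (fun t => k / 2 * Cnorm2 (f t))).
      apply (ex_RInt_const (V := R_NormedModule)).
      now apply (ex_RInt_scal (V := R_NormedModule) (fun t => Cnorm2 (f t))).
    - intros t _. rewrite Cnorm2_Cmod. set (u := Cmod (f t)).
      assert (0 <= (1 - k * u) * (1 - k * u) / (2 * k)).
      { apply Rdiv_le_0_compat; [apply Rle_0_sqr | lra]. }
      replace ((1 - k * u) * (1 - k * u) / (2 * k)) with (/ (2 * k) + k / 2 * (u * u) - u) in * by (field; lra).
      lra. }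
  rewrite (RInt_plus (V := R_CompleteNormedModule) (fun _ => / (2 * k)) (fun t => k / 2 * Cnorm2 (f t))) in K.
  2: apply (ex_RInt_const (V := R_NormedModule)).
  2: now apply (ex_RInt_scal (V := R_NormedModule) (fun t => Cnorm2 (f t))).
  rewrite (RInt_scal (V := R_CompleteNormedModule) (fun t => Cnorm2 (f t))) in K by auto.
  rewrite (RInt_const (V := R_CompleteNormedModule)) in K.
  change (I <= (b - a) * / (2 * k) + k / 2 * N) in K.
  replace ((b - a) * / (2 * k)) with (I / 2) in K by (unfold k; field; lra).
  apply (Rmult_le_compat_l (2 * I)) in K; [| lra].
  replace (2 * I * (I / 2 + k / 2 * N)) with (I * I + (b - a) * N) in K by (unfold k; field; lra).
  lra.
Qed.

Lemma RInt_param_continuous (f : R -> R -> R) (a b t : R) : a <= b ->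
  (forall x t, continuity_2d_pt f x t) -> continuous (fun t => RInt (fun x => f x t) a b) t.
Proof.
  intros Hab H. apply continuity_pt_filterlim. intros eps He.
  assert (He' : 0 < eps / (2 * (b - a + 1))) by (apply Rdiv_lt_0_compat; lra).
  destruct (uniform_continuity_2d_1d f a b t (fun x _ => H x t) (mkposreal _ He')) as [d Hd].
  exists d. split; [apply cond_pos |]. intros s [_ Hs]. change (Rabs (s - t) < d) in Hs.
  simpl in Hd. change (Rabs (RInt (fun x => f x s) a b - RInt (fun x => f x t) a b) < eps).
  assert (Hex : forall s, ex_RInt (fun x => f x s) a b).
  { intros u. apply (ex_RInt_continuous (V := R_CompleteNormedModule)). intros x _.
    apply continuity_pt_filterlim. intros e Hep. destruct (H x u (mkposreal e Hep)) as [dl K].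
    exists dl. split; [apply cond_pos |]. intros v [_ Hv]. apply K; auto.
    replace (u - u) with 0 by ring. rewrite Rabs_R0. apply cond_pos. }
  rewrite <- (RInt_minus (V := R_CompleteNormedModule)) by auto.
  apply Rle_lt_trans with ((b - a) * (eps / (2 * (b - a + 1)))).
  - apply abs_RInt_le_const; auto.
    + now apply (ex_RInt_minus (V := R_NormedModule)).
    + intros x Hx. left. apply Rabs_lt_between in Hs.
      assert (Hdp := cond_pos d).
      apply (Hd x t x s); try (split; lra).
      replace (x - x) with 0 by ring. rewrite Rabs_R0. exact Hdp.
  - apply Rlt_le_trans with ((b - a + 1) * (eps / (2 * (b - a + 1)))).
    apply Rmult_lt_compat_r; lra. apply Rle_trans with (eps / 2); [right; field; lra | lra].
Qed.

(* The bound is integrated in [x] by comparing [x]-derivatives, which replaces Fubini's theorem. *)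
Lemma L2_average (p : R -> R) (f : R -> R -> R) (k m a b c d : R) : a <= b -> c <= d -> 0 <= k ->
  (forall x, continuous p x) -> (forall x t, continuity_2d_pt f x t) ->
  (forall x, p x <= k * RInt (fun t => f x t) c d) ->
  (forall t, RInt (fun x => f x t) a b <= m) ->
  RInt p a b <= k * ((d - c) * m).
Proof.
  intros Hab Hcd Hk Hp Hf Hpk Hm.
  assert (Hfx : forall x t, continuous (fun x => f x t) x).
  { intros x u. apply continuity_pt_filterlim. intros e Hep. destruct (Hf x u (mkposreal e Hep)) as [dl K].
    exists dl. split; [apply cond_pos |]. intros v [_ Hv]. apply K; auto.
    replace (u - u) with 0 by ring. rewrite Rabs_R0. apply cond_pos. }
  assert (Hex : forall t u v, ex_RInt (fun x => f x t) u v).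
  { intros t u v. apply (ex_RInt_continuous (V := R_CompleteNormedModule)). intros x _. apply Hfx. }
  assert (HD : forall x t, is_derive (fun u => RInt (fun x => f x t) (a - 1) u) x (f x t)).
  { intros x t. apply (is_derive_RInt (V := R_CompleteNormedModule) (fun x => f x t) _ (a - 1)).
    - apply filter_forall. intros u. apply (RInt_correct (V := R_CompleteNormedModule)), Hex.
    - apply Hfx. }
  assert (HexT : forall u, a - 1 < u -> ex_RInt (fun t => RInt (fun x => f x t) (a - 1) u) c d).
  { intros u Hu. apply (ex_RInt_continuous (V := R_CompleteNormedModule)). intros t _.
    apply RInt_param_continuous; auto. lra. }
  (* The base point a - 1 instead of a makes [Psi] differentiable on both sides of a as well. *)
  set (Psi := fun u => RInt (fun t => RInt (fun x => f x t) (a - 1) u) c d).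
  assert (HPsi : forall x, a - 1 < x -> is_derive Psi x (RInt (fun t => f x t) c d)).
  { intros x Hx. unfold Psi.
    rewrite (RInt_ext (fun t => f x t) (fun t => Derive (fun u => RInt (fun x => f x t) (a - 1) u) x)).
    2:{ intros t _. symmetry. apply is_derive_unique, HD. }
    apply (is_derive_RInt_param (fun u t => RInt (fun x => f x t) (a - 1) u)).
    - apply filter_forall. intros u t _. eexists. apply HD.
    - intros t _. apply (continuity_2d_pt_ext f); auto. intros u v. symmetry. apply is_derive_unique, HD.
    - apply (locally_interval _ x (a - 1) p_infty); simpl; auto. }
  assert (K : RInt p a b - k * Psi b <= RInt p a a - k * Psi a).
  { apply (derive_nonpos_le (fun u => RInt p a u - k * Psi u) (fun x => p x - k * RInt (fun t => f x t) c d)); auto.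
    - intros x Hx. split; [| specialize (Hpk x); lra].
      apply (is_derive_minus (V := R_NormedModule) (fun u => RInt p a u) (fun u => k * Psi u)).
      + apply (is_derive_RInt (V := R_CompleteNormedModule) p _ a); [| apply Hp].
        apply filter_forall. intros u. apply (RInt_correct (V := R_CompleteNormedModule)).
        apply (ex_RInt_continuous (V := R_CompleteNormedModule)). intros; apply Hp.
      + apply (is_derive_scal Psi). apply HPsi. lra.
    - intros x Hx. apply (continuous_minus (V := R_NormedModule) (fun u => RInt p a u) (fun u => k * Psi u)).
      + apply (ex_derive_continuous (K := R_AbsRing) (V := R_NormedModule)). exists (p x).
        apply (is_derive_RInt (V := R_CompleteNormedModule) p _ a); [| apply Hp].
        apply filter_forall. intros u. apply (RInt_correct (V := R_CompleteNormedModule)).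
        apply (ex_RInt_continuous (V := R_CompleteNormedModule)). intros; apply Hp.
      + apply (continuous_scal_r (V := R_NormedModule) k Psi).
        apply (ex_derive_continuous (K := R_AbsRing) (V := R_NormedModule)).
        eexists. apply HPsi. lra. }
  rewrite RInt_point in K. change (zero : R) with 0 in K.
  assert (E : Psi b - Psi a = RInt (fun t => RInt (fun x => f x t) a b) c d).
  { unfold Psi. rewrite <- (RInt_minus (V := R_CompleteNormedModule)) by (apply HexT; lra).
    apply RInt_ext. intros t _.
    rewrite <- (RInt_Chasles (V := R_CompleteNormedModule) (fun x => f x t) (a - 1) a b) by auto.
    unfold minus, plus, opp; simpl. ring. }
  assert (L : Psi b - Psi a <= (d - c) * m).
  { rewrite E. eapply Rle_trans; [apply (RInt_le _ (fun _ => m)); auto |].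
    - apply (ex_RInt_continuous (V := R_CompleteNormedModule)). intros t _.
      now apply RInt_param_continuous.
    - apply (ex_RInt_const (V := R_NormedModule)).
    - rewrite (RInt_const (V := R_CompleteNormedModule)). right. reflexivity. }
  assert (k * (Psi b - Psi a) <= k * ((d - c) * m)) by now apply Rmult_le_compat_l.
  lra.
Qed.

Lemma continuity_2d_cdiff (F : C -> C) (g1 g2 : R -> R -> R) (x y : R) (l : C) :
  cdiff F (g1 x y, g2 x y) l -> continuity_2d_pt g1 x y -> continuity_2d_pt g2 x y ->
  continuity_2d_pt (fun u v => Cnorm2 (F (g1 u v, g2 u v))) x y.
Proof.
  intros H H1 H2.
  assert (K : forall p : C -> R, (forall z w, Rabs (p z - p w) <= Cmod (z - w)%C) ->
    continuity_2d_pt (fun u v => p (F (g1 u v, g2 u v))) x y).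
  { intros p Hp eps.
    destruct (cdiff_cont F _ l H (eps / 2)) as [d [Hd Hc]]; [apply is_pos_div_2 |].
    assert (Hd2 : 0 < d / 2) by lra.
    destruct (H1 (mkposreal _ Hd2)) as [d1 K1]. destruct (H2 (mkposreal _ Hd2)) as [d2 K2].
    assert (Hm : 0 < Rmin d1 d2) by (apply Rmin_pos; apply cond_pos).
    exists (mkposreal _ Hm). simpl in *. intros u v Hu Hv.
    pose proof (Rmin_l d1 d2). pose proof (Rmin_r d1 d2).
    specialize (K1 u v ltac:(lra) ltac:(lra)). specialize (K2 u v ltac:(lra) ltac:(lra)).
    eapply Rle_lt_trans; [apply Hp |].
    set (w := ((g1 u v, g2 u v) - (g1 x y, g2 x y))%C).
    assert (Hw : Cmod w < d).
    { eapply Rle_lt_trans; [apply Cmod_le_sum |].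
      change (Rabs (g1 u v - g1 x y) + Rabs (g2 u v - g2 x y) < d). lra. }
    specialize (Hc w Hw).
    replace ((g1 x y, g2 x y) + w)%C with ((g1 u v, g2 u v) : C) in Hc
      by (unfold w; apply injective_projections; simpl; ring).
    eapply Rle_lt_trans; [exact Hc |]. pose proof (cond_pos eps). lra. }
  unfold Cnorm2. apply continuity_2d_pt_plus; apply continuity_2d_pt_mult;
    (apply (K fst) || apply (K snd)); intros z w;
    (apply (Rabs_fst_Cmod (z - w)%C) || apply (Rabs_snd_Cmod (z - w)%C)).
Qed.

Lemma Cnorm2_mult (z w : C) : Cnorm2 (z * w)%C = Cnorm2 z * Cnorm2 w.
Proof. unfold Cnorm2. simpl. ring. Qed.

Lemma Cnorm2_cis (t : R) : Cnorm2 (cis t) = 1.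
Proof. rewrite Cnorm2_Cmod, Cmod_cis. ring. Qed.

Lemma L2B_shift (g : R -> C) (m c a b : R) : contline g -> L2B g m -> a <= b ->
  RInt (fun x => Cnorm2 (g (x + c))) a b <= m * m.
Proof.
  intros Hg H Hab.
  pose proof (RInt_comp_lin (V := R_CompleteNormedModule) (fun x => Cnorm2 (g x)) 1 c a b) as E.
  assert (E2 : RInt (fun x => Cnorm2 (g (x + c))) a b
    = RInt (fun x => Cnorm2 (g x)) (1 * a + c) (1 * b + c)).
  { rewrite <- E by now apply ex_RInt_Cnorm2. apply RInt_ext. intros x _.
    change (Cnorm2 (g (x + c)) = 1 * Cnorm2 (g (1 * x + c))). rewrite !Rmult_1_l. reflexivity. }
  rewrite E2. apply H. lra.
Qed.

(** Cauchy's formula and Cauchy-Schwarz bound |G'(x+iy)|^2 by r^(-2) times the mean of |G|^2 over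
    the circle of radius r. When x runs over the line, each point of the circle runs over a
    horizontal line of the strip, so the mean integrates to at most m^2. *)
Lemma L2B_Cd (s : R) (G : C -> C) (m y r : R) : hol s G ->
  (forall y, Rabs y < s -> L2B (line G y) m) -> 0 < r -> Rabs y + r < s ->
  L2B (line (Cd G) y) (m / r).
Proof.
  intros H HL Hr Hy a b Hab. pose proof PI_RGT_0 as HPI.
  assert (Hs : forall t, Rabs (y + r * sin t) < s).
  { intros t. eapply Rle_lt_trans; [apply Rabs_triang |]. rewrite Rabs_mult, (Rabs_pos_eq r) by lra.
    assert (Rabs (sin t) <= 1) by (apply Rabs_le, SIN_bound). nra. }
  assert (Ew : forall x t, ((x, y) + RtoC r * cis t)%C = (x + r * cos t, y + r * sin t)).
  { intros x t. unfold cis. apply injective_projections; simpl; ring. }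
  replace (m / r * (m / r)) with (/ (2 * PI * (r * r)) * ((2 * PI - 0) * (m * m))) by (field; lra).
  apply (L2_average _ (fun x t => Cnorm2 (G (x + r * cos t, y + r * sin t)))); auto.
  - lra.
  - left. apply Rinv_0_lt_compat. apply Rmult_lt_0_compat; [lra | nra].
  - intros x. apply (continuous_Cnorm2 (line (Cd G) y)). apply (hol_contline s).
    now apply hol_Cd. pose proof (Rabs_pos y). lra.
  - intros x t. destruct (H (x + r * cos t, y + r * sin t) (Hs t)) as [l Hl].
    apply (continuity_2d_cdiff G (fun x t => x + r * cos t) (fun x t => y + r * sin t) x t l); auto.
    + apply continuity_2d_pt_plus. apply continuity_2d_pt_id1.
      apply continuity_2d_pt_mult. apply continuity_2d_pt_const.
      apply (continuity_1d_2d_pt_comp cos). apply continuity_cos. apply continuity_2d_pt_id2.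
    + apply continuity_2d_pt_plus. apply continuity_2d_pt_const.
      apply continuity_2d_pt_mult. apply continuity_2d_pt_const.
      apply (continuity_1d_2d_pt_comp sin). apply continuity_sin. apply continuity_2d_pt_id2.
  - intros x. set (z := (x, y) : C).
    assert (Hz : holb z (s - Rabs y) G) by (apply (hol_holb s); auto; simpl; lra).
    assert (Hrr : 0 < r < s - Rabs y) by lra.
    pose proof (cauchy_formula G z (Cd G z) r _ Hrr Hz) as E.
    assert (Hzs : Rabs (snd z) < s) by (simpl; pose proof (Rabs_pos y); lra).
    specialize (E (hol_cdiff s G H z Hzs)).
    assert (Hc : contline (fun t => G (z + RtoC r * cis t) * cis (- t))%C).
    { intros t. now apply (cauchy_ccont G z r (s - Rabs y)). }
    pose proof (CI_cauchy_schwarz _ 0 (2 * PI) ltac:(lra) Hc) as K.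
    fold (cauchy_int G z r) in K. rewrite E, Cnorm2_mult in K.
    rewrite (RInt_ext _ (fun t => Cnorm2 (G (x + r * cos t, y + r * sin t)))) in K.
    2:{ intros t _. rewrite Cnorm2_mult, Cnorm2_cis, Rmult_1_r. unfold z. now rewrite Ew. }
    replace (Cnorm2 (RtoC (2 * PI * r))) with ((2 * PI) * (2 * PI * (r * r))) in K
      by (unfold Cnorm2; simpl; ring).
    assert (Hq : 0 < 2 * PI * (r * r)) by (apply Rmult_lt_0_compat; [lra | nra]).
    assert (K' : forall u N : R, (2 * PI) * (2 * PI * (r * r)) * u <= (2 * PI - 0) * N ->
      u <= / (2 * PI * (r * r)) * N).
    { intros u N HN. apply Rmult_le_reg_l with (2 * PI * (r * r)); auto.
      replace (2 * PI * (r * r) * (/ (2 * PI * (r * r)) * N)) with N by (field; lra).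
      apply Rmult_le_reg_l with (2 * PI); lra. }
    exact (K' _ _ K).
  - intros t. apply (L2B_shift (line G (y + r * sin t)) m (r * cos t)); auto.
    apply (hol_contline s); auto.
Qed.

(** * The spaces H^(1,s) *)

(** An upper bound m for the norm of [H1_le], that is, for the larger of the norms of F and F' on
    each line. It is required to be positive because [L2B_plus] divides by its two bounds. *)
Definition HB (s : R) (F : C -> C) (m : R) : Prop :=
  0 < m /\ hol s F /\ forall y, Rabs y < s -> L2B (line F y) m /\ L2B (line (Cd F) y) m.

Lemma Cd_ext (F G : C -> C) (z : C) : (forall x, F (x, snd z) = G (x, snd z)) -> Cd F z = Cd G z.
Proof.
  intros H. unfold Cd. f_equal; apply Derive_ext; intros x; now rewrite H.
Qed.

Lemma hol_ext (s : R) (F G : C -> C) : (forall z : C, Rabs (snd z) < s -> F z = G z) -> hol s F -> hol s G.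
Proof.
  intros E H z Hz. destruct (H z Hz) as [l Hl]. exists l.
  apply (cdiff_ext_loc F G z l (s - Rabs (snd z))); auto. lra.
  intros w Hw. apply E. pose proof (snd_dist z w). lra.
Qed.

Lemma HB_ext (s : R) (F G : C -> C) (m : R) :
  (forall z : C, Rabs (snd z) < s -> F z = G z) -> HB s F m -> HB s G m.
Proof.
  intros E (Hm & H & HL). split; [auto | split].
  - now apply (hol_ext s F).
  - intros y Hy. destruct (HL y Hy) as [L1 L2]. split.
    + apply (L2B_ext (line F y)); auto. intros x. now apply E.
    + apply (L2B_ext (line (Cd F) y)); auto. intros x. apply Cd_ext. intros x'. now apply E.
Qed.

Lemma HB_strip (s s' : R) (F : C -> C) (m : R) : s' <= s -> HB s F m -> HB s' F m.
Proof.
  intros Hs (Hm & H & HL). split; [auto | split].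
  - now apply (hol_le s).
  - intros y Hy. apply HL. lra.
Qed.

Lemma HB_le (s : R) (F : C -> C) (m m' : R) : m <= m' -> HB s F m -> HB s F m'.
Proof.
  intros Hs (Hm & H & HL). split; [lra | split]; auto.
  intros y Hy. destruct (HL y Hy). split; apply (L2B_le _ m); auto; lra.
Qed.

Lemma hol_plus (s : R) (F G : C -> C) : hol s F -> hol s G ->
  hol s (fun z => F z + G z)%C /\
  forall z : C, Rabs (snd z) < s -> Cd (fun z => F z + G z)%C z = (Cd F z + Cd G z)%C.
Proof.
  intros HF HG. apply (hol_intro s _ (fun z => Cd F z + Cd G z)%C). intros z Hz.
  apply cdiff_plus; eapply hol_cdiff; eauto.
Qed.

Lemma hol_mult (s : R) (F G : C -> C) : hol s F -> hol s G ->
  hol s (fun z => F z * G z)%C /\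
  forall z : C, Rabs (snd z) < s -> Cd (fun z => F z * G z)%C z = (Cd F z * G z + F z * Cd G z)%C.
Proof.
  intros HF HG. apply (hol_intro s _ (fun z => Cd F z * G z + F z * Cd G z)%C). intros z Hz.
  apply cdiff_mult; eapply hol_cdiff; eauto.
Qed.

Lemma hol_scal (s : R) (c : C) (F : C -> C) : hol s F ->
  hol s (fun z => c * F z)%C /\
  forall z : C, Rabs (snd z) < s -> Cd (fun z => c * F z)%C z = (c * Cd F z)%C.
Proof.
  intros HF. apply (hol_intro s _ (fun z => c * Cd F z)%C). intros z Hz.
  apply cdiff_scal; eapply hol_cdiff; eauto.
Qed.

Lemma HB_plus (s : R) (F G : C -> C) (m m' : R) : HB s F m -> HB s G m' ->
  HB s (fun z => F z + G z)%C (m + m').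
Proof.
  intros (Hm & H & HL) (Hm' & H' & HL'). destruct (hol_plus s F G H H') as [P1 P2].
  split; [lra | split; auto].
  intros y Hy. destruct (HL y Hy) as [L1 L2], (HL' y Hy) as [L1' L2']. split.
  - apply (L2B_plus (line F y) (line G y)); auto; now apply (hol_contline s).
  - apply (L2B_ext (fun x => line (Cd F) y x + line (Cd G) y x)%C).
    + intros x. symmetry. now apply P2.
    + apply L2B_plus; auto; apply (hol_contline s); auto using hol_Cd.
Qed.

Lemma HB_scal (s : R) (c : C) (F : C -> C) (k m : R) : 0 < k -> Cmod c <= k -> HB s F m ->
  HB s (fun z => c * F z)%C (k * m).
Proof.
  intros Hk Hc (Hm & H & HL). destruct (hol_scal s c F H) as [P1 P2].
  assert (K : 0 <= Cmod c * m <= k * m).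
  { split. apply Rmult_le_pos; [apply Cmod_ge_0 | lra]. apply Rmult_le_compat_r; lra. }
  split; [now apply Rmult_lt_0_compat | split; auto].
  intros y Hy. destruct (HL y Hy) as [L1 L2]. split.
  - apply (L2B_le _ (Cmod c * m)); auto. apply (L2B_scal c (line F y)); auto. now apply (hol_contline s).
  - apply (L2B_ext (fun x => c * line (Cd F) y x)%C).
    + intros x. symmetry. now apply P2.
    + apply (L2B_le _ (Cmod c * m)); auto. apply L2B_scal; auto. apply (hol_contline s); auto using hol_Cd.
Qed.

Lemma pder_Cnorm2 (f : R -> C) (t : R) (l : C) : pder f t l ->
  is_derive (fun s => Cnorm2 (f s)) t (2 * (fst (f t) * fst l + snd (f t) * snd l)).
Proof.
  intros [H1 H2]. unfold Cnorm2.
  replace (2 * (fst (f t) * fst l + snd (f t) * snd l))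
    with ((fst l * fst (f t) + fst (f t) * fst l) + (snd l * snd (f t) + snd (f t) * snd l)) by ring.
  apply (is_derive_plus (V := R_NormedModule) (fun s => fst (f s) * fst (f s)) (fun s => snd (f s) * snd (f s))).
  - apply (is_derive_mult (fun s => fst (f s)) (fun s => fst (f s))); auto. intros; apply Rmult_comm.
  - apply (is_derive_mult (fun s => snd (f s)) (fun s => snd (f s))); auto. intros; apply Rmult_comm.
Qed.

Lemma hol_pder_line (s : R) (F : C -> C) (x y : R) : hol s F -> Rabs y < s ->
  pder (line F y) x (line (Cd F) y x).
Proof. intros H Hy. apply (cdiff_pder_line F (x, y)). now apply (hol_cdiff s). Qed.

Lemma is_derive_RInt_cont (p : R -> R) (a x : R) : (forall x, continuous p x) ->
  is_derive (fun u => RInt p a u) x (p x).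
Proof.
  intros Hp. apply (is_derive_RInt (V := R_CompleteNormedModule) p _ a); [| apply Hp].
  apply filter_forall. intros u. apply (RInt_correct (V := R_CompleteNormedModule)).
  apply (ex_RInt_continuous (V := R_CompleteNormedModule)). intros; apply Hp.
Qed.

Lemma derive_continuous (f : R -> R) (x l : R) : is_derive f x l -> continuous f x.
Proof.
  intros H. apply (ex_derive_continuous (K := R_AbsRing) (V := R_NormedModule)). now exists l.
Qed.

(** The derivative of |f|^2 is at least -(|f|^2 + |f'|^2), so |f(x)|^2 <= |f(t)|^2 + 2 m^2 for t >=
    x. Averaging over t in [x, x+1] gives 3 m^2, which is below (2m)^2. *)
Lemma sobolev (f df : R -> C) (m : R) : contline df -> (forall x, pder f x (df x)) -> 0 < m ->
  L2B f m -> L2B df m -> forall x, Cmod (f x) <= 2 * m.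
Proof.
  intros Hdf Hd Hm H1 H2 x.
  assert (Hf : contline f) by (intros u; eapply pder_ccont, Hd).
  apply Cmod_le_of_Cnorm2; [lra |].
  set (p := fun u => Cnorm2 (f u) + Cnorm2 (df u)).
  assert (Hp : forall u, continuous p u).
  { intros u. apply (continuous_plus (V := R_NormedModule) (fun u => Cnorm2 (f u)) (fun u => Cnorm2 (df u)));
    now apply continuous_Cnorm2. }
  assert (Hp2 : forall t, x <= t -> RInt p x t <= 2 * (m * m)).
  { intros t Ht. unfold p. rewrite (RInt_plus (V := R_CompleteNormedModule)) by now apply ex_RInt_Cnorm2.
    specialize (H1 x t Ht). specialize (H2 x t Ht). unfold plus; simpl. lra. }
  assert (K : forall t, x <= t -> Cnorm2 (f x) <= Cnorm2 (f t) + 2 * (m * m)).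
  { intros t Ht. specialize (Hp2 t Ht).
    pose proof (derive_nonpos_le (fun t => - Cnorm2 (f t) - RInt p x t)
      (fun t => - (2 * (fst (f t) * fst (df t) + snd (f t) * snd (df t))) - p t) x t Ht) as K.
    assert (D : forall u, is_derive (fun t => - Cnorm2 (f t) - RInt p x t) u
      (- (2 * (fst (f u) * fst (df u) + snd (f u) * snd (df u))) - p u)).
    { intros u. apply (is_derive_minus (V := R_NormedModule) (fun t => - Cnorm2 (f t)) (fun t => RInt p x t)).
      - apply (is_derive_opp (V := R_NormedModule) (fun t => Cnorm2 (f t))). now apply pder_Cnorm2.
      - now apply is_derive_RInt_cont. }
    cbv beta in K. rewrite RInt_point in K. change (zero : R) with 0 in K.
    cut (- Cnorm2 (f t) - RInt p x t <= - Cnorm2 (f x) - 0); [lra |]. apply K.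
    - intros u _. split; auto. unfold p, Cnorm2.
      pose proof (Rle_0_sqr (fst (f u) + fst (df u))). pose proof (Rle_0_sqr (snd (f u) + snd (df u))).
      unfold Rsqr in *. lra.
    - intros u _. eapply derive_continuous, D. }
  assert (L : RInt (fun _ => Cnorm2 (f x)) x (x + 1) <= RInt (fun t => Cnorm2 (f t) + 2 * (m * m)) x (x + 1)).
  { apply RInt_le.
    - lra.
    - apply (ex_RInt_const (V := R_NormedModule)).
    - apply (ex_RInt_plus (V := R_NormedModule)). now apply ex_RInt_Cnorm2. apply (ex_RInt_const (V := R_NormedModule)).
    - intros t Ht. apply K. lra. }
  rewrite (RInt_plus (V := R_CompleteNormedModule)), !(RInt_const (V := R_CompleteNormedModule)) in L.
  2: now apply ex_RInt_Cnorm2. 2: apply (ex_RInt_const (V := R_NormedModule)).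
  specialize (H1 x (x + 1) ltac:(lra)).
  change ((x + 1 - x) * Cnorm2 (f x) <= RInt (fun t => Cnorm2 (f t)) x (x + 1) + (x + 1 - x) * (2 * (m * m))) in L.
  nra.
Qed.

Lemma HB_bnd (s : R) (F : C -> C) (m : R) : HB s F m -> bnd s (2 * m) F.
Proof.
  intros (Hm & H & HL) [x y] Hy. simpl in Hy. destruct (HL y Hy) as [L1 L2].
  apply (sobolev (line F y) (line (Cd F) y)); auto.
  - apply (hol_contline s); auto using hol_Cd.
  - intros u. now apply (hol_pder_line s).
Qed.

(** In each product one factor is taken in sup norm, at the cost of the factor 2 of [HB_bnd]; the
    two terms of the product rule make 4. *)
Lemma HB_mult (s : R) (F G : C -> C) (m m' : R) : HB s F m -> HB s G m' ->
  HB s (fun z => F z * G z)%C (4 * m * m').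
Proof.
  intros HF HG. pose proof (HB_bnd _ _ _ HF) as BF. pose proof (HB_bnd _ _ _ HG) as BG.
  destruct HF as (Hm & H & HL), HG as (Hm' & H' & HL'). destruct (hol_mult s F G H H') as [P1 P2].
  assert (Hmm : 0 < m * m') by now apply Rmult_lt_0_compat.
  split; [lra | split; auto].
  intros y Hy. destruct (HL y Hy) as [L1 L2], (HL' y Hy) as [L1' L2'].
  assert (CF : contline (line F y)) by now apply (hol_contline s).
  assert (CG : contline (line G y)) by now apply (hol_contline s).
  assert (CdF : contline (line (Cd F) y)) by (apply (hol_contline s); auto using hol_Cd).
  assert (CdG : contline (line (Cd G) y)) by (apply (hol_contline s); auto using hol_Cd).
  split.
  - apply (L2B_le _ (2 * m * m')); [lra |]. apply (L2B_mult (line F y) (line G y)); auto.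
    intros x. now apply BF.
  - apply (L2B_ext (fun x => line G y x * line (Cd F) y x + line F y x * line (Cd G) y x)%C).
    + intros x. unfold line. rewrite P2 by auto. ring.
    + replace (4 * m * m') with (2 * m' * m + 2 * m * m') by ring.
      apply L2B_plus; auto using contline_mult; try lra.
      * apply L2B_mult; auto. intros x. now apply BG.
      * apply L2B_mult; auto. intros x. now apply BF.
Qed.

(** The norm of G' itself loses nothing, that of its derivative a factor 1/(s-s'); as s-s' <= rho,
    the factor 1+rho covers both. *)
Lemma HB_Cd (s s' rho : R) (G : C -> C) (m : R) : HB s G m -> 0 < s - s' <= rho ->
  HB s' (Cd G) (m * (1 + rho) / (s - s')).
Proof.
  intros (Hm & H & HL) Hs.
  assert (Hd := hol_Cd s G H).
  assert (0 < m * (1 + rho) / (s - s')) by (apply Rdiv_lt_0_compat; [apply Rmult_lt_0_compat |]; lra).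
  split; [auto | split].
  - apply (hol_le s); auto. lra.
  - intros y Hy. split.
    + apply (L2B_le _ m). 2: apply HL; lra. split; [lra |].
      apply Rmult_le_reg_r with (s - s'); [lra |].
      replace (m * (1 + rho) / (s - s') * (s - s')) with (m * (1 + rho)) by (field; lra).
      apply Rmult_le_compat_l; lra.
    + apply (L2B_le _ (m / (s - s'))).
      * split. left. apply Rdiv_lt_0_compat; lra. unfold Rdiv.
        apply Rmult_le_compat_r. left. apply Rinv_0_lt_compat; lra. nra.
      * apply (L2B_Cd s); auto; try lra. intros y' Hy'. now apply HL.
Qed.

(** * The operator (1 - d^2/dx^2)^(-1) on strips *)

(** A total limit, meaningful for sequences that are Cauchy at the rate (1/2)^n. All limits of
    functions below are taken at this explicit rate. *)
Definition clim (c : nat -> C) : C :=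
  (real (Lim_seq (fun n => fst (c n))), real (Lim_seq (fun n => snd (c n)))).

Lemma half_pow_pos (n : nat) : 0 < (1 / 2) ^ n.
Proof. apply pow_lt. lra. Qed.

Lemma half_pow_le (n m : nat) : (n <= m)%nat -> (1 / 2) ^ m <= (1 / 2) ^ n.
Proof.
  intros H. replace m with (n + (m - n))%nat by lia. rewrite pow_add.
  pose proof (pow_incr (1 / 2) 1 (m - n) ltac:(lra)) as K. rewrite pow1 in K.
  pose proof (half_pow_pos n). nra.
Qed.

Lemma half_pow_small (K eps : R) : 0 < eps -> exists N, forall n, (N <= n)%nat -> K * (1 / 2) ^ n < eps.
Proof.
  intros He. pose proof (Rabs_pos K).
  destruct (pow_lt_1_zero (1 / 2) ltac:(rewrite Rabs_pos_eq; lra) (eps / (1 + Rabs K))) as [N HN].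
  { apply Rdiv_lt_0_compat; lra. }
  exists N. intros n Hn. specialize (HN n Hn). pose proof (half_pow_pos n). rewrite Rabs_pos_eq in HN by lra.
  apply (Rmult_lt_compat_l (1 + Rabs K)) in HN; [| lra].
  replace ((1 + Rabs K) * (eps / (1 + Rabs K))) with eps in HN by (field; lra).
  pose proof (Rle_abs K). nra.
Qed.

Lemma le_half_pow (x y K : R) : (forall n, x <= y + K * (1 / 2) ^ n) -> x <= y.
Proof.
  intros H. apply le_epsilon. intros eps He. destruct (half_pow_small K eps He) as [N HN].
  specialize (H N). specialize (HN N (le_n N)). lra.
Qed.

Lemma eq_half_pow (x y : C) (K : R) : (forall n, Cmod (x - y)%C <= K * (1 / 2) ^ n) -> x = y.
Proof.
  intros H. assert (E : (x - y)%C = 0).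
  { apply Cmod_eq_0, Rle_antisym; [| apply Cmod_ge_0]. apply (le_half_pow _ _ K). intros n.
    specialize (H n). lra. }
  replace x with ((x - y) + y)%C by ring. rewrite E. ring.
Qed.

(** The factor 2 comes from treating real and imaginary parts separately. *)
Lemma clim_spec (c : nat -> C) (K : R) :
  (forall n m, (n <= m)%nat -> Cmod (c m - c n)%C <= K * (1 / 2) ^ n) ->
  forall n, Cmod (clim c - c n)%C <= 2 * K * (1 / 2) ^ n.
Proof.
  intros H n0.
  assert (P : forall p : C -> R, (forall z w, Rabs (p z - p w) <= Cmod (z - w)%C) ->
    Rabs (real (Lim_seq (fun n => p (c n))) - p (c n0)) <= K * (1 / 2) ^ n0).
  { intros p Hp.
    assert (Hl : ex_finite_lim_seq (fun n => p (c n))).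
    { apply ex_lim_seq_cauchy_corr. intros eps.
      destruct (half_pow_small K (eps / 2)) as [N HN]; [apply is_pos_div_2 |].
      exists N. intros n m Hn Hm. specialize (HN N (le_n N)).
      pose proof (Rle_trans _ _ _ (Hp (c n) (c N)) (H N n Hn)) as Kn.
      pose proof (Rle_trans _ _ _ (Hp (c m) (c N)) (H N m Hm)) as Km.
      replace (p (c n) - p (c m)) with ((p (c n) - p (c N)) - (p (c m) - p (c N))) by ring.
      eapply Rle_lt_trans; [apply Rabs_triang |]. rewrite Rabs_Ropp. lra. }
    apply Lim_seq_correct' in Hl. set (l := real (Lim_seq _)) in *.
    apply (is_lim_seq_le_loc (fun n => Rabs (p (c n) - p (c n0))) (fun _ => K * (1 / 2) ^ n0)
      (Rabs (l - p (c n0))) (K * (1 / 2) ^ n0)).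
    - exists n0. intros n Hn. eapply Rle_trans; [apply Hp | now apply H].
    - apply (is_lim_seq_abs _ (Finite (l - p (c n0)))).
      apply (is_lim_seq_minus' _ _ l (p (c n0)) Hl). apply is_lim_seq_const.
    - apply is_lim_seq_const. }
  eapply Rle_trans; [apply Cmod_le_sum |].
  assert (K1 := P fst (fun z w => Rabs_fst_Cmod (z - w)%C)).
  assert (K2 := P snd (fun z w => Rabs_snd_Cmod (z - w)%C)).
  replace (2 * K * (1 / 2) ^ n0) with (K * (1 / 2) ^ n0 + K * (1 / 2) ^ n0) by ring.
  exact (Rplus_le_compat _ _ _ _ K1 K2).
Qed.

Lemma clim_unique (c : nat -> C) (K K' : R) (l : C) :
  (forall n m, (n <= m)%nat -> Cmod (c m - c n)%C <= K * (1 / 2) ^ n) ->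
  (forall n, Cmod (l - c n)%C <= K' * (1 / 2) ^ n) -> clim c = l.
Proof.
  intros H H'. apply (eq_half_pow _ _ (2 * K + K')). intros n.
  pose proof (clim_spec c K H n). specialize (H' n). rewrite (Cmod_minus_sym l) in H'.
  pose proof (Cmod_dist_triangle (clim c) (c n) l). lra.
Qed.

Definition expint_to (f : R -> C) (T : R) : C := CI (fun s => RtoC (exp s) * f s)%C (- T) 0.

(** The integral of e^s f(s) over the negative half-line, as a limit along integers; [expint_spec]
    extends the convergence to all real T, with error S e^(-T). *)
Definition expint (f : R -> C) : C := clim (fun n => expint_to f (INR n)).

Lemma exp_opp_small (K eps : R) : 0 < eps -> exists N, 0 <= N /\ forall T, N <= T -> K * exp (- T) < eps.
Proof.
  intros He. pose proof (Rabs_pos K). exists (Rabs K / eps). split.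
  { apply Rdiv_le_0_compat; lra. }
  intros T HT. assert (HT' : Rabs K <= T * eps).
  { apply (Rmult_le_compat_r eps) in HT; [| lra]. replace (Rabs K / eps * eps) with (Rabs K) in HT by (field; lra). auto. }
  pose proof (exp_ineq1_le T). rewrite exp_Ropp.
  apply Rmult_lt_reg_r with (exp T); [apply exp_pos |].
  rewrite Rmult_assoc, Rinv_l, Rmult_1_r by (apply Rgt_not_eq, exp_pos).
  pose proof (Rle_abs K). apply Rle_lt_trans with (T * eps); [lra |].
  rewrite Rmult_comm. apply Rmult_lt_compat_l; lra.
Qed.

Lemma le_exp_lim (x y K : R) : (forall T, 0 <= T -> x <= y + K * exp (- T)) -> x <= y.
Proof.
  intros H. apply le_epsilon. intros eps He.
  destruct (exp_opp_small K eps He) as [N [HN HT]].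
  specialize (H N HN). specialize (HT N (Rle_refl N)). lra.
Qed.

Lemma RInt_exp (a b : R) : RInt exp a b = exp b - exp a.
Proof.
  apply is_RInt_unique. apply (is_RInt_derive (V := R_CompleteNormedModule) exp).
  - intros x _. auto_derive; auto. ring.
  - intros x _. apply (derive_continuous exp x (exp x)). auto_derive; auto. ring.
Qed.

Lemma contline_exp : contline (fun s => RtoC (exp s)).
Proof.
  intros s. apply (pder_ccont _ _ (RtoC (exp s))). split; simpl.
  - auto_derive; auto. ring.
  - apply (is_derive_const (V := R_NormedModule)).
Qed.

Lemma contline_expmul (f : R -> C) : contline f -> contline (fun s => RtoC (exp s) * f s)%C.
Proof. intros Hf. apply contline_mult; auto using contline_exp. Qed.

Lemma ex_CI_line (f : R -> C) (a b : R) : contline f -> ex_CI f a b.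
Proof. intros Hf. apply ex_CI_cont. intros t _. apply Hf. Qed.

Lemma expint_piece (f : R -> C) (S a b : R) : contline f -> (forall s, Cmod (f s) <= S) -> a <= b ->
  Cmod (CI (fun s => RtoC (exp s) * f s)%C a b) <= S * (exp b - exp a).
Proof.
  intros Hf HS Hab. rewrite <- RInt_exp.
  assert (Ie : ex_RInt exp a b).
  { apply (ex_RInt_continuous (V := R_CompleteNormedModule)). intros x _.
    apply (derive_continuous exp x (exp x)). auto_derive; auto. ring. }
  change (S * RInt exp a b) with (scal S (RInt exp a b)).
  rewrite <- (RInt_scal (V := R_CompleteNormedModule)) by auto.
  apply CI_norm; auto.
  - apply ex_CI_line. now apply contline_expmul.
  - now apply (ex_RInt_scal (V := R_NormedModule)).
  - intros t _. rewrite Cmod_mult, Cmod_R, Rabs_pos_eq by (left; apply exp_pos).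
    change (exp t * Cmod (f t) <= S * exp t). rewrite Rmult_comm.
    apply Rmult_le_compat_r; auto. left. apply exp_pos.
Qed.

Lemma expint_to_cauchy (f : R -> C) (S T T' : R) : contline f -> (forall s, Cmod (f s) <= S) ->
  0 <= T <= T' -> Cmod (expint_to f T' - expint_to f T)%C <= S * exp (- T).
Proof.
  intros Hf HS HT. unfold expint_to. pose proof (contline_expmul f Hf) as Hc.
  rewrite <- (CI_Chasles _ (- T') (- T) 0) by now apply ex_CI_line.
  match goal with |- Cmod ?z <= _ => replace z with (CI (fun s => RtoC (exp s) * f s)%C (- T') (- T)) by ring end.
  eapply Rle_trans; [apply expint_piece; eauto; lra |].
  pose proof (exp_pos (- T')). pose proof (Rle_trans _ _ _ (Cmod_ge_0 (f 0)) (HS 0)). nra.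
Qed.

Lemma exp_le_half_pow (n : nat) : exp (- INR n) <= (1 / 2) ^ n.
Proof.
  induction n; [simpl; rewrite Ropp_0, exp_0; lra |].
  rewrite S_INR, Ropp_plus_distr, exp_plus, Rmult_comm. simpl pow.
  apply Rmult_le_compat; auto; try (left; apply exp_pos).
  pose proof (exp_ineq1_le 1). rewrite exp_Ropp. unfold Rdiv. rewrite Rmult_1_l.
  apply Rinv_le_contravar; lra.
Qed.

Lemma expint_spec (f : R -> C) (S T : R) : contline f -> (forall s, Cmod (f s) <= S) -> 0 <= T ->
  Cmod (expint f - expint_to f T)%C <= S * exp (- T).
Proof.
  intros Hf HS HT.
  assert (HS0 : 0 <= S) by (eapply Rle_trans; [apply (Cmod_ge_0 (f 0)) | auto]).
  assert (K := clim_spec (fun n => expint_to f (INR n)) S). fold (expint f) in K.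
  destruct (nfloor_ex T HT) as [n0 Hn0].
  apply (le_half_pow _ _ (2 * S)). intros n.
  set (m := (n + Datatypes.S n0)%nat).
  assert (Hm : T <= INR m).
  { unfold m. rewrite plus_INR, S_INR. pose proof (pos_INR n). lra. }
  pose proof (Cmod_dist_triangle (expint f) (expint_to f (INR m)) (expint_to f T)).
  pose proof (expint_to_cauchy f S T (INR m) Hf HS ltac:(lra)).
  assert (K2 : Cmod (expint f - expint_to f (INR m))%C <= 2 * S * (1 / 2) ^ m).
  { apply K. intros i j Hij. eapply Rle_trans.
    - apply expint_to_cauchy; [exact Hf | exact HS |]. split; [apply pos_INR | now apply le_INR].
    - apply Rmult_le_compat_l; auto using exp_le_half_pow. }
  assert (2 * S * (1 / 2) ^ m <= 2 * S * (1 / 2) ^ n).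
  { apply Rmult_le_compat_l; [lra |]. apply half_pow_le. lia. }
  lra.
Qed.

Lemma expint_unique (f : R -> C) (S K : R) (l : C) : contline f -> (forall s, Cmod (f s) <= S) ->
  (forall T, 0 <= T -> Cmod (l - expint_to f T)%C <= K * exp (- T)) -> expint f = l.
Proof.
  intros Hf HS H. assert (E : (expint f - l)%C = 0).
  { apply Cmod_eq_0, Rle_antisym; [| apply Cmod_ge_0].
    apply (le_exp_lim _ _ (S + K)). intros T HT.
    pose proof (expint_spec f S T Hf HS HT). specialize (H T HT).
    pose proof (Cmod_dist_triangle (expint f) (expint_to f T) l). rewrite (Cmod_minus_sym (expint_to f T) l) in *. lra. }
  replace (expint f) with ((expint f - l) + l)%C by ring. rewrite E. ring.
Qed.

Lemma expint_bound (f : R -> C) (S : R) : contline f -> (forall s, Cmod (f s) <= S) ->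
  Cmod (expint f) <= S.
Proof.
  intros Hf HS. apply (le_exp_lim _ _ S). intros T HT.
  pose proof (expint_spec f S T Hf HS HT).
  pose proof (expint_piece f S (- T) 0 Hf HS ltac:(lra)) as K. fold (expint_to f T) in K.
  pose proof (Cmod_triangle_minus (expint f) (expint_to f T)).
  rewrite exp_0 in K. pose proof (exp_pos (- T)).
  pose proof (Rle_trans _ _ _ (Cmod_ge_0 (f 0)) (HS 0)). nra.
Qed.

(** Cauchy-Schwarz in the form e^s |f| <= (m/2) e^(2s) + |f|^2/(2m), with e^(2s) <= e^s for s <= 0:
    each term integrates to at most m/2. *)
Lemma expint_bound_L2 (f : R -> C) (S m : R) : contline f -> (forall s, Cmod (f s) <= S) ->
  0 < m -> L2B f m -> Cmod (expint f) <= m.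
Proof.
  intros Hf HS Hm HL. apply (le_exp_lim _ _ S). intros T HT.
  pose proof (expint_spec f S T Hf HS HT).
  pose proof (Cmod_triangle_minus (expint f) (expint_to f T)).
  assert (Cmod (expint_to f T) <= m); [| lra].
  assert (Ie : forall a b, ex_RInt exp a b).
  { intros a b. apply (ex_RInt_continuous (V := R_CompleteNormedModule)). intros x _.
    apply (derive_continuous exp x (exp x)). auto_derive; auto. ring. }
  assert (I1 : ex_RInt (fun s => m / 2 * exp s) (- T) 0)
    by (apply (ex_RInt_scal (V := R_NormedModule)); auto).
  assert (I2 : ex_RInt (fun s => / (2 * m) * Cnorm2 (f s)) (- T) 0).
  { apply (ex_RInt_scal (V := R_NormedModule) (fun s => Cnorm2 (f s))). now apply ex_RInt_Cnorm2. }
  eapply Rle_trans.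
  - apply (CI_norm _ (fun s => m / 2 * exp s + / (2 * m) * Cnorm2 (f s))).
    + lra.
    + apply ex_CI_line. now apply contline_expmul.
    + now apply (ex_RInt_plus (V := R_NormedModule)).
    + intros t Ht. rewrite Cmod_mult, Cmod_R, Rabs_pos_eq by (left; apply exp_pos).
      rewrite Cnorm2_Cmod. set (u := Cmod (f t)).
      assert (He : 0 < exp t <= 1).
      { split. apply exp_pos. rewrite <- exp_0. left. apply exp_increasing. lra. }
      set (e := exp t) in *.
      assert (0 <= / (2 * m) * ((m * e - u) * (m * e - u))).
      { apply Rmult_le_pos. left. apply Rinv_0_lt_compat. lra. apply Rle_0_sqr. }
      replace (/ (2 * m) * ((m * e - u) * (m * e - u)))
        with (m / 2 * (e * e) - e * u + / (2 * m) * (u * u)) in * by (field; lra).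
      assert (e * e <= e) by nra. assert (m / 2 * (e * e) <= m / 2 * e) by (apply Rmult_le_compat_l; lra).
      lra.
  - rewrite (RInt_plus (V := R_CompleteNormedModule)) by auto.
    rewrite (RInt_scal (V := R_CompleteNormedModule)) by auto.
    rewrite (RInt_scal (V := R_CompleteNormedModule) (fun s => Cnorm2 (f s))) by now apply ex_RInt_Cnorm2.
    rewrite RInt_exp, exp_0. specialize (HL (- T) 0 ltac:(lra)).
    change (m / 2 * (1 - exp (- T)) + / (2 * m) * RInt (fun x => Cnorm2 (f x)) (- T) 0 <= m).
    apply Rle_trans with (m / 2 + / (2 * m) * (m * m)); [| right; field; lra].
    apply Rplus_le_compat.
    + pose proof (exp_pos (- T)). nra.
    + apply Rmult_le_compat_l; auto. left. apply Rinv_0_lt_compat. lra.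
Qed.

Lemma expint_plus (f g : R -> C) (S S' : R) : contline f -> contline g ->
  (forall s, Cmod (f s) <= S) -> (forall s, Cmod (g s) <= S') ->
  expint (fun s => f s + g s)%C = (expint f + expint g)%C.
Proof.
  intros Hf Hg HS HS'. apply (expint_unique _ (S + S') (S + S')).
  - now apply contline_plus.
  - intros s. eapply Rle_trans; [apply Cmod_triangle |]. now apply Rplus_le_compat.
  - intros T HT. replace (expint_to (fun s => f s + g s)%C T) with (expint_to f T + expint_to g T)%C.
    + replace (expint f + expint g - (expint_to f T + expint_to g T))%C
        with ((expint f - expint_to f T) + (expint g - expint_to g T))%C by ring.
      eapply Rle_trans; [apply Cmod_triangle |].
      pose proof (expint_spec f S T Hf HS HT). pose proof (expint_spec g S' T Hg HS' HT). lra.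
    + unfold expint_to. rewrite <- CI_plus by (apply ex_CI_line; now apply contline_expmul).
      apply CI_ext. intros t _. ring.
Qed.

Lemma expint_scal (c : C) (f : R -> C) (S : R) : contline f -> (forall s, Cmod (f s) <= S) ->
  expint (fun s => c * f s)%C = (c * expint f)%C.
Proof.
  intros Hf HS. apply (expint_unique _ (Cmod c * S) (Cmod c * S)).
  - now apply contline_scal.
  - intros s. rewrite Cmod_mult. apply Rmult_le_compat_l; auto using Cmod_ge_0.
  - intros T HT. replace (expint_to (fun s => c * f s)%C T) with (c * expint_to f T)%C.
    + replace (c * expint f - c * expint_to f T)%C with (c * (expint f - expint_to f T))%C by ring.
      rewrite Cmod_mult, Rmult_assoc. apply Rmult_le_compat_l; [apply Cmod_ge_0 |]. now apply expint_spec.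
    + unfold expint_to. rewrite <- CI_scal by (apply ex_CI_line; now apply contline_expmul).
      apply CI_ext. intros t _. ring.
Qed.

Lemma expint_ext (f g : R -> C) : (forall s, f s = g s) -> expint f = expint g.
Proof.
  intros H. unfold expint, expint_to, clim.
  assert (E : forall n, CI (fun s => RtoC (exp s) * f s)%C (- INR n) 0 = CI (fun s => RtoC (exp s) * g s)%C (- INR n) 0).
  { intros n. apply CI_ext. intros t _. now rewrite H. }
  f_equal; f_equal; apply Lim_seq_ext; intros n; now rewrite E.
Qed.

Lemma pder_expmul (f : R -> C) (t : R) (l : C) : pder f t l ->
  pder (fun s => RtoC (exp s) * f s)%C t (RtoC (exp t) * (f t + l))%C.
Proof.
  assert (De : is_derive exp t (exp t)) by (auto_derive; auto; ring).
  assert (K : forall (g : R -> R) (m : R), is_derive g t m ->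
    is_derive (fun s => exp s * g s) t (exp t * (g t + m))).
  { intros g m Dg. replace (exp t * (g t + m)) with (exp t * g t + exp t * m) by ring.
    apply (is_derive_mult exp g t (exp t) m De Dg Rmult_comm). }
  intros [D1 D2]. split; simpl.
  - apply (is_derive_ext (fun s => exp s * fst (f s))); [intros s; simpl; ring |].
    replace (exp t * (fst (f t) + fst l) - 0 * (snd (f t) + snd l))
      with (exp t * (fst (f t) + fst l)) by ring. now apply K.
  - apply (is_derive_ext (fun s => exp s * snd (f s))); [intros s; simpl; ring |].
    replace (exp t * (snd (f t) + snd l) + 0 * (fst (f t) + fst l))
      with (exp t * (snd (f t) + snd l)) by ring. now apply K.
Qed.

(** Integration by parts: e^s (f + f') is the derivative of e^s f, whose value at -T is at most S
    e^(-T). *)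
Lemma expint_parts (f df : R -> C) (S S' : R) : contline df -> (forall s, pder f s (df s)) ->
  (forall s, Cmod (f s) <= S) -> (forall s, Cmod (df s) <= S') ->
  (expint f + expint df)%C = f 0.
Proof.
  intros Hdf Hd HS HS'. assert (Hf : contline f) by (intros s; eapply pder_ccont, Hd).
  rewrite <- (expint_plus f df S S') by auto.
  apply (expint_unique _ (S + S') S).
  - now apply contline_plus.
  - intros s. eapply Rle_trans; [apply Cmod_triangle |]. now apply Rplus_le_compat.
  - intros T HT. unfold expint_to. rewrite (CI_derive (fun s => RtoC (exp s) * f s)%C).
    + rewrite exp_0. replace (f 0 - (RtoC 1 * f 0 - RtoC (exp (- T)) * f (- T)%R))%C
        with (RtoC (exp (- T)) * f (- T)%R)%C by ring.
      rewrite Cmod_mult, Cmod_R, Rabs_pos_eq, Rmult_comm by (left; apply exp_pos).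
      apply Rmult_le_compat_r; auto. left; apply exp_pos.
    + intros t _. now apply pder_expmul.
    + intros t _. apply contline_expmul. now apply contline_plus.
Qed.

(** For sg = 1 this is the inverse of 1 + d/dx, for sg = -1 the inverse of 1 - d/dx. Their product
    inverts 1 - d^2/dx^2, and so does their half sum [Wop]. *)
Definition Aop (sg : R) (g : C -> C) (z : C) : C := expint (fun s => g (z + RtoC (sg * s))%C).

Lemma line_shift (sg s : R) (z : C) : (z + RtoC (sg * s))%C = (fst z + sg * s, snd z).
Proof. apply injective_projections; simpl; ring. Qed.

Lemma pder_ray (sg : R) (z : C) (t : R) : pder (fun s => z + RtoC (sg * s))%C t (RtoC sg).
Proof. split; simpl; auto_derive; auto; ring. Qed.

Lemma hol_pder_ray (s sg : R) (g : C -> C) (z : C) (t : R) : hol s g -> Rabs (snd z) < s ->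
  pder (fun s => g (z + RtoC (sg * s))%C) t (RtoC sg * Cd g (z + RtoC (sg * t)))%C.
Proof.
  intros H Hz. rewrite Cmult_comm. apply (pder_comp g (fun s => z + RtoC (sg * s))%C); [| apply pder_ray].
  apply (hol_cdiff s); auto. rewrite line_shift. exact Hz.
Qed.

Lemma hol_ray (s sg : R) (g : C -> C) (z : C) : hol s g -> Rabs (snd z) < s ->
  contline (fun s => g (z + RtoC (sg * s))%C).
Proof. intros H Hz t. eapply pder_ccont, (hol_pder_ray s); auto. Qed.

Lemma Aop_bound_line (s sg S : R) (g : C -> C) (z : C) : hol s g -> Rabs (snd z) < s ->
  (forall x, Cmod (g (x, snd z)) <= S) -> Cmod (Aop sg g z) <= S.
Proof.
  intros H Hz HS. apply expint_bound. now apply (hol_ray s). intros t. now rewrite line_shift.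
Qed.

Lemma bnd_line (s S : R) (g : C -> C) (z : C) : bnd s S g -> Rabs (snd z) < s ->
  forall x, Cmod (g (x, snd z)) <= S.
Proof. intros H Hz x. now apply H. Qed.

Lemma Cd_line_bound (s S : R) (g : C -> C) (z : C) : hol s g -> bnd s S g -> Rabs (snd z) < s ->
  forall x, Cmod (Cd g (x, snd z)) <= S / (s - Rabs (snd z)).
Proof. intros H HS Hz x. now apply (hol_Cd_bound s S g (x, snd z)). Qed.

Lemma Aop_plus (s sg S S' : R) (g h : C -> C) (z : C) : hol s g -> hol s h -> Rabs (snd z) < s ->
  (forall x, Cmod (g (x, snd z)) <= S) -> (forall x, Cmod (h (x, snd z)) <= S') ->
  Aop sg (fun z => g z + h z)%C z = (Aop sg g z + Aop sg h z)%C.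
Proof.
  intros Hg Hh Hz HS HS'. apply (expint_plus _ _ S S'); try (apply (hol_ray s); auto);
  intros t; now rewrite line_shift.
Qed.

Lemma Aop_scal (s sg S : R) (c : C) (g : C -> C) (z : C) : hol s g -> Rabs (snd z) < s ->
  (forall x, Cmod (g (x, snd z)) <= S) -> Aop sg (fun z => c * g z)%C z = (c * Aop sg g z)%C.
Proof.
  intros Hg Hz HS. apply (expint_scal _ _ S). apply (hol_ray s); auto.
  intros t; now rewrite line_shift.
Qed.

Lemma Aop_ext_line (sg : R) (g h : C -> C) (z : C) :
  (forall x, g (x, snd z) = h (x, snd z)) -> Aop sg g z = Aop sg h z.
Proof. intros H. apply expint_ext. intros t. rewrite line_shift. apply H. Qed.

Lemma Aop_Cd (s sg S : R) (g : C -> C) (z : C) : sg * sg = 1 -> hol s g -> bnd s S g ->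
  Rabs (snd z) < s -> Aop sg (Cd g) z = (RtoC sg * (g z - Aop sg g z))%C.
Proof.
  intros Hsg H HS Hz.
  assert (B := Cd_line_bound s S g z H HS Hz).
  assert (B' : forall t, Cmod (Cd g (z + RtoC (sg * t))%C) <= S / (s - Rabs (snd z)))
    by (intros t; rewrite line_shift; apply B).
  assert (Hc : contline (fun s0 => Cd g (z + RtoC (sg * s0))%C)) by (apply (hol_ray s); auto using hol_Cd).
  pose proof (expint_parts (fun s => g (z + RtoC (sg * s))%C)
    (fun s => RtoC sg * Cd g (z + RtoC (sg * s)))%C S (Cmod (RtoC sg) * (S / (s - Rabs (snd z))))) as K.
  rewrite (expint_scal _ _ (S / (s - Rabs (snd z)))) in K; auto.
  fold (Aop sg g z) in K. fold (Aop sg (Cd g) z) in K.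
  replace (z + RtoC (sg * 0))%C with z in K by (rewrite Rmult_0_r; ring).
  rewrite <- K.
  - replace (RtoC sg * (Aop sg g z + RtoC sg * Aop sg (Cd g) z - Aop sg g z))%C
      with ((RtoC sg * RtoC sg) * Aop sg (Cd g) z)%C by ring.
    rewrite <- RtoC_mult, Hsg. ring.
  - now apply contline_scal.
  - intros t. now apply (hol_pder_ray s).
  - intros t. rewrite line_shift. now apply HS.
  - intros t. rewrite Cmod_mult. apply Rmult_le_compat_l; auto using Cmod_ge_0.
Qed.

(** Differentiation under the integral gives [Aop sg (Cd g)], and integration by parts removes the
    derivative from g. This is the gain of one derivative that the nonlocal term relies on. *)
Lemma Aop_cdiff (s sg S : R) (g : C -> C) (z : C) : sg * sg = 1 -> hol s g -> bnd s S g ->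
  Rabs (snd z) < s -> cdiff (Aop sg g) z (RtoC sg * (g z - Aop sg g z))%C.
Proof.
  intros Hsg H HS Hz. rewrite <- (Aop_Cd s sg S g z); auto.
  set (d := (s - Rabs (snd z)) / 5). assert (Hd : 0 < d) by (unfold d; lra).
  apply (cdiff_taylor2 _ _ _ (S / (d * d)) d); auto. intros h Hh.
  assert (Hzh : Rabs (snd (z + h)%C) < s).
  { pose proof (snd_dist z (z + h)%C). replace (z + h - z)%C with h in * by ring. unfold d in *. lra. }
  set (f1 := fun t => g (z + h + RtoC (sg * t))%C). set (f2 := fun t => g (z + RtoC (sg * t))%C).
  set (f3 := fun t => Cd g (z + RtoC (sg * t))%C).
  assert (C1 : contline f1) by (apply (hol_ray s); auto).
  assert (C2 : contline f2) by (apply (hol_ray s); auto).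
  assert (C3 : contline f3) by (apply (hol_ray s); auto using hol_Cd).
  assert (B1 : forall t, Cmod (f1 t) <= S) by (intros t; unfold f1; rewrite line_shift; now apply HS).
  assert (B2 : forall t, Cmod (f2 t) <= S) by (intros t; unfold f2; rewrite line_shift; now apply HS).
  assert (B3 : forall t, Cmod (f3 t) <= S / (s - Rabs (snd z)))
    by (intros t; unfold f3; rewrite line_shift; now apply Cd_line_bound).
  replace (Aop sg g (z + h) - Aop sg g z - Aop sg (Cd g) z * h)%C
    with (expint (fun t => (f1 t + (- (1)) * f2 t) + (- h) * f3 t)%C).
  - apply expint_bound.
    + auto using contline_plus, contline_scal.
    + intros t. unfold f1, f2, f3. set (w := (z + RtoC (sg * t))%C).
      replace (z + h + RtoC (sg * t))%C with (w + h)%C by (unfold w; ring).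
      replace (g (w + h) + (- (1)) * g w + - h * Cd g w)%C with (g (w + h) - g w - Cd g w * h)%C by ring.
      apply (hol_taylor2 s S g w h d); auto. unfold w. rewrite line_shift. simpl. unfold d. lra.
  - assert (P1 : forall t, Cmod ((- (1)) * f2 t)%C <= S).
    { intros t. rewrite Cmod_mult, Cmod_m1, Rmult_1_l. auto. }
    assert (P2 : forall t, Cmod (- h * f3 t)%C <= Cmod h * (S / (s - Rabs (snd z)))).
    { intros t. rewrite Cmod_mult, Cmod_opp. apply Rmult_le_compat_l; auto using Cmod_ge_0. }
    rewrite (expint_plus _ _ (S + S) (Cmod h * (S / (s - Rabs (snd z))))); auto using contline_plus, contline_scal.
    2:{ intros t. eapply Rle_trans; [apply Cmod_triangle |]. now apply Rplus_le_compat. }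
    rewrite (expint_plus _ _ S S); auto using contline_scal.
    rewrite (expint_scal _ _ S), (expint_scal _ _ (S / (s - Rabs (snd z)))); auto.
    unfold Aop. fold f1. fold f2. fold f3. ring.
Qed.

Lemma L2B_rev (g : R -> C) (m c a b : R) : contline g -> L2B g m -> a <= b ->
  RInt (fun x => Cnorm2 (g (- x + c))) a b <= m * m.
Proof.
  intros Hg H Hab.
  pose proof (RInt_comp_lin (V := R_CompleteNormedModule) (fun x => Cnorm2 (g x)) (-1) c a b) as E.
  assert (E2 : RInt (fun x => Cnorm2 (g (- x + c))) a b = RInt (fun x => Cnorm2 (g x)) (- b + c) (- a + c)).
  { replace (- b + c) with (-1 * b + c) by ring. replace (- a + c) with (-1 * a + c) by ring.
    rewrite <- (opp_RInt_swap (V := R_CompleteNormedModule) _ (-1 * a + c)) by now apply ex_RInt_Cnorm2.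
    rewrite <- E by now apply ex_RInt_Cnorm2.
    rewrite <- (RInt_opp (V := R_CompleteNormedModule)).
    - apply RInt_ext. intros x _.
      change (Cnorm2 (g (- x + c)) = - (-1 * Cnorm2 (g (-1 * x + c)))).
      replace (-1 * x + c) with (- x + c) by ring. ring.
    - apply (ex_RInt_comp_lin (V := R_NormedModule) (fun x => Cnorm2 (g x))). now apply ex_RInt_Cnorm2. }
  rewrite E2. apply H. lra.
Qed.

Lemma L2B_ray (sg m : R) (g : C -> C) (z : C) : sg = 1 \/ sg = -1 -> contline (line g (snd z)) ->
  L2B (line g (snd z)) m -> L2B (fun t => g (z + RtoC (sg * t))%C) m.
Proof.
  intros Hsg Hg H a b Hab. destruct Hsg as [-> | ->].
  - rewrite (RInt_ext _ (fun x => Cnorm2 (line g (snd z) (x + fst z)))).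
    now apply L2B_shift. intros x _. rewrite line_shift. unfold line. do 2 f_equal. f_equal. ring.
  - rewrite (RInt_ext _ (fun x => Cnorm2 (line g (snd z) (- x + fst z)))).
    now apply L2B_rev. intros x _. rewrite line_shift. unfold line. do 2 f_equal. f_equal. ring.
Qed.

Lemma pm_sq (sg : R) : sg = 1 \/ sg = -1 -> sg * sg = 1.
Proof. intros [-> | ->]; ring. Qed.

Lemma energy_pointwise (sg : R) (p q : C) : sg = 1 \/ sg = -1 ->
  Cnorm2 p - Cnorm2 q + sg * (2 * (fst p * fst (RtoC sg * (q - p))%C + snd p * snd (RtoC sg * (q - p))%C)) <= 0.
Proof.
  intros Hsg. unfold Cnorm2. simpl.
  pose proof (Rle_0_sqr (fst p - fst q)). pose proof (Rle_0_sqr (snd p - snd q)). unfold Rsqr in *.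
  destruct Hsg as [-> | ->]; lra.
Qed.

(* With A' = sg (g - A) one has sg d|A|^2/dx = 2 Re (conj A g) - 2 |A|^2 <= |g|^2 - |A|^2. *)
Lemma Aop_L2B (s sg S m y : R) (g : C -> C) : sg = 1 \/ sg = -1 -> hol s g -> bnd s S g ->
  Rabs y < s -> 0 < m -> L2B (line g y) m -> L2B (line (Aop sg g) y) (2 * m).
Proof.
  intros Hsg H HS Hy Hm HL a b Hab.
  assert (Hg : contline (line g y)) by now apply (hol_contline s).
  (* This controls the boundary terms of the energy inequality; the outcome 2 m^2 is below
     (2m)^2. *)
  assert (Bpt : forall x, Cnorm2 (Aop sg g (x, y)) <= m * m).
  { intros x. apply Cnorm2_le_of_Cmod. apply (expint_bound_L2 _ S); auto.
    - apply (hol_ray s); auto.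
    - intros t. rewrite line_shift. now apply HS.
    - now apply (L2B_ray sg m g (x, y)). }
  set (A := line (Aop sg g) y). set (dA := fun x => (RtoC sg * (line g y x - A x))%C).
  assert (HD : forall x, pder A x (dA x)).
  { intros x. apply (cdiff_pder_line (Aop sg g) (x, y)). apply (Aop_cdiff s sg S); auto using pm_sq. }
  assert (HA : contline A) by (intros x; eapply pder_ccont, HD).
  assert (IA : forall x, continuous (fun x => Cnorm2 (A x)) x) by (intros x; now apply continuous_Cnorm2).
  assert (Ig : forall x, continuous (fun x => Cnorm2 (line g y x)) x) by (intros x; now apply continuous_Cnorm2).
  pose proof (derive_nonpos_le
    (fun u => (RInt (fun x => Cnorm2 (A x)) a u - RInt (fun x => Cnorm2 (line g y x)) a u) + sg * Cnorm2 (A u))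
    (fun u => (Cnorm2 (A u) - Cnorm2 (line g y u)) + sg * (2 * (fst (A u) * fst (dA u) + snd (A u) * snd (dA u))))
    a b Hab) as K.
  cbv beta in K. rewrite !RInt_point in K. change (zero : R) with 0 in K.
  assert (D : forall u, is_derive (fun u => (RInt (fun x => Cnorm2 (A x)) a u - RInt (fun x => Cnorm2 (line g y x)) a u) + sg * Cnorm2 (A u)) u
    ((Cnorm2 (A u) - Cnorm2 (line g y u)) + sg * (2 * (fst (A u) * fst (dA u) + snd (A u) * snd (dA u))))).
  { intros u. apply (is_derive_plus (V := R_NormedModule)
      (fun u => (RInt (fun x => Cnorm2 (A x)) a u - RInt (fun x => Cnorm2 (line g y x)) a u)) (fun u => sg * Cnorm2 (A u))).
    - apply (is_derive_minus (V := R_NormedModule) (fun u => RInt (fun x => Cnorm2 (A x)) a u) (fun u => RInt (fun x => Cnorm2 (line g y x)) a u));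
      now apply (is_derive_RInt_cont).
    - apply (is_derive_scal (fun u => Cnorm2 (A u))). now apply pder_Cnorm2. }
  specialize (HL a b Hab).
  assert (Ba : Cnorm2 (A a) <= m * m) by apply Bpt.
  assert (Bb : Cnorm2 (A b) <= m * m) by apply Bpt.
  pose proof (Cnorm2_ge_0 (A a)). pose proof (Cnorm2_ge_0 (A b)).
  assert (K' := K (fun u _ => conj (D u) (energy_pointwise sg (A u) (line g y u) Hsg))
    (fun u _ => derive_continuous _ _ _ (D u))).
  change (RInt (fun x => Cnorm2 (A x)) a b <= 2 * m * (2 * m)).
  clear K. clearbody A. destruct Hsg as [-> | ->]; lra.
Qed.

(* [Wop g] is (1 - d^2)^(-1) g, with the kernel exp(-|x - y|)/2 split at y = x; [Pop g] is its derivative. *)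
Definition Wop (g : C -> C) (z : C) : C := (RtoC (/ 2) * (Aop 1 g z + Aop (-1) g z))%C.

Definition Pop (g : C -> C) (z : C) : C := (RtoC (/ 2) * (Aop (-1) g z - Aop 1 g z))%C.

Lemma RtoC_half (w : C) : (RtoC (/ 2) * (w + w))%C = w.
Proof. apply injective_projections; simpl; field. Qed.

Lemma Wop_cdiff (s S : R) (g : C -> C) (z : C) : hol s g -> bnd s S g -> Rabs (snd z) < s ->
  cdiff (Wop g) z (Pop g z).
Proof.
  intros H HS Hz. unfold Wop, Pop.
  replace (RtoC (/ 2) * (Aop (-1) g z - Aop 1 g z))%C
    with (RtoC (/ 2) * (RtoC 1 * (g z - Aop 1 g z) + RtoC (-1) * (g z - Aop (-1) g z)))%C
    by (apply injective_projections; simpl; ring).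
  apply cdiff_scal. apply cdiff_plus; apply (Aop_cdiff s _ S); auto; ring.
Qed.

Lemma Pop_cdiff (s S : R) (g : C -> C) (z : C) : hol s g -> bnd s S g -> Rabs (snd z) < s ->
  cdiff (Pop g) z (Wop g z - g z)%C.
Proof.
  intros H HS Hz. unfold Wop, Pop.
  replace (RtoC (/ 2) * (Aop 1 g z + Aop (-1) g z) - g z)%C
    with (RtoC (/ 2) * (RtoC (-1) * (g z - Aop (-1) g z) - RtoC 1 * (g z - Aop 1 g z)))%C.
  - apply cdiff_scal. apply cdiff_minus; apply (Aop_cdiff s _ S); auto; ring.
  - rewrite <- (RtoC_half (g z)) at 3. apply injective_projections; simpl; ring.
Qed.

Lemma Pop_bound_line (s S : R) (g : C -> C) (z : C) : hol s g -> Rabs (snd z) < s ->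
  (forall x, Cmod (g (x, snd z)) <= S) -> Cmod (Pop g z) <= S.
Proof.
  intros H Hz HS. unfold Pop. rewrite Cmod_mult, Cmod_R, Rabs_pos_eq by lra.
  pose proof (Cmod_minus (Aop (-1) g z) (Aop 1 g z)).
  pose proof (Aop_bound_line s 1 S g z H Hz HS). pose proof (Aop_bound_line s (-1) S g z H Hz HS). lra.
Qed.

Lemma Pop_plus (s S S' : R) (g h : C -> C) (z : C) : hol s g -> hol s h -> Rabs (snd z) < s ->
  (forall x, Cmod (g (x, snd z)) <= S) -> (forall x, Cmod (h (x, snd z)) <= S') ->
  Pop (fun z => g z + h z)%C z = (Pop g z + Pop h z)%C.
Proof.
  intros Hg Hh Hz HS HS'. unfold Pop. rewrite !(Aop_plus s _ S S') by auto. ring.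
Qed.

Lemma Pop_scal (s S : R) (c : C) (g : C -> C) (z : C) : hol s g -> Rabs (snd z) < s ->
  (forall x, Cmod (g (x, snd z)) <= S) -> Pop (fun z => c * g z)%C z = (c * Pop g z)%C.
Proof.
  intros Hg Hz HS. unfold Pop. rewrite !(Aop_scal s _ S) by auto. ring.
Qed.

Lemma Pop_ext_line (g h : C -> C) (z : C) :
  (forall x, g (x, snd z) = h (x, snd z)) -> Pop g z = Pop h z.
Proof. intros H. unfold Pop. now rewrite !(Aop_ext_line _ g h). Qed.

(** Only the L2 norm of g enters, not that of its derivative, because the derivative of [Pop g] is
    [Wop g - g]; hence 3m = 2m + m. *)
Lemma HB_Pop (s S m : R) (g : C -> C) : 0 < m -> hol s g -> bnd s S g ->
  (forall y, Rabs y < s -> L2B (line g y) m) -> HB s (Pop g) (3 * m).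
Proof.
  intros Hm H HS HL.
  destruct (hol_intro s (Pop g) (fun z => Wop g z - g z)%C) as [P1 P2].
  { intros z Hz. now apply (Pop_cdiff s S). }
  split; [lra | split; auto]. intros y Hy. specialize (HL y Hy).
  assert (L1 := Aop_L2B s 1 S m y g (or_introl eq_refl) H HS Hy Hm HL).
  assert (L2 := Aop_L2B s (-1) S m y g (or_intror eq_refl) H HS Hy Hm HL).
  assert (HA : forall sg, sg * sg = 1 -> contline (line (Aop sg g) y)).
  { intros sg Hsg x. eapply cdiff_ccont_h. now apply (Aop_cdiff s sg S). }
  assert (C1 := HA 1 ltac:(ring)). assert (C2 := HA (-1) ltac:(ring)).
  assert (Ch : Cmod (RtoC (/ 2)) = / 2) by (rewrite Cmod_R; apply Rabs_pos_eq; lra).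
  split.
  - apply (L2B_le _ (2 * m)); [lra |].
    replace (2 * m) with (Cmod (RtoC (/ 2)) * (2 * m + Cmod (- (1))%C * (2 * m))) by (rewrite Ch, Cmod_m1; field).
    apply (L2B_scal (RtoC (/ 2)) (fun x => line (Aop (-1) g) y x + - line (Aop 1 g) y x)%C).
    + apply contline_plus; auto. intros x. apply (ccont_eps _ _).
      intros eps He. destruct (ccont_eps_inv _ _ (C1 x) eps He) as [d [Hd K]]. exists d. split; auto.
      intros h Hh. specialize (K h Hh).
      replace (- line (Aop 1 g) y (x + h)%R - - line (Aop 1 g) y x)%C
        with (- (line (Aop 1 g) y (x + h)%R - line (Aop 1 g) y x))%C by ring.
      now rewrite Cmod_opp.
    + apply (L2B_ext (fun x => line (Aop (-1) g) y x + (- (1)) * line (Aop 1 g) y x)%C); [intros; ring |].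
      apply L2B_plus; auto using contline_scal.
      * lra.
      * rewrite Cmod_m1. lra.
      * now apply L2B_scal.
  - apply (L2B_ext (fun x => RtoC (/ 2) * (line (Aop 1 g) y x + line (Aop (-1) g) y x) + (- (1)) * line g y x)%C).
    + intros x. unfold line. rewrite P2 by auto. unfold Wop. ring.
    + assert (Cg : contline (line g y)) by now apply (hol_contline s).
      replace (3 * m) with (2 * m + Cmod (- (1))%C * m) by (rewrite Cmod_m1; ring).
      apply L2B_plus; auto using contline_scal, contline_plus.
      * lra.
      * rewrite Cmod_m1. lra.
      * replace (2 * m) with (Cmod (RtoC (/ 2)) * (2 * m + 2 * m)) by (rewrite Ch; field).
        apply L2B_scal; auto using contline_plus. apply L2B_plus; auto; lra.
      * now apply L2B_scal.
Qed.

Lemma RInt_line_unique (g : R -> R) (l l' : R) : RInt_line g l -> RInt_line g l' -> l = l'.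
Proof.
  intros H H'. apply Rminus_diag_uniq. apply NNPP. intros N.
  assert (He : 0 < Rabs (l - l') / 2) by (pose proof (Rabs_pos_lt _ N); lra).
  destruct (H _ He) as [n Hn], (H' _ He) as [n' Hn'].
  assert (L := Rmax_l n n'). assert (L' := Rmax_r n n').
  destruct (Hn (- Rmax n n') (Rmax n n') ltac:(lra) ltac:(lra)) as [pr K].
  destruct (Hn' (- Rmax n n') (Rmax n n') ltac:(lra) ltac:(lra)) as [pr' K'].
  rewrite <- RInt_Reals in K, K'.
  pose proof (Rabs_triang (RInt g (- Rmax n n') (Rmax n n') - l') (- (RInt g (- Rmax n n') (Rmax n n') - l))) as T.
  rewrite Rabs_Ropp in T.
  replace (RInt g (- Rmax n n') (Rmax n n') - l' + - (RInt g (- Rmax n n') (Rmax n n') - l)) with (l - l') in T by ring.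
  lra.
Qed.

Lemma LambdaInv_unique (g w w' : R -> Cx) : LambdaInv g w -> LambdaInv g w' -> forall x, w x = w' x.
Proof.
  intros H H' x. destruct (H x) as [H1 H2], (H' x) as [H1' H2'].
  apply injective_projections; eapply RInt_line_unique; eauto.
Qed.

(** The substitutions s = y - x to the left of x and s = x - y to its right turn both halves into
    integrals of e^s over an interval ending at 0, the shape of [expint_to]. *)
Lemma RInt_kernel (p : R -> R) (x a b : R) : (forall x, continuous p x) -> a <= x <= b ->
  ex_RInt (fun y => exp (- Rabs (x - y)) / 2 * p y) a b /\
  RInt (fun y => exp (- Rabs (x - y)) / 2 * p y) a b =
    / 2 * (RInt (fun s => exp s * p (x + 1 * s)) (- (x - a)) 0
           + RInt (fun s => exp s * p (x + -1 * s)) (- (b - x)) 0).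
Proof.
  intros Hp Hx.
  assert (Cexp : forall s, continuous exp s) by
    (intros s; apply (derive_continuous exp s (exp s)); auto_derive; auto; ring).
  assert (Caff : forall k c s, continuous (fun s => c + k * s) s).
  { intros k c s. apply (derive_continuous _ s k). auto_derive; auto. ring. }
  assert (C1 : forall k s, continuous (fun s => exp s * p (x + k * s)) s).
  { intros k s. apply (continuous_mult (K := R_AbsRing) exp (fun s => p (x + k * s))); auto.
    apply (continuous_comp (fun s => x + k * s) p); auto. }
  assert (E1 : is_RInt (fun y => exp (- Rabs (x - y)) / 2 * p y) a x
    (/ 2 * RInt (fun s => exp s * p (x + 1 * s)) (- (x - a)) 0)).
  { set (f := fun s => / 2 * (exp s * p (x + 1 * s))).
    assert (If : ex_RInt (fun s => exp s * p (x + 1 * s)) (- (x - a)) 0).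
    { apply (ex_RInt_continuous (V := R_CompleteNormedModule)). intros; apply C1. }
    pose proof (is_RInt_comp_lin (V := R_NormedModule) f 1 (- x) a x (/ 2 * RInt (fun s => exp s * p (x + 1 * s)) (- (x - a)) 0)) as K.
    replace (1 * a + - x) with (- (x - a)) in K by ring. replace (1 * x + - x) with 0 in K by ring.
    specialize (K (is_RInt_scal (V := R_NormedModule) _ _ _ (/ 2) _ (RInt_correct (V := R_CompleteNormedModule) _ _ _ If))).
    eapply is_RInt_ext; [| exact K]. intros y Hy. rewrite Rmin_left, Rmax_right in Hy by lra.
    unfold f. change (1 * (/ 2 * (exp (1 * y + - x) * p (x + 1 * (1 * y + - x)))) = exp (- Rabs (x - y)) / 2 * p y).
    rewrite Rabs_pos_eq by lra. replace (x + 1 * (1 * y + - x)) with y by ring.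
    replace (1 * y + - x) with (- (x - y)) by ring. field. }
  assert (E2 : is_RInt (fun y => exp (- Rabs (x - y)) / 2 * p y) x b
    (/ 2 * RInt (fun s => exp s * p (x + -1 * s)) (- (b - x)) 0)).
  { set (f := fun s => - (/ 2) * (exp s * p (x + -1 * s))).
    assert (If : ex_RInt (fun s => exp s * p (x + -1 * s)) 0 (- (b - x))).
    { apply (ex_RInt_continuous (V := R_CompleteNormedModule)). intros; apply C1. }
    rewrite <- (opp_RInt_swap (V := R_CompleteNormedModule) _ 0) by exact If.
    replace (/ 2 * opp (RInt (fun s => exp s * p (x + -1 * s)) 0 (- (b - x))))
      with (- / 2 * RInt (fun s => exp s * p (x + -1 * s)) 0 (- (b - x)))
      by (unfold opp; simpl; ring).
    pose proof (is_RInt_comp_lin (V := R_NormedModule) f (-1) x x b (- / 2 * RInt (fun s => exp s * p (x + -1 * s)) 0 (- (b - x)))) as K.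
    replace (-1 * x + x) with 0 in K by ring. replace (-1 * b + x) with (- (b - x)) in K by ring.
    specialize (K (is_RInt_scal (V := R_NormedModule) _ _ _ (- / 2) _ (RInt_correct (V := R_CompleteNormedModule) _ _ _ If))).
    eapply is_RInt_ext; [| exact K]. intros y Hy. rewrite Rmin_left, Rmax_right in Hy by lra.
    unfold f. change (-1 * (- / 2 * (exp (-1 * y + x) * p (x + -1 * (-1 * y + x)))) = exp (- Rabs (x - y)) / 2 * p y).
    rewrite Rabs_left1 by lra. replace (x + -1 * (-1 * y + x)) with y by ring.
    replace (-1 * y + x) with (- - (x - y)) by ring. field. }
  pose proof (is_RInt_Chasles _ _ _ _ _ _ E1 E2) as E.
  split; [eexists; exact E |]. rewrite (is_RInt_unique _ _ _ _ E).
  symmetry. apply Rmult_plus_distr_l.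
Qed.

Lemma Wop_LambdaInv (s S : R) (g : C -> C) : 0 < s -> hol s g -> bnd s S g ->
  LambdaInv (line g 0) (line (Wop g) 0).
Proof.
  intros Hs H HS x.
  assert (H0 : Rabs (snd (x, 0)) < s) by (simpl; rewrite Rabs_R0; auto).
  assert (Hg : contline (line g 0)) by (apply (hol_contline s); auto; rewrite Rabs_R0; auto).
  set (f := fun sg t => g ((x, 0) + RtoC (sg * t))%C).
  assert (Cf : forall sg, contline (f sg)) by (intros sg; now apply (hol_ray s)).
  assert (Bf : forall sg t, Cmod (f sg t) <= S) by (intros sg t; unfold f; rewrite line_shift; now apply HS).
  (* p stands for the real or the imaginary part; the premises are what the common argument uses of
     either. *)
  assert (K : forall p : C -> R, (forall z w, Rabs (p z - p w) <= Cmod (z - w)%C) ->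
    (forall c w, p (RtoC c * w)%C = c * p w) -> (forall z w, p (z + w)%C = p z + p w) ->
    (forall h a b, contline h -> p (CI h a b) = RInt (fun t => p (h t)) a b) ->
    (forall h t, contline h -> continuous (fun t => p (h t)) t) ->
    RInt_line (fun y => exp (- Rabs (x - y)) / 2 * p (line g 0 y)) (p (line (Wop g) 0 x))).
  { intros p Hp Hpc Hpp HpI HpC eps He.
    destruct (exp_opp_small S eps He) as [N [HN HT]].
    exists (N + Rabs x). intros a b Ha Hb. pose proof (Rle_abs x). pose proof (Rle_abs (- x)). rewrite Rabs_Ropp in *.
    destruct (RInt_kernel (fun y => p (line g 0 y)) x a b) as [K1 K2].
    { intros y. now apply HpC. } { lra. }
    exists (ex_RInt_Reals_0 _ _ _ K1). rewrite <- RInt_Reals, K2.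
    assert (E : forall sg T, RInt (fun t => exp t * p (line g 0 (x + sg * t))) (- T) 0 = p (expint_to (f sg) T)).
    { intros sg T. unfold expint_to. rewrite HpI by (apply contline_expmul; auto).
      apply RInt_ext. intros t _. rewrite Hpc. unfold f, line. rewrite line_shift. reflexivity. }
    rewrite !E. unfold line, Wop, Aop. rewrite Hpc, Hpp. fold (f 1). fold (f (-1)).
    pose proof (expint_spec (f 1) S (x - a) (Cf 1) (Bf 1) ltac:(lra)) as S1.
    pose proof (expint_spec (f (-1)) S (b - x) (Cf (-1)) (Bf (-1)) ltac:(lra)) as S2.
    pose proof (HT (x - a) ltac:(lra)). pose proof (HT (b - x) ltac:(lra)).
    pose proof (Hp (expint (f 1)) (expint_to (f 1) (x - a))) as P1.
    pose proof (Hp (expint (f (-1))) (expint_to (f (-1)) (b - x))) as P2.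
    set (u1 := p (expint (f 1))) in *. set (u2 := p (expint (f (-1)))) in *.
    set (v1 := p (expint_to (f 1) (x - a))) in *. set (v2 := p (expint_to (f (-1)) (b - x))) in *.
    assert (Q1 : Rabs (u1 - v1) < eps) by lra. assert (Q2 : Rabs (u2 - v2) < eps) by lra.
    apply Rabs_lt_between in Q1. apply Rabs_lt_between in Q2. apply Rabs_lt_between. lra. }
  split.
  - apply (K fst).
    + intros z w. apply (Rabs_fst_Cmod (z - w)%C).
    + intros c w. simpl. ring.
    + reflexivity.
    + reflexivity.
    + intros h t Hh. apply Hh.
  - apply (K snd).
    + intros z w. apply (Rabs_snd_Cmod (z - w)%C).
    + intros c w. simpl. ring.
    + reflexivity.
    + reflexivity.
    + intros h t Hh. apply Hh.
Qed.

(** * The quadratic nonlinearity *)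

(** The class on which [Qop] is bilinear: boundedness makes the integrals inside [Pop] converge. By
    [HB_reg], functions with finite norm belong to it on every smaller strip. *)
Definition reg (s : R) (F : C -> C) : Prop :=
  hol s F /\ exists S, bnd s S F /\ bnd s S (Cd F).

Definition nonlin (b : R) (F G : C -> C) (z : C) : C :=
  (RtoC (b / 2) * (F z * G z) + RtoC ((3 - b) / 2) * (Cd F z * Cd G z))%C.

(** A bilinear form, not symmetric, whose diagonal is the right-hand side of the equation; existence
    expands it on series, uniqueness on differences. *)
Definition Qop (b : R) (F G : C -> C) (z : C) : C := (- (F z * Cd G z + Pop (nonlin b F G) z))%C.

Lemma bnd_le (s S S' : R) (F : C -> C) : S <= S' -> bnd s S F -> bnd s S' F.
Proof. intros HS H z Hz. specialize (H z Hz). lra. Qed.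

Lemma reg_intro (s S S' : R) (F : C -> C) : hol s F -> bnd s S F -> bnd s S' (Cd F) -> reg s F.
Proof.
  intros H HS HS'. split; auto. exists (Rmax S S'). split; eapply bnd_le; eauto; [apply Rmax_l | apply Rmax_r].
Qed.

Lemma reg_plus (s : R) (F G : C -> C) : reg s F -> reg s G -> reg s (fun z => F z + G z)%C.
Proof.
  intros [H [S [H1 H2]]] [H' [S' [H1' H2']]]. destruct (hol_plus s F G H H') as [P1 P2].
  apply (reg_intro s (S + S') (S + S')); auto; intros z Hz.
  - eapply Rle_trans; [apply Cmod_triangle |]. apply Rplus_le_compat; auto.
  - rewrite P2 by auto. eapply Rle_trans; [apply Cmod_triangle |]. apply Rplus_le_compat; auto.
Qed.

Lemma reg_scal (s : R) (c : C) (F : C -> C) : reg s F -> reg s (fun z => c * F z)%C.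
Proof.
  intros [H [S [H1 H2]]]. destruct (hol_scal s c F H) as [P1 P2].
  apply (reg_intro s (Cmod c * S) (Cmod c * S)); auto; intros z Hz.
  - rewrite Cmod_mult. apply Rmult_le_compat_l; auto using Cmod_ge_0.
  - rewrite P2, Cmod_mult by auto. apply Rmult_le_compat_l; auto using Cmod_ge_0.
Qed.

Lemma nonlin_hol (b s : R) (F G : C -> C) : hol s F -> hol s G -> hol s (nonlin b F G).
Proof.
  intros HF HG. apply hol_plus; apply hol_scal; apply hol_mult; auto using hol_Cd.
Qed.

Lemma Cmod_RtoC_mult (c : R) (w : C) : Cmod (RtoC c * w)%C = Rabs c * Cmod w.
Proof. now rewrite Cmod_mult, Cmod_R. Qed.

Lemma nonlin_bound (b f0 f1 g0 g1 : R) (F G : C -> C) (z : C) :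
  Cmod (F z) <= f0 -> Cmod (Cd F z) <= f1 -> Cmod (G z) <= g0 -> Cmod (Cd G z) <= g1 ->
  Cmod (nonlin b F G z) <= Rabs (b / 2) * (f0 * g0) + Rabs ((3 - b) / 2) * (f1 * g1).
Proof.
  intros H1 H2 H3 H4. unfold nonlin. eapply Rle_trans; [apply Cmod_triangle |].
  rewrite !Cmod_RtoC_mult, !Cmod_mult.
  apply Rplus_le_compat; apply Rmult_le_compat_l; try apply Rabs_pos;
    apply Rmult_le_compat; auto using Cmod_ge_0.
Qed.

Lemma nonlin_bnd (b s : R) (F G : C -> C) : reg s F -> reg s G -> exists S, bnd s S (nonlin b F G).
Proof.
  intros [H [S [H1 H2]]] [H' [S' [H1' H2']]]. eexists. intros z Hz.
  apply nonlin_bound; [apply H1 | apply H2 | apply H1' | apply H2']; auto.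
Qed.

(** The nonlocal operator mixes only points of one horizontal line, so bounds on the line through z
    suffice. In the uniqueness proof these bounds depend on |Im z|. *)
Lemma Qop_bound_line (b s f0 f1 g0 g1 : R) (F G : C -> C) (z : C) : hol s F -> hol s G ->
  Rabs (snd z) < s ->
  (forall x, Cmod (F (x, snd z)) <= f0) -> (forall x, Cmod (Cd F (x, snd z)) <= f1) ->
  (forall x, Cmod (G (x, snd z)) <= g0) -> (forall x, Cmod (Cd G (x, snd z)) <= g1) ->
  Cmod (Qop b F G z) <= f0 * g1 + (Rabs (b / 2) * (f0 * g0) + Rabs ((3 - b) / 2) * (f1 * g1)).
Proof.
  intros HF HG Hz H1 H2 H3 H4. unfold Qop. rewrite Cmod_opp.
  eapply Rle_trans; [apply Cmod_triangle |]. apply Rplus_le_compat.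
  - rewrite Cmod_mult. rewrite (surjective_pairing z) at 1 2.
    apply Rmult_le_compat; auto using Cmod_ge_0.
  - apply (Pop_bound_line s); auto using nonlin_hol. intros x. now apply nonlin_bound.
Qed.

Lemma Qop_plus_l (b s : R) (F F' G : C -> C) (z : C) : reg s F -> reg s F' -> reg s G ->
  Rabs (snd z) < s -> Qop b (fun z => F z + F' z)%C G z = (Qop b F G z + Qop b F' G z)%C.
Proof.
  intros HF HF' HG Hz. destruct (nonlin_bnd b s F G HF HG) as [S HS].
  destruct (nonlin_bnd b s F' G HF' HG) as [S' HS'].
  unfold Qop. rewrite (Pop_ext_line _ (fun z => nonlin b F G z + nonlin b F' G z)%C).
  - rewrite (Pop_plus s S S').
    + ring.
    + apply nonlin_hol. apply HF. apply HG.
    + apply nonlin_hol. apply HF'. apply HG.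
    + auto.
    + intros x. now apply HS.
    + intros x. now apply HS'.
  - intros x. unfold nonlin.
    destruct (hol_plus s F F' (proj1 HF) (proj1 HF')) as [_ P2]. rewrite P2 by auto. ring.
Qed.

Lemma Qop_plus_r (b s : R) (F G G' : C -> C) (z : C) : reg s F -> reg s G -> reg s G' ->
  Rabs (snd z) < s -> Qop b F (fun z => G z + G' z)%C z = (Qop b F G z + Qop b F G' z)%C.
Proof.
  intros HF HG HG' Hz. destruct (nonlin_bnd b s F G HF HG) as [S HS].
  destruct (nonlin_bnd b s F G' HF HG') as [S' HS'].
  destruct (hol_plus s G G' (proj1 HG) (proj1 HG')) as [_ P2].
  unfold Qop. rewrite (Pop_ext_line _ (fun z => nonlin b F G z + nonlin b F G' z)%C).
  - rewrite (Pop_plus s S S').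
    + rewrite P2 by auto. ring.
    + apply nonlin_hol. apply HF. apply HG.
    + apply nonlin_hol. apply HF. apply HG'.
    + auto.
    + intros x. now apply HS.
    + intros x. now apply HS'.
  - intros x. unfold nonlin. rewrite P2 by auto. ring.
Qed.

Lemma Qop_scal_l (b s : R) (c : C) (F G : C -> C) (z : C) : reg s F -> reg s G ->
  Rabs (snd z) < s -> Qop b (fun z => c * F z)%C G z = (c * Qop b F G z)%C.
Proof.
  intros HF HG Hz. destruct (nonlin_bnd b s F G HF HG) as [S HS].
  destruct (hol_scal s c F (proj1 HF)) as [_ P2].
  unfold Qop. rewrite (Pop_ext_line _ (fun z => c * nonlin b F G z)%C).
  - rewrite (Pop_scal s S c (nonlin b F G) z (nonlin_hol b s F G (proj1 HF) (proj1 HG)) Hz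
      (bnd_line s S _ z HS Hz)). ring.
  - intros x. unfold nonlin. rewrite P2 by auto. ring.
Qed.

Lemma Qop_scal_r (b s : R) (c : C) (F G : C -> C) (z : C) : reg s F -> reg s G ->
  Rabs (snd z) < s -> Qop b F (fun z => c * G z)%C z = (c * Qop b F G z)%C.
Proof.
  intros HF HG Hz. destruct (nonlin_bnd b s F G HF HG) as [S HS].
  destruct (hol_scal s c G (proj1 HG)) as [_ P2].
  unfold Qop. rewrite (Pop_ext_line _ (fun z => c * nonlin b F G z)%C).
  - rewrite (Pop_scal s S c (nonlin b F G) z (nonlin_hol b s F G (proj1 HF) (proj1 HG)) Hz
      (bnd_line s S _ z HS Hz)), P2 by auto. ring.
  - intros x. unfold nonlin. rewrite P2 by auto. ring.
Qed.

Lemma Qop_ext (b s : R) (F F' G G' : C -> C) (z : C) : Rabs (snd z) < s ->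
  (forall z : C, Rabs (snd z) < s -> F z = F' z) -> (forall z : C, Rabs (snd z) < s -> G z = G' z) ->
  Qop b F G z = Qop b F' G' z.
Proof.
  intros Hz HF HG.
  assert (DF : forall z : C, Rabs (snd z) < s -> Cd F z = Cd F' z).
  { intros w Hw. apply Cd_ext. intros x. now apply HF. }
  assert (DG : forall z : C, Rabs (snd z) < s -> Cd G z = Cd G' z).
  { intros w Hw. apply Cd_ext. intros x. now apply HG. }
  unfold Qop. rewrite (Pop_ext_line _ (nonlin b F' G')).
  - rewrite HF, DG by auto. reflexivity.
  - intros x. unfold nonlin. rewrite HF, DG, HG, DF by auto. reflexivity.
Qed.

Lemma HB_reg (s s' : R) (F : C -> C) (m : R) : HB s F m -> s' < s -> reg s' F.
Proof.
  intros H Hs. apply (reg_intro s' (2 * m) (2 * (m * (1 + (s - s')) / (s - s')))).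
  - apply (hol_le s); [lra | apply H].
  - intros z Hz. apply (HB_bnd s F m H). lra.
  - apply HB_bnd. apply (HB_Cd s s'); auto. lra.
Qed.

(** The product F G' contributes 4 through [HB_mult]; the nonlocal term contributes 3 (from
    [HB_Pop]) times 2 (from [HB_bnd]) times |b/2| + 1 + |(3-b)/2| + 1. The added ones keep both
    summands positive when b = 0 or b = 3. *)
Definition CQ (b rho : R) : R := (1 + rho) * (16 + 6 * Rabs (b / 2) + 6 * Rabs ((3 - b) / 2)).

Lemma CQ_pos (b rho : R) : 0 < rho -> 0 < CQ b rho.
Proof.
  intros H. unfold CQ. pose proof (Rabs_pos (b / 2)). pose proof (Rabs_pos ((3 - b) / 2)).
  apply Rmult_lt_0_compat; lra.
Qed.

(** The width s - s' must be paid only once. In F'G' the factor F' is taken in sup norm, which costs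
    1/(s-s'), while G' is taken in L2, which costs nothing. *)
Lemma HB_Qop (b rho s s' m m' : R) (F G : C -> C) : HB s F m -> HB s G m' -> 0 < s - s' <= rho ->
  HB s' (Qop b F G) (CQ b rho * (m * m' / (s - s'))).
Proof.
  intros HF HG Hs.
  assert (DF := HB_Cd s s' rho F m HF Hs). assert (DG := HB_Cd s s' rho G m' HG Hs).
  assert (HF' := HB_strip s s' F m ltac:(lra) HF). assert (HG' := HB_strip s s' G m' ltac:(lra) HG).
  assert (Hm := proj1 HF). assert (Hm' := proj1 HG).
  set (X := m * m' / (s - s')).
  assert (HX : 0 < X) by (apply Rdiv_lt_0_compat; [now apply Rmult_lt_0_compat | lra]).
  assert (HmX : m * m' <= rho * X).
  { replace (m * m') with ((s - s') * X) by (unfold X; field; lra). apply Rmult_le_compat_r; lra. }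
  set (b1 := Rabs (b / 2)). set (b2 := Rabs ((3 - b) / 2)).
  assert (Hb1 : 0 <= b1) by apply Rabs_pos. assert (Hb2 : 0 <= b2) by apply Rabs_pos.
  assert (HrX : 0 < (1 + rho) * X) by (apply Rmult_lt_0_compat; lra).
  set (mu := (b1 + 1) * (2 * ((1 + rho) * X)) + (b2 + 1) * (2 * ((1 + rho) * X))).
  assert (Hmu : 0 < mu) by (unfold mu; apply Rplus_lt_0_compat; apply Rmult_lt_0_compat; lra).
  destruct (nonlin_bnd b s' F G) as [S HS].
  { apply (HB_reg s s' F m); auto; lra. } { apply (HB_reg s s' G m'); auto; lra. }
  assert (HP : HB s' (Pop (nonlin b F G)) (3 * mu)).
  { apply (HB_Pop s' S); auto.
    - apply nonlin_hol. apply HF'. apply HG'.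
    - intros y Hy.
      assert (CF : contline (line F y)) by (apply (hol_contline s'); auto; apply HF').
      assert (CG : contline (line G y)) by (apply (hol_contline s'); auto; apply HG').
      assert (CDF : contline (line (Cd F) y)) by (apply (hol_contline s'); auto; apply DF).
      assert (CDG : contline (line (Cd G) y)) by (apply (hol_contline s'); auto; apply DG).
      destruct (proj2 (proj2 HG') y Hy) as [L1 L2].
      apply (L2B_plus (fun x => RtoC (b / 2) * (line F y x * line G y x))%C
        (fun x => RtoC ((3 - b) / 2) * (line (Cd F) y x * line (Cd G) y x))%C);
        auto using contline_scal, contline_mult.
      + apply Rmult_lt_0_compat; lra.
      + apply Rmult_lt_0_compat; lra.
      + apply (L2B_le _ (Cmod (RtoC (b / 2)) * (2 * m * m'))).
        * rewrite Cmod_R. fold b1. assert (0 < m * m') by now apply Rmult_lt_0_compat.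
          split; [apply Rmult_le_pos; lra |]. apply Rmult_le_compat; lra.
        * apply L2B_scal; auto using contline_mult. apply L2B_mult; auto.
          intros x. now apply (HB_bnd s' F m HF').
      + apply (L2B_le _ (Cmod (RtoC ((3 - b) / 2)) * (2 * (m * (1 + rho) / (s - s')) * m'))).
        * rewrite Cmod_R. fold b2.
          replace (2 * (m * (1 + rho) / (s - s')) * m') with (2 * ((1 + rho) * X)) by (unfold X; field; lra).
          split; [apply Rmult_le_pos; lra |]. apply Rmult_le_compat; lra.
        * apply L2B_scal; auto using contline_mult. apply L2B_mult; auto.
          intros x. now apply (HB_bnd s' (Cd F) _ DF). }
  assert (HT := HB_mult s' F (Cd G) _ _ HF' DG).
  assert (HA := HB_plus s' _ _ _ _ HT HP).
  apply (HB_ext s' (fun z => (- (1)) * (F z * Cd G z + Pop (nonlin b F G) z))%C).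
  { intros z _. unfold Qop. ring. }
  apply (HB_le _ _ (1 * (4 * m * (m' * (1 + rho) / (s - s')) + 3 * mu))).
  - right. unfold mu, CQ, X. fold b1 b2. field. lra.
  - apply HB_scal; auto; [lra |]. rewrite Cmod_m1. lra.
Qed.

(** * Translation between the notions of the statement and the predicate [HB] *)

Lemma L2le_L2B (g : R -> C) (m : R) : L2le g (m * m) -> L2B g m.
Proof.
  intros H a b Hab. destruct (H a b Hab) as [pr K]. now rewrite (RInt_Reals _ _ _ pr).
Qed.

Lemma L2B_L2le (g : R -> C) (m : R) : contline g -> L2B g m -> L2le g (m * m).
Proof.
  intros Hg H a b Hab. exists (ex_RInt_Reals_0 _ _ _ (ex_RInt_Cnorm2 g a b Hg)).
  rewrite <- RInt_Reals. now apply H.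
Qed.

Lemma L2le_le (g : R -> C) (M M' : R) : M <= M' -> L2le g M -> L2le g M'.
Proof. intros HM H a b Hab. destruct (H a b Hab) as [pr K]. exists pr. lra. Qed.

Lemma strip_ext_hol (rho : R) (f : R -> C) (F F' : R -> R -> C) : strip_ext rho f F F' ->
  (forall x, F x 0 = f x) /\ hol rho (fun z => F (fst z) (snd z)) /\
  forall x y, Rabs y < rho -> Cd (fun z => F (fst z) (snd z)) (x, y) = F' x y.
Proof.
  intros [H1 H2]. split; [exact H1 |].
  destruct (hol_intro rho (fun z => F (fst z) (snd z)) (fun z => F' (fst z) (snd z))) as [K1 K2].
  { intros [x y] Hz. apply cderiv_cdiff. now apply H2. }
  split; [exact K1 |]. intros x y Hy. exact (K2 (x, y) Hy).
Qed.

Lemma strip_ext_HB (rho m : R) (f : R -> C) (F F' : R -> R -> C) : 0 < m -> strip_ext rho f F F' ->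
  (forall y, Rabs y < rho -> L2le (fun x => F x y) (m * m) /\ L2le (fun x => F' x y) (m * m)) ->
  HB rho (fun z => F (fst z) (snd z)) m.
Proof.
  intros Hm H HL. destruct (strip_ext_hol _ _ _ _ H) as (H1 & H2 & H3).
  split; [auto | split; auto]. intros y Hy. destruct (HL y Hy) as [L1 L2]. split.
  - now apply L2le_L2B.
  - apply (L2B_ext (fun x => F' x y)). intros x. symmetry. now apply H3. now apply L2le_L2B.
Qed.

Lemma HB_strip_ext (rho m : R) (F : C -> C) : HB rho F m ->
  strip_ext rho (line F 0) (fun x y => F (x, y)) (fun x y => Cd F (x, y)) /\
  forall y, Rabs y < rho -> L2le (fun x => F (x, y)) (m * m) /\ L2le (fun x => Cd F (x, y)) (m * m).
Proof.
  intros (Hm & H & HL). split; [split |].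
  - reflexivity.
  - intros x y Hy. apply cdiff_cderiv. now apply (hol_cdiff rho).
  - intros y Hy. destruct (HL y Hy) as [L1 L2]. split; apply L2B_L2le; auto;
    apply (hol_contline rho); auto using hol_Cd.
Qed.

Lemma in_H1_HB (rho : R) (f : R -> C) : in_H1 rho f <->
  exists F m, HB rho F m /\ forall x, F (x, 0) = f x.
Proof.
  split.
  (* M bounds the squares of the norms; |M| + 1 is positive and its square is at least M. *)
  - intros (F & F' & H & M & HM). exists (fun z => F (fst z) (snd z)), (Rabs M + 1).
    pose proof (Rabs_pos M). pose proof (Rle_abs M). split; [| apply H].
    apply (strip_ext_HB rho _ f F F'); auto; [lra |].
    intros y Hy. destruct (HM y Hy). split; apply (L2le_le _ M); auto; nra.
  - intros (F & m & H & E). exists (fun x y => F (x, y)), (fun x y => Cd F (x, y)).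
    destruct (HB_strip_ext rho m F H) as [[S1 S2] L]. split; [split; auto |].
    exists (m * m). apply L.
Qed.

Lemma H1_le_HB (rho eps : R) (f : R -> C) : 0 < eps -> (H1_le rho f eps <->
  exists F, HB rho F eps /\ forall x, F (x, 0) = f x).
Proof.
  intros He. split.
  - intros (F & F' & H & HM). exists (fun z => F (fst z) (snd z)). split; [| apply H].
    now apply (strip_ext_HB rho _ f F F').
  - intros (F & H & E). exists (fun x y => F (x, y)), (fun x y => Cd F (x, y)).
    destruct (HB_strip_ext rho eps F H) as [[S1 S2] L]. split; [split; auto | apply L].
Qed.

Lemma derivC_pder (f : R -> C) (x : R) (l : C) : derivC f x l <-> pder f x l.
Proof. unfold derivC, pder. now rewrite !is_derive_Reals. Qed.

Lemma pder_unique (f : R -> C) (x : R) (l m : C) : pder f x l -> pder f x m -> l = m.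
Proof.
  intros [H1 H2] [K1 K2]. apply injective_projections.
  - rewrite <- (is_derive_unique _ _ _ H1). now apply is_derive_unique.
  - rewrite <- (is_derive_unique _ _ _ H2). now apply is_derive_unique.
Qed.

Lemma pder_ext (f g : R -> C) (x : R) (l : C) : (forall t, f t = g t) -> pder f x l -> pder g x l.
Proof.
  intros E [H1 H2]. split; (eapply is_derive_ext; [| eassumption]); intros t; simpl; now rewrite E.
Qed.

Lemma Cx_Cscal (r : R) (z : C) : Cscal r z = (RtoC r * z)%C.
Proof. unfold Cscal. apply injective_projections; simpl; ring. Qed.

Lemma nonlin_line (b : R) (F : C -> C) (u ux : R -> Cx) :
  (forall x, u x = F (x, 0)) -> (forall x, ux x = Cd F (x, 0)) ->
  (fun x => Cadd (Cscal (b / 2) (Cmul (u x) (u x))) (Cscal ((3 - b) / 2) (Cmul (ux x) (ux x))))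
  = line (nonlin b F F) 0.
Proof.
  intros Hu Hux. apply FunctionalExtensionality.functional_extensionality. intros x.
  rewrite !Cx_Cscal, Hu, Hux. reflexivity.
Qed.

(** Derivatives and integrals over the line are unique, so the witnesses hidden in [bfam_eq] are
    forced to be those built from [Cd], [Wop] and [Pop]. *)
Lemma bfam_reg (b s : R) (F : C -> C) (u v : R -> C) : 0 < s -> reg s F ->
  (forall x, u x = F (x, 0)) ->
  (bfam_eq b u v <-> forall x, v x = Qop b F F (x, 0)).
Proof.
  intros Hs HF Hu. destruct (nonlin_bnd b s F F HF HF) as [S HS].
  assert (Hn := nonlin_hol b s F F (proj1 HF) (proj1 HF)).
  assert (H0 : forall x : R, Rabs (snd (x, 0)) < s) by (intros x; simpl; rewrite Rabs_R0; auto).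
  assert (HD : forall x, pder u x (Cd F (x, 0))).
  { intros x. apply (pder_ext (line F 0)); [intros; symmetry; apply Hu |].
    apply (hol_pder_line s). apply HF. rewrite Rabs_R0; auto. }
  assert (HW : forall x, pder (line (Wop (nonlin b F F)) 0) x (Pop (nonlin b F F) (x, 0))).
  { intros x. apply (cdiff_pder_line (Wop (nonlin b F F)) (x, 0)). now apply (Wop_cdiff s S). }
  split.
  - intros (ux & Hux & w & Hw & Hv) x.
    assert (Eux : forall x, ux x = Cd F (x, 0)).
    { intros x'. apply (pder_unique u x'); auto. now apply derivC_pder. }
    rewrite (nonlin_line b F u ux Hu Eux) in Hw.
    assert (Ew := LambdaInv_unique _ _ _ (Wop_LambdaInv s S _ Hs Hn HS) Hw).
    destruct (Hv x) as (dw & Hdw & ->). apply derivC_pder in Hdw.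
    rewrite (pder_unique w x dw (Pop (nonlin b F F) (x, 0))); auto.
    + rewrite Cx_Cscal, Hu, Eux. unfold Qop.
      change (RtoC (-1) * (F (x, 0) * Cd F (x, 0) + Pop (nonlin b F F) (x, 0)) =
        - (F (x, 0) * Cd F (x, 0) + Pop (nonlin b F F) (x, 0)))%C.
      apply injective_projections; simpl; ring.
    + apply (pder_ext (line (Wop (nonlin b F F)) 0)); auto.
  - intros Hv. exists (line (Cd F) 0). split; [intros x; now apply derivC_pder |].
    exists (line (Wop (nonlin b F F)) 0). split.
    + rewrite (nonlin_line b F u (line (Cd F) 0)) by auto. now apply (Wop_LambdaInv s S).
    + intros x. exists (Pop (nonlin b F F) (x, 0)). split; [now apply derivC_pder |].
      rewrite Hv, Cx_Cscal, Hu. unfold Qop.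
      change (- (F (x, 0) * Cd F (x, 0) + Pop (nonlin b F F) (x, 0)) =
        RtoC (-1) * (F (x, 0) * Cd F (x, 0) + Pop (nonlin b F F) (x, 0)))%C.
      apply injective_projections; simpl; ring.
Qed.

(** * Identity theorem *)

Lemma Cmod_cexp (w : C) : Cmod (cexp w) = exp (fst w).
Proof.
  replace (cexp w) with (RtoC (exp (fst w)) * cis (snd w))%C
    by (unfold cexp, cis; apply injective_projections; simpl; ring).
  rewrite Cmod_mult, Cmod_cis, Cmod_R, Rabs_pos_eq, Rmult_1_r; auto. left; apply exp_pos.
Qed.

(** With z - z0 = p + iq, its modulus is exp(-k(p^2 - q^2)): a real Gaussian on the horizontal line
    through z0, but growing vertically. *)
Definition gauss (k : R) (z0 z : C) : C := cexp (RtoC (- k) * ((z - z0) * (z - z0)))%C.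

Lemma gauss_cdiff (k : R) (z0 z : C) : exists l, cdiff (gauss k z0) z l.
Proof.
  eexists. apply (cdiff_comp cexp (fun z => RtoC (- k) * ((z - z0) * (z - z0)))%C).
  apply cdiff_cexp. apply cdiff_scal. apply cdiff_mult; apply cdiff_minus;
  try apply cdiff_id; apply cdiff_const.
Qed.

Lemma Rabs_mul_self (x : R) : Rabs x * Rabs x = x * x.
Proof. rewrite <- Rabs_mult. apply Rabs_pos_eq. apply Rle_0_sqr. Qed.

Lemma gauss_line (k x0 y x : R) : gauss k (x0, y) (x, y) = RtoC (exp (- k * ((x - x0) * (x - x0)))).
Proof.
  unfold gauss, cexp. simpl. replace (y + - y) with 0 by ring.
  replace (- k * ((x + - x0) * 0 + 0 * (x + - x0)) + 0 * ((x + - x0) * (x + - x0) - 0 * 0)) with 0 by ring.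
  rewrite cos_0, sin_0. apply injective_projections; simpl; [| ring].
  rewrite Rmult_1_r. f_equal. ring.
Qed.

Lemma exp_le_mono (x y : R) : x <= y -> exp x <= exp y.
Proof. intros [H | ->]; [left; now apply exp_increasing | right; auto]. Qed.

(* Goursat's lemma for G times a Gaussian centred at z0, on a rectangle with a side on the real axis and
   z0 on the opposite side: the integral over the latter is exponentially small,
   while it would concentrate near z0 if [G z0 <> 0]. *)
Lemma zero_above (s S x0 y : R) (G : C -> C) : hol s G -> bnd s S G ->
  (forall x, G (x, 0) = 0) -> 0 < y < s -> G (x0, y) = 0.
Proof.
  intros H HS H0 Hy. apply NNPP. intros Nc. set (c := G (x0, y)) in *.
  assert (Hc : 0 < Cmod c) by now apply Cmod_gt_0.
  (* The half-width exceeds the height by 1, so L^2 - (t-y)^2 >= 1 on the vertical sides and the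
     Gaussian is at most e^(-k) there. *)
  set (L := y + 1). set (a := x0 - L). set (b := x0 + L).
  assert (Hys : forall t, 0 <= t <= y -> Rabs t < s) by (intros t Ht; rewrite Rabs_pos_eq; lra).
  assert (HS0 : 0 <= S) by (eapply Rle_trans; [apply (Cmod_ge_0 (G (x0, 0))) |]; apply HS; simpl; apply Hys; lra).
  assert (Hcont : contline (line G y)) by (apply (hol_contline s); auto; apply Hys; lra).
  destruct (ccont_eps_inv _ _ (Hcont x0) (Cmod c / 2)) as [d0 [Hd0 Hd]]; [lra |].
  (* Within d of x0 the values of [G] are within |c|/2 of c; d <= 1/2 gives e^(-k) <= e^(-k d^2), so
     that one exponential dominates all error terms. *)
  set (d := Rmin (d0 / 2) (1 / 2)). assert (Hdp : 0 < d) by (apply Rmin_pos; lra).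
  assert (Hd1 : d <= d0 / 2) by apply Rmin_l. assert (Hd2 : d <= 1 / 2) by apply Rmin_r.
  assert (Hnear : forall x, Rabs (x - x0) <= d -> Cmod (G (x, y) - c)%C <= Cmod c / 2).
  { intros x Hx. specialize (Hd (x - x0) ltac:(lra)).
    replace (x0 + (x - x0)) with x in Hd by ring. exact Hd. }
  assert (Hre : forall w, Cnorm2 c - Cmod c * Cmod (w - c)%C <= fst (Cconj c * w)%C).
  { intros w. pose proof (Rabs_fst_Cmod (Cconj c * (c - w))%C) as K.
    rewrite Cmod_mult, Cmod_conj, (Cmod_minus_sym c w) in K.
    replace (fst (Cconj c * (c - w))%C) with (Cnorm2 c - fst (Cconj c * w)%C) in K
      by (unfold Cnorm2; simpl; ring).
    apply Rabs_le_between in K. lra. }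
  assert (Habs : forall w, Cmod w <= S -> - (Cmod c * S) <= fst (Cconj c * w)%C).
  { intros w Hw. pose proof (Rabs_fst_Cmod (Cconj c * w)%C) as K. rewrite Cmod_mult, Cmod_conj in K.
    apply Rabs_le_between in K. pose proof (Rmult_le_compat_l (Cmod c) _ _ (Rlt_le _ _ Hc) Hw). lra. }
  (* The piece |x - x0| <= d/2 contributes at least d (|c|^2/2) e^(-k d^2/4) and all the rest is of
     order e^(-k d^2); this is the comparison after division by |c| e^(-k d^2/4). *)
  assert (Hmain : forall k, 0 <= k ->
    d * (Cmod c / 2) <= (2 * L + 2 * y) * S * exp (- (k * (3 / 4 * (d * d))))).
  { intros k Hk. set (F := fun z => (G z * gauss k (x0, y) z)%C).
    assert (HF : cdiff_rect F a b 0 y).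
    { intros x t Hx Ht. destruct (H (x, t) (Hys t Ht)) as [l1 K1].
      destruct (gauss_cdiff k (x0, y) (x, t)) as [l2 K2]. eexists. apply cdiff_mult; eauto. }
    assert (E := goursat F a b 0 y ltac:(unfold a, b, L; lra) ltac:(lra) HF). unfold rect_int in E.
    assert (E0 : CI (fun x => F (x, 0)) a b = 0).
    { rewrite (CI_ext _ (fun _ => RtoC 0)). rewrite CI_const; ring.
      intros x _. unfold F. rewrite H0. ring. }
    assert (Hside : forall x, (x - x0) * (x - x0) = L * L -> a <= x <= b ->
      Cmod (CI (fun t => F (x, t)) 0 y) <= S * exp (- k) * (y - 0)).
    { intros x Hx Hx'. apply CI_norm_const; [lra | |].
      - apply (cdiff_rect_v F a b 0 y); auto; lra.
      - intros t Ht. unfold F. rewrite Cmod_mult. apply Rmult_le_compat; try apply Cmod_ge_0.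
        + apply HS. simpl. apply Hys. lra.
        + unfold gauss. rewrite Cmod_cexp. apply exp_le_mono. simpl.
          replace (- k * ((x + - x0) * (x + - x0) - (t + - y) * (t + - y)) -
             0 * ((x + - x0) * (t + - y) + (t + - y) * (x + - x0)))
            with (- (k * ((x - x0) * (x - x0) - (t - y) * (t - y)))) by ring.
          rewrite Hx. assert (1 <= L * L - (t - y) * (t - y)) by (unfold L; nra). nra. }
    assert (Sa := Hside a ltac:(unfold a; ring) ltac:(unfold a, b, L; lra)).
    assert (Sb := Hside b ltac:(unfold b; ring) ltac:(unfold a, b, L; lra)).
    set (T := CI (fun x => F (x, y)) a b) in *. rewrite E0 in E.
    assert (ET : T = (Ci * (CI (fun t => F (b, t)) 0 y - CI (fun t => F (a, t)) 0 y))%C).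
    { replace T with ((Ci * (CI (fun t => F (b, t)) 0 y - CI (fun t => F (a, t)) 0 y)) -
        (0 - T + Ci * (CI (fun t => F (b, t)) 0 y - CI (fun t => F (a, t)) 0 y)))%C by ring.
      rewrite E. ring. }
    assert (HT : Cmod T <= 2 * y * S * exp (- k)).
    { rewrite ET, Cmod_mult, Cmod_Ci. pose proof (Cmod_minus (CI (fun t => F (b, t)) 0 y) (CI (fun t => F (a, t)) 0 y)). lra. }
    set (phi := fun x => fst (Cconj c * F (x, y))%C).
    assert (Hphi : forall x, phi x = exp (- k * ((x - x0) * (x - x0))) * fst (Cconj c * G (x, y))%C).
    { intros x. unfold phi, F. rewrite gauss_line. simpl. ring. }
    assert (CF : contline (fun x => Cconj c * F (x, y))%C).
    { apply contline_scal. intros x.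
      destruct (H (x, y)) as [l1 K1]; [simpl; apply Hys; lra |].
      destruct (gauss_cdiff k (x0, y) (x, y)) as [l2 K2].
      eapply (cdiff_ccont_h F). apply cdiff_mult; eauto. }
    assert (Iphi : forall u v, ex_RInt phi u v) by (intros u v; apply (ex_CI_line _ u v CF)).
    assert (Ere : RInt phi a b = fst (Cconj c * T)%C).
    { unfold T. rewrite <- CI_scal. reflexivity. apply (cdiff_rect_h F a b 0 y); unfold a, b, L; auto; lra. }
    (* For d/2 <= |x - x0| <= d the integrand is nonnegative, as [G] is still close to c; beyond d
       the Gaussian is at most e^(-k d^2). *)
    assert (Pout : forall x, d / 2 <= Rabs (x - x0) -> - (Cmod c * S) * exp (- (k * (d * d))) <= phi x).
    { intros x Hx. rewrite Hphi. pose proof (exp_pos (- k * ((x - x0) * (x - x0)))).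
      pose proof (exp_pos (- (k * (d * d)))).
      destruct (Rle_dec (Rabs (x - x0)) d) as [Hxd | Hxd].
      - specialize (Hnear x Hxd). specialize (Hre (G (x, y))). rewrite Cnorm2_Cmod in Hre.
        assert (0 <= fst (Cconj c * G (x, y))%C) by nra.
        assert (0 <= Cmod c * S) by (apply Rmult_le_pos; lra).
        assert (0 <= exp (- k * ((x - x0) * (x - x0))) * fst (Cconj c * G (x, y))%C) by (apply Rmult_le_pos; lra).
        nra.
      - assert (He : exp (- k * ((x - x0) * (x - x0))) <= exp (- (k * (d * d)))).
        { apply exp_le_mono. assert (d * d <= (x - x0) * (x - x0)).
          { rewrite <- (Rabs_mul_self (x - x0)). apply Rmult_le_compat; lra. }
          nra. }
        pose proof (Habs (G (x, y)) (HS (x, y) (Hys y ltac:(lra)))).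
        assert (0 <= Cmod c * S) by (apply Rmult_le_pos; lra). nra. }
    assert (Pin : forall x, Rabs (x - x0) <= d / 2 -> Cmod c * Cmod c / 2 * exp (- (k * (d * d / 4))) <= phi x).
    { intros x Hx. rewrite Hphi.
      specialize (Hnear x ltac:(lra)). specialize (Hre (G (x, y))). rewrite Cnorm2_Cmod in Hre.
      assert (Cmod c * Cmod c / 2 <= fst (Cconj c * G (x, y))%C) by nra.
      rewrite Rmult_comm. apply Rmult_le_compat; auto.
      - left; apply exp_pos.
      - nra.
      - apply exp_le_mono. assert ((x - x0) * (x - x0) <= d * d / 4).
        { rewrite <- (Rabs_mul_self (x - x0)). pose proof (Rabs_pos (x - x0)).
          replace (d * d / 4) with (d / 2 * (d / 2)) by field. apply Rmult_le_compat; lra. }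
        nra. }
    assert (Hlow : forall u v q, u <= v -> (forall x, u < x < v -> q <= phi x) -> q * (v - u) <= RInt phi u v).
    { intros u v q Huv Hq. replace (q * (v - u)) with (RInt (fun _ => q) u v).
      - apply RInt_le; auto. apply (ex_RInt_const (V := R_NormedModule)).
      - rewrite (RInt_const (V := R_CompleteNormedModule)). apply Rmult_comm. }
    assert (HdL : d < L) by (unfold L; lra).
    assert (I1 := Hlow a (x0 - d / 2) _ ltac:(unfold a; lra)
      (fun x Hx => Pout x ltac:(rewrite Rabs_left1; lra))).
    assert (I2 := Hlow (x0 - d / 2) (x0 + d / 2) _ ltac:(lra)
      (fun x Hx => Pin x ltac:(apply Rabs_le; lra))).
    assert (I3 := Hlow (x0 + d / 2) b _ ltac:(unfold b; lra)
      (fun x Hx => Pout x ltac:(rewrite Rabs_pos_eq; lra))).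
    assert (Esum : RInt phi a b = RInt phi a (x0 - d / 2) + RInt phi (x0 - d / 2) (x0 + d / 2) + RInt phi (x0 + d / 2) b).
    { rewrite <- (RInt_Chasles (V := R_CompleteNormedModule) phi a (x0 + d / 2) b) by auto.
      rewrite <- (RInt_Chasles (V := R_CompleteNormedModule) phi a (x0 - d / 2) (x0 + d / 2)) by auto. reflexivity. }
    assert (Hup : RInt phi a b <= Cmod c * (2 * y * S * exp (- k))).
    { rewrite Ere. eapply Rle_trans; [apply Rle_abs |]. eapply Rle_trans; [apply Rabs_fst_Cmod |].
      rewrite Cmod_mult, Cmod_conj. apply Rmult_le_compat_l; lra. }
    assert (Ek : exp (- k) <= exp (- (k * (d * d)))).
    { apply exp_le_mono. assert (d * d <= 1 / 2 * (1 / 2)) by (apply Rmult_le_compat; lra).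
      assert (0 <= k * (1 - d * d)) by (apply Rmult_le_pos; lra). lra. }
    set (e1 := exp (- (k * (d * d)))) in *.
    assert (Ee : e1 = exp (- (k * (d * d / 4))) * exp (- (k * (3 / 4 * (d * d))))).
    { unfold e1. rewrite <- exp_plus. f_equal. field. }
    set (e2 := exp (- (k * (d * d / 4)))) in *. set (e3 := exp (- (k * (3 / 4 * (d * d))))) in *.
    assert (He2 : 0 < e2) by apply exp_pos. assert (He1 : 0 < e1) by apply exp_pos.
    assert (HcS : 0 <= Cmod c * S) by (apply Rmult_le_pos; lra).
    unfold a, b in I1, I3.
    assert (J1 : - (Cmod c * S * e1 * L) <= RInt phi (x0 - L) (x0 - d / 2)).
    { eapply Rle_trans; [| exact I1].
      assert (0 <= Cmod c * S * e1) by (apply Rmult_le_pos; lra). nra. }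
    assert (J3 : - (Cmod c * S * e1 * L) <= RInt phi (x0 + d / 2) (x0 + L)).
    { eapply Rle_trans; [| exact I3].
      assert (0 <= Cmod c * S * e1) by (apply Rmult_le_pos; lra). nra. }
    assert (J2 : Cmod c * Cmod c / 2 * e2 * d <= RInt phi (x0 - d / 2) (x0 + d / 2)).
    { eapply Rle_trans; [| exact I2]. right. field. }
    fold a in J1. fold b in J3.
    assert (J4 : Cmod c * (2 * y * S * exp (- k)) <= Cmod c * (2 * y * S * e1)).
    { apply Rmult_le_compat_l; [lra |]. apply Rmult_le_compat_l; auto. apply Rmult_le_pos; lra. }
    apply Rmult_le_reg_l with (Cmod c * e2); [now apply Rmult_lt_0_compat |].
    replace (Cmod c * e2 * ((2 * L + 2 * y) * S * e3)) with (Cmod c * S * (2 * L + 2 * y) * e1) by (rewrite Ee; ring).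
    rewrite Esum in Hup. lra. }
  assert (Hdd : 0 < 3 / 4 * (d * d)) by (apply Rmult_lt_0_compat; nra).
  destruct (exp_opp_small ((2 * L + 2 * y) * S) (d * (Cmod c / 2))) as [N [HN HT]].
  { apply Rmult_lt_0_compat; lra. }
  assert (Hk0 : 0 <= N / (3 / 4 * (d * d))) by (apply Rdiv_le_0_compat; lra).
  specialize (Hmain _ Hk0).
  replace (N / (3 / 4 * (d * d)) * (3 / 4 * (d * d))) with N in Hmain by (field; lra).
  specialize (HT N (Rle_refl N)). lra.
Qed.

Theorem identity_theorem (s S : R) (G : C -> C) : hol s G -> bnd s S G ->
  (forall x, G (x, 0) = 0) -> forall z : C, Rabs (snd z) < s -> G z = 0.
Proof.
  intros H HS H0 [x y] Hy. simpl in Hy. destruct (Rtotal_order y 0) as [N | [-> | P]].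
  (* The lower half of the strip is carried to the upper half by z -> -z. *)
  - assert (Eo : forall z : C, Copp z = (- fst z, - snd z)) by reflexivity.
    replace (G (x, y)) with (G (Copp ((- x)%R, (- y)%R)))
      by (f_equal; apply injective_projections; simpl; ring).
    apply (zero_above s S (- x) (- y) (fun z => G (- z)%C)).
    + intros z Hz. destruct (H (- z)%C) as [l Hl]; [simpl; rewrite Rabs_Ropp; auto |].
      exists (l * (- (1) * 1))%C. apply (cdiff_comp G (fun z => - z)%C); auto.
      apply (cdiff_ext (fun z => - (1) * z)%C); [intros; ring |]. apply cdiff_scal, cdiff_id.
    + intros z Hz. apply HS. simpl. now rewrite Rabs_Ropp.
    + intros x'. rewrite Eo. simpl. rewrite Ropp_0. apply H0.
    + rewrite Rabs_left in Hy; lra.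
  - apply H0.
  - apply (zero_above s S); auto. rewrite Rabs_pos_eq in Hy; lra.
Qed.

(** In [in_H1] and [H1_le] the extension to the strip is existential. This makes it unique, so that
    relations known on the real line hold in the whole strip. *)
Lemma HB_real_unique (s m m' : R) (F G : C -> C) : HB s F m -> HB s G m' ->
  (forall x, F (x, 0) = G (x, 0)) -> forall z : C, Rabs (snd z) < s -> F z = G z.
Proof.
  intros HF HG E z Hz.
  assert (HD := HB_plus s _ _ _ _ HF (HB_scal s (- (1))%C G 1 m' ltac:(lra) ltac:(rewrite Cmod_m1; lra) HG)).
  assert (K := identity_theorem s _ _ (proj1 (proj2 HD)) (HB_bnd _ _ _ HD)).
  replace (F z) with ((F z + (- (1)) * G z) + G z)%C by ring. rewrite K; auto; [ring |].
  intros x. rewrite E. ring.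
Qed.

(** * Series of functions *)

Fixpoint csum (f : nat -> C) (n : nat) : C :=
  match n with O => f O | S n => (csum f n + f (S n))%C end.

Lemma csum_ext (f g : nat -> C) (n : nat) : (forall k, (k <= n)%nat -> f k = g k) -> csum f n = csum g n.
Proof.
  induction n; intros H; simpl; [apply H; lia |]. rewrite IHn, (H (S n)); auto.
Qed.

Lemma csum_plus (f g : nat -> C) (n : nat) : csum (fun k => f k + g k)%C n = (csum f n + csum g n)%C.
Proof. induction n; simpl; auto. rewrite IHn. ring. Qed.

Lemma csum_scal (c : C) (f : nat -> C) (n : nat) : csum (fun k => c * f k)%C n = (c * csum f n)%C.
Proof. induction n; simpl; auto. rewrite IHn. ring. Qed.

Lemma csum_bound (f : nat -> C) (m : nat -> R) (n : nat) :
  (forall k, (k <= n)%nat -> Cmod (f k) <= m k) -> Cmod (csum f n) <= sum_f_R0 m n.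
Proof.
  induction n; intros H; simpl; [apply H; lia |].
  eapply Rle_trans; [apply Cmod_triangle |]. apply Rplus_le_compat; auto.
Qed.

Lemma pow_half_double (r : R) (n : nat) : 0 <= r <= 1 / 2 -> 2 * r ^ S n <= r ^ n.
Proof. intros Hr. simpl. assert (0 <= r ^ n) by (apply pow_le; lra). nra. Qed.

Lemma csum_tail (f : nat -> C) (K r : R) : 0 <= r <= 1 / 2 -> (forall n, Cmod (f n) <= K * r ^ n) ->
  forall n m, (n <= m)%nat -> Cmod (csum f m - csum f n)%C <= K * r ^ n.
Proof.
  intros Hr H n m Hnm.
  assert (HK : 0 <= K).
  { specialize (H O). simpl in H. pose proof (Cmod_ge_0 (f O)). lra. }
  (* The subtracted power makes the induction close, since 2 r^(i+1) <= r^i for r <= 1/2. *)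
  assert (P : forall j, Cmod (csum f (n + j) - csum f n)%C <= K * (r ^ n - r ^ (n + j))).
  { induction j.
    - rewrite Nat.add_0_r. replace (csum f n - csum f n)%C with (RtoC 0) by ring. rewrite Cmod_0. lra.
    - rewrite Nat.add_succ_r. simpl csum.
      replace (csum f (n + j) + f (S (n + j)) - csum f n)%C
        with ((csum f (n + j) - csum f n) + f (S (n + j)))%C by ring.
      eapply Rle_trans; [apply Cmod_triangle |].
      pose proof (H (S (n + j))). pose proof (pow_half_double r (n + j) Hr). nra. }
  specialize (P (m - n)%nat). replace (n + (m - n))%nat with m in P by lia.
  assert (0 <= r ^ m) by (apply pow_le; lra). nra.
Qed.

Lemma HB_csum (s : R) (F : nat -> C -> C) (m : nat -> R) (n : nat) :
  (forall k, (k <= n)%nat -> HB s (F k) (m k)) -> HB s (fun z => csum (fun k => F k z) n) (sum_f_R0 m n).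
Proof.
  induction n; intros H; simpl; [apply H; lia |].
  apply (HB_plus s (fun z => csum (fun k => F k z) n) (F (S n))); auto.
Qed.

Lemma sum_geom_half (A : R) (n : nat) : sum_f_R0 (fun k => A * (1 / 2) ^ k) n = A * (2 - (1 / 2) ^ n).
Proof. induction n; simpl; [ring |]. rewrite IHn. simpl. field. Qed.

(** Since |g| <= B, |f|^2 exceeds |g|^2 by at most eps (2B+1). As [L2B] tests only bounded
    intervals, uniform closeness is enough. *)
Lemma L2B_lim (f : R -> C) (m B : R) : contline f -> 0 <= B ->
  (forall eps, 0 < eps -> exists g, contline g /\ L2B g m /\ (forall x, Cmod (g x) <= B) /\
     forall x, Cmod (f x - g x)%C <= eps) -> L2B f m.
Proof.
  intros Hf HB H a b Hab. apply le_epsilon. intros e He.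
  set (w := (2 * B + 1) * (b - a + 1)). assert (Hw : 0 < w) by (apply Rmult_lt_0_compat; lra).
  set (eps := Rmin 1 (e / w)). assert (Heps : 0 < eps) by (apply Rmin_pos; [lra | now apply Rdiv_lt_0_compat]).
  assert (He1 : eps <= 1) by apply Rmin_l. assert (He2 : eps <= e / w) by apply Rmin_r.
  destruct (H eps Heps) as (g & Hg & HL & Hgb & Hfg). specialize (HL a b Hab).
  assert (K : RInt (fun x => Cnorm2 (f x)) a b <= RInt (fun x => Cnorm2 (g x) + eps * (2 * B + 1)) a b).
  { apply RInt_le; auto using ex_RInt_Cnorm2.
    - apply (ex_RInt_plus (V := R_NormedModule)). now apply ex_RInt_Cnorm2. apply (ex_RInt_const (V := R_NormedModule)).
    - intros x _. rewrite !Cnorm2_Cmod. specialize (Hgb x). specialize (Hfg x).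
      pose proof (Cmod_triangle_minus (f x) (g x)). pose proof (Cmod_ge_0 (f x)). pose proof (Cmod_ge_0 (g x)).
      assert (Cmod (f x) * Cmod (f x) <= (Cmod (g x) + eps) * (Cmod (g x) + eps)) by (apply Rmult_le_compat; lra).
      assert (eps * (2 * Cmod (g x) + eps) <= eps * (2 * B + 1)) by (apply Rmult_le_compat_l; lra). lra. }
  rewrite (RInt_plus (V := R_CompleteNormedModule)), (RInt_const (V := R_CompleteNormedModule)) in K.
  2: now apply ex_RInt_Cnorm2. 2: apply (ex_RInt_const (V := R_NormedModule)).
  change (RInt (fun x => Cnorm2 (f x)) a b <= RInt (fun x => Cnorm2 (g x)) a b + (b - a) * (eps * (2 * B + 1))) in K.
  assert ((b - a) * (eps * (2 * B + 1)) <= e); [| lra].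
  apply Rle_trans with (w * (e / w)); [| right; field; lra].
  replace ((b - a) * (eps * (2 * B + 1))) with ((2 * B + 1) * (b - a) * eps) by ring.
  unfold w. apply Rmult_le_compat; auto; [apply Rmult_le_pos; lra | lra | apply Rmult_le_compat_l; lra].
Qed.

(** The Taylor estimate of order 2 has a constant depending only on the common sup bound, so it
    passes to the uniform limit and yields holomorphy. The derivatives converge on each line by
    Cauchy's estimate for differences, and L2 bounds survive by [L2B_lim]. *)
Lemma HB_lim (s m K : R) (G : nat -> C -> C) : (forall n, HB s (G n) m) ->
  (forall n k, (n <= k)%nat -> bnd s (K * (1 / 2) ^ n) (fun z => G k z - G n z)%C) ->
  HB s (fun z => clim (fun n => G n z)) m.
Proof.
  intros HG Hc. set (L := fun z => clim (fun n => G n z)).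
  assert (Hm : 0 < m) by apply (HG O).
  assert (Hnear : forall n z, Rabs (snd z) < s -> Cmod (L z - G n z)%C <= 2 * K * (1 / 2) ^ n).
  { intros n z Hz. apply (clim_spec (fun n => G n z) K). intros; now apply Hc. }
  assert (HcD : forall z, Rabs (snd z) < s -> forall n k, (n <= k)%nat ->
    Cmod (Cd (G k) z - Cd (G n) z)%C <= K / (s - Rabs (snd z)) * (1 / 2) ^ n).
  { intros z Hz n k Hnk.
    assert (Hk := proj1 (proj2 (HG k))). assert (Hn := proj1 (proj2 (HG n))).
    assert (Hdiff : cdiff (fun z => G k z - G n z)%C z (Cd (G k) z - Cd (G n) z)%C).
    { apply cdiff_minus; now apply (hol_cdiff s). }
    rewrite <- (cdiff_Cd _ _ _ Hdiff).
    eapply Rle_trans; [apply (hol_Cd_bound s (K * (1 / 2) ^ n)); auto |].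
    - intros w Hw. eexists. apply cdiff_minus; apply (hol_cdiff s); eauto.
    - right. field. lra. }
  set (dL := fun z => clim (fun n => Cd (G n) z)).
  assert (HnearD : forall z, Rabs (snd z) < s -> forall n,
    Cmod (dL z - Cd (G n) z)%C <= 2 * (K / (s - Rabs (snd z))) * (1 / 2) ^ n).
  { intros z Hz n. apply (clim_spec (fun n => Cd (G n) z)). now apply HcD. }
  assert (HD : forall z : C, Rabs (snd z) < s -> cdiff L z (dL z)).
  { intros z Hz. set (d := (s - Rabs (snd z)) / 5). assert (Hd : 0 < d) by (unfold d; lra).
    apply (cdiff_taylor2 _ _ _ (2 * m / (d * d)) d); auto. intros h Hh.
    assert (Hzh : Rabs (snd (z + h)%C) < s).
    { pose proof (snd_dist z (z + h)%C). replace (z + h - z)%C with h in * by ring. unfold d in *. lra. }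
    apply (le_half_pow _ _ (2 * K + 2 * K + 2 * (K / (s - Rabs (snd z))) * Cmod h)). intros n.
    pose proof (hol_taylor2 s (2 * m) (G n) z h d (proj1 (proj2 (HG n))) (HB_bnd _ _ _ (HG n)) Hd
      ltac:(unfold d; lra) Hh) as T.
    pose proof (Hnear n _ Hz) as N1. pose proof (Hnear n _ Hzh) as N2.
    pose proof (HnearD z Hz n) as N3.
    replace (L (z + h) - L z - dL z * h)%C with ((G n (z + h) - G n z - Cd (G n) z * h)
      + (((L (z + h) - G n (z + h)) - (L z - G n z)) - (dL z - Cd (G n) z) * h))%C by ring.
    eapply Rle_trans; [apply Cmod_triangle |]. apply Rplus_le_compat; auto.
    eapply Rle_trans; [apply Cmod_minus |]. rewrite Cmod_mult.
    pose proof (Cmod_minus (L (z + h) - G n (z + h))%C (L z - G n z)%C).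
    pose proof (Rmult_le_compat_r (Cmod h) _ _ (Cmod_ge_0 h) N3). lra. }
  destruct (hol_intro s L dL HD) as [H1 H2].
  split; [auto | split; auto]. intros y Hy.
  assert (Hsmall : forall Q eps, 0 < eps -> exists n, Q * (1 / 2) ^ n <= eps).
  { intros Q eps He. destruct (half_pow_small Q eps He) as [N HN]. exists N. left. now apply HN. }
  split.
  - apply (L2B_lim _ _ (2 * m)); [now apply (hol_contline s) | lra |].
    intros eps He. destruct (Hsmall (2 * K) eps He) as [n Hn]. exists (line (G n) y).
    split; [| split; [| split]].
    + apply (hol_contline s); auto. apply (HG n).
    + exact (proj1 (proj2 (proj2 (HG n)) y Hy)).
    + intros x. exact (HB_bnd s (G n) m (HG n) (x, y) Hy).
    + intros x. eapply Rle_trans; [now apply Hnear | auto].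
  - apply (L2B_lim _ _ (2 * m / (s - Rabs y))).
    + apply (hol_contline s); auto using hol_Cd.
    + apply Rdiv_le_0_compat; lra.
    + intros eps He. destruct (Hsmall (2 * (K / (s - Rabs y))) eps He) as [n Hn].
      exists (line (Cd (G n)) y). assert (Hn' := proj1 (proj2 (HG n))). split; [| split; [| split]].
      * apply (hol_contline s); auto using hol_Cd.
      * exact (proj2 (proj2 (proj2 (HG n)) y Hy)).
      * intros x. apply (hol_Cd_bound s (2 * m) (G n) (x, y)); auto. now apply HB_bnd.
      * intros x. unfold line. rewrite H2 by auto. eapply Rle_trans; [now apply HnearD | auto].
Qed.

Definition cser (F : nat -> C -> C) (z : C) : C := clim (fun n => csum (fun k => F k z) n).

Lemma HB_geom (s A : R) (F : nat -> C -> C) : (forall n, HB s (F n) (A * (1 / 2) ^ n)) ->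
  HB s (cser F) (2 * A) /\
  (forall z : C, Rabs (snd z) < s -> forall n k, (n <= k)%nat ->
    Cmod (csum (fun j => F j z) k - csum (fun j => F j z) n)%C <= 2 * A * (1 / 2) ^ n) /\
  forall z : C, Rabs (snd z) < s -> forall n,
    Cmod (cser F z - csum (fun j => F j z) n)%C <= 4 * A * (1 / 2) ^ n.
Proof.
  intros H. assert (HA : 0 < A).
  { pose proof (proj1 (H O)) as K. simpl in K. lra. }
  assert (T : forall z : C, Rabs (snd z) < s -> forall n k, (n <= k)%nat ->
    Cmod (csum (fun j => F j z) k - csum (fun j => F j z) n)%C <= 2 * A * (1 / 2) ^ n).
  { intros z Hz. apply csum_tail; [lra |]. intros n. rewrite Rmult_assoc.
    now apply (HB_bnd s (F n) _ (H n)). }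
  split; [| split; auto].
  - apply (HB_lim s (2 * A) (2 * A) (fun n z => csum (fun k => F k z) n)).
    + intros n. apply (HB_le _ _ (sum_f_R0 (fun k => A * (1 / 2) ^ k) n)).
      * rewrite sum_geom_half. pose proof (half_pow_pos n). nra.
      * apply HB_csum. intros; apply H.
    + intros n k Hnk z Hz. now apply T.
  - intros z Hz n. replace (4 * A) with (2 * (2 * A)) by ring.
    apply (clim_spec (fun n => csum (fun k => F k z) n)). now apply T.
Qed.

Lemma cser_unique (s A K : R) (F : nat -> C -> C) (z l : C) :
  (forall n, HB s (F n) (A * (1 / 2) ^ n)) -> Rabs (snd z) < s ->
  (forall n, Cmod (l - csum (fun j => F j z) n)%C <= K * (1 / 2) ^ n) -> cser F z = l.
Proof.
  intros H Hz. destruct (HB_geom s A F H) as (_ & T & _).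
  apply (clim_unique (fun n => csum (fun k => F k z) n) (2 * A)). now apply T.
Qed.

(** Square and triangular partial sums differ by n+1 tails, each of size K 4^(-n), and n+1 <=
    2^n. *)
Lemma cauchy_product (q : nat -> nat -> C) (K : R) :
  (forall k l, Cmod (q k l) <= K * (1 / 4) ^ k * (1 / 4) ^ l) ->
  forall n, Cmod (csum (fun k => csum (fun l => q k l) n) n - csum (fun j => csum (fun k => q k (j - k)%nat) j) n)%C
    <= K * (1 / 2) ^ n.
Proof.
  intros H n.
  assert (HK : 0 <= K).
  { pose proof (H O O) as H0. simpl in H0. pose proof (Cmod_ge_0 (q O O)). lra. }
  assert (E : csum (fun j => csum (fun k => q k (j - k)%nat) j) n = csum (fun k => csum (fun l => q k l) (n - k)) n).
  { clear. induction n; [reflexivity |].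
    change (csum (fun j => csum (fun k => q k (j - k)%nat) j) n + csum (fun k => q k (S n - k)%nat) (S n) =
      csum (fun k => csum (fun l => q k l) (S n - k)) (S n))%C.
    rewrite IHn. cbn [csum]. rewrite Nat.sub_diag. cbn [csum]. rewrite Cplus_assoc, <- csum_plus. f_equal.
    apply csum_ext. intros k Hk. replace (S n - k)%nat with (S (n - k)) by lia. reflexivity. }
  rewrite E.
  replace (csum (fun k => csum (fun l => q k l) n) n - csum (fun k => csum (fun l => q k l) (n - k)) n)%C
    with (csum (fun k => csum (fun l => q k l) n + (- (1)) * csum (fun l => q k l) (n - k))%C n)
    by (rewrite csum_plus, csum_scal; ring).
  eapply Rle_trans.
  - apply (csum_bound _ (fun _ => K * (1 / 4) ^ n)). intros k Hk.
    replace (csum (fun l => q k l) n + (- (1)) * csum (fun l => q k l) (n - k))%C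
      with (csum (fun l => q k l) n - csum (fun l => q k l) (n - k))%C by ring.
    eapply Rle_trans; [apply (csum_tail _ (K * (1 / 4) ^ k) (1 / 4)); [lra | auto | lia] |].
    rewrite Rmult_assoc, <- pow_add. replace (k + (n - k))%nat with n by lia. lra.
  - rewrite sum_cte.
    assert (Hn : INR (S n) <= 2 ^ n).
    { clear. induction n; [simpl; lra |]. rewrite S_INR.
      assert (1 <= 2 ^ n) by (apply pow_R1_Rle; lra). simpl pow. lra. }
    replace ((1 / 4) ^ n) with ((1 / 2) ^ n * (1 / 2) ^ n) by (rewrite <- Rpow_mult_distr; f_equal; lra).
    assert (E2 : 2 ^ n * (1 / 2) ^ n = 1) by (rewrite <- Rpow_mult_distr; replace (2 * (1 / 2)) with 1 by field; apply pow1).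
    pose proof (half_pow_pos n).
    assert (INR (S n) * (1 / 2) ^ n <= 1) by nra.
    replace (K * ((1 / 2) ^ n * (1 / 2) ^ n) * INR (S n))
      with (K * (1 / 2) ^ n * (INR (S n) * (1 / 2) ^ n)) by ring.
    rewrite <- (Rmult_1_r (K * (1 / 2) ^ n)) at 2. apply Rmult_le_compat_l; auto.
    apply Rmult_le_pos; lra.
Qed.

(** * Power series solution *)

Ltac mulpos := match goal with
  | |- 0 < ?a * ?b => apply (Rmult_lt_0_compat a b); mulpos
  | |- _ => lra end.

(** Course-of-values recursion: the coefficient of index n+1 involves all earlier ones, so the
    recursion builds the table of the coefficients up to n. *)
Fixpoint coef_upto (b : R) (U0 : C -> C) (n : nat) : nat -> C -> C :=
  match n with
  | O => fun _ => U0
  | S n => fun k => if Nat.leb k n then coef_upto b U0 n k else fun z =>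
      (RtoC (/ INR (S n)) * csum (fun j => Qop b (coef_upto b U0 n j) (coef_upto b U0 n (n - j)%nat) z) n)%C
  end.

Definition coef (b : R) (U0 : C -> C) (n : nat) : C -> C := coef_upto b U0 n n.

Lemma coef_upto_le (b : R) (U0 : C -> C) (n k : nat) : (k <= n)%nat -> coef_upto b U0 n k = coef b U0 k.
Proof.
  induction n; intros H.
  - now replace k with O by lia.
  - destruct (Nat.eq_dec k (S n)) as [-> | N]; [reflexivity |].
    simpl. replace (Nat.leb k n) with true by (symmetry; apply Nat.leb_le; lia). apply IHn. lia.
Qed.

Lemma coef_S (b : R) (U0 : C -> C) (n : nat) (z : C) :
  coef b U0 (S n) z = (RtoC (/ INR (S n)) * csum (fun j => Qop b (coef b U0 j) (coef b U0 (n - j)%nat) z) n)%C.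
Proof.
  unfold coef at 1. cbn [coef_upto].
  replace (Nat.leb (S n) n) with false by (symmetry; apply Nat.leb_gt; lia).
  f_equal. apply csum_ext. intros k Hk. rewrite !coef_upto_le by lia. reflexivity.
Qed.

Lemma sum_rev (f : nat -> R) (n : nat) : sum_f_R0 (fun k => f (n - k)%nat) n = sum_f_R0 f n.
Proof.
  induction n; [reflexivity |].
  rewrite decomp_sum by lia. rewrite Nat.sub_0_r. simpl pred.
  rewrite (sum_eq _ (fun k => f (n - k)%nat)) by (intros; f_equal; lia).
  rewrite IHn. simpl. ring.
Qed.

Lemma sum_scal_l (c : R) (f : nat -> R) (n : nat) :
  sum_f_R0 (fun k => c * f k) n = c * sum_f_R0 f n.
Proof. induction n; simpl; [reflexivity |]. rewrite IHn. ring. Qed.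

Lemma INR_S_pos (n : nat) : 0 < INR (S n).
Proof. apply lt_0_INR. lia. Qed.

(** The subtracted term makes the induction telescope: 1/(x+1)^2 <= 1/x - 1/(x+1). *)
Lemma sum_inv_sq (n : nat) : sum_f_R0 (fun k => / (INR (S k) * INR (S k))) n <= 2 - / INR (S n).
Proof.
  induction n; [simpl; lra |].
  change (sum_f_R0 (fun k => / (INR (S k) * INR (S k))) n + / (INR (S (S n)) * INR (S (S n))) <= 2 - / INR (S (S n))).
  pose proof (INR_S_pos n). rewrite (S_INR (S n)). set (x := INR (S n)) in *.
  assert (/ ((x + 1) * (x + 1)) <= / x - / (x + 1)); [| lra].
  apply Rmult_le_reg_r with (x * ((x + 1) * (x + 1))); [mulpos |].
  replace (/ ((x + 1) * (x + 1)) * (x * ((x + 1) * (x + 1)))) with x by (field; lra).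
  replace ((/ x - / (x + 1)) * (x * ((x + 1) * (x + 1)))) with (x + 1) by (field; lra). lra.
Qed.

(* 1/(p q) = (1/p + 1/q)/(p + q), here with p + q = n + 2. *)
Lemma sum_inv_sq_conv (n : nat) :
  sum_f_R0 (fun k => / (INR (S k) * INR (S k)) * / (INR (S (n - k)) * INR (S (n - k)))) n
  <= 8 / (INR (S (S n)) * INR (S (S n))).
Proof.
  set (N := INR (S (S n))). assert (HN : 0 < N) by apply INR_S_pos.
  apply Rle_trans with (sum_f_R0 (fun k => 2 / (N * N) * / (INR (S k) * INR (S k))
    + 2 / (N * N) * / (INR (S (n - k)) * INR (S (n - k)))) n).
  - apply sum_Rle. intros k Hk.
    set (p := INR (S k)). set (q := INR (S (n - k))).
    assert (Hp : 0 < p) by apply INR_S_pos. assert (Hq : 0 < q) by apply INR_S_pos.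
    assert (E : N = p + q).
    { unfold N, p, q. rewrite <- plus_INR. f_equal. lia. }
    rewrite E. apply Rmult_le_reg_r with ((p * p) * (q * q) * ((p + q) * (p + q))).
    { mulpos. }
    replace (/ (p * p) * / (q * q) * (p * p * (q * q) * ((p + q) * (p + q)))) with ((p + q) * (p + q)) by (field; lra).
    replace ((2 / ((p + q) * (p + q)) * / (p * p) + 2 / ((p + q) * (p + q)) * / (q * q)) * (p * p * (q * q) * ((p + q) * (p + q))))
      with (2 * (q * q) + 2 * (p * p)) by (field; lra).
    pose proof (Rle_0_sqr (p - q)). unfold Rsqr in *. lra.
  - rewrite sum_plus.
    rewrite (sum_rev (fun k => 2 / (N * N) * / (INR (S k) * INR (S k)))).
    rewrite sum_scal_l. pose proof (sum_inv_sq n) as K. pose proof (Rinv_0_lt_compat _ (INR_S_pos n)).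
    assert (0 < 2 / (N * N)) by (apply Rdiv_lt_0_compat; nra).
    replace (8 / (N * N)) with (2 / (N * N) * 2 + 2 / (N * N) * 2) by (field; lra).
    assert (2 / (N * N) * sum_f_R0 (fun k => / (INR (S k) * INR (S k))) n <= 2 / (N * N) * 2)
      by (apply Rmult_le_compat_l; lra).
    lra.
Qed.

(** Giving up a width d/(n+2) out of d leaves d (n+1)/(n+2); this is the cost in an n-th power of
    1/d, at most e uniformly in n. Existence and uniqueness both rest on it. *)
Lemma pow_succ_ratio (n : nat) : (INR (S (S n)) / INR (S n)) ^ n <= 3.
Proof.
  pose proof (INR_S_pos n) as H. rewrite (S_INR (S n)). set (x := INR (S n)) in *.
  replace ((x + 1) / x) with (1 + / x) by (field; lra).
  apply Rle_trans with (exp (/ x) ^ n).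
  - apply pow_incr. pose proof (Rinv_0_lt_compat _ H). split; [lra | apply exp_ineq1_le].
  - assert (E : forall k, exp (/ x) ^ k = exp (INR k * / x)).
    { induction k; [simpl; rewrite Rmult_0_l, exp_0; auto |].
      rewrite S_INR. simpl. rewrite IHk, <- exp_plus. f_equal. ring. }
    rewrite E. apply Rle_trans with (exp 1); [| apply exp_le_3]. apply exp_le_mono.
    apply Rmult_le_reg_r with x; auto. rewrite Rmult_assoc, Rinv_l, Rmult_1_r, Rmult_1_l by lra.
    unfold x. rewrite S_INR. lra.
Qed.

(* 48 = 2 * 3 * 8: the factors are N1/N <= 2, [pow_succ_ratio] and [sum_inv_sq_conv]. The norm of a product
   at radius s is estimated at the radius s + (rho - s)/(n + 2), which costs a factor (n + 2)/(rho - s). *)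
Lemma coef_HB (b rho M : R) (U0 : C -> C) : 0 < rho -> HB rho U0 M ->
  forall n s, 0 < s < rho ->
  HB s (coef b U0 n) (M / (INR (S n) * INR (S n)) * (48 * CQ b rho * M / (rho - s)) ^ n).
Proof.
  intros Hrho HU. assert (HM : 0 < M) by apply HU. assert (HC := CQ_pos b rho Hrho).
  set (C0 := CQ b rho) in *. set (K := 48 * C0 * M).
  assert (HK : 0 < K) by (unfold K; mulpos).
  induction n as [n IH] using (well_founded_induction Wf_nat.lt_wf). intros s Hs. destruct n as [| n].
  - simpl. replace (M / (1 * 1) * 1) with M by field. apply (HB_strip rho); auto. lra.
  - set (d := rho - s). set (N := INR (S n)). set (N1 := INR (S (S n))).
    assert (Hd : 0 < d) by (unfold d; lra).
    assert (HN : 0 < N) by apply INR_S_pos.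
    assert (EN : N1 = N + 1) by apply S_INR.
    assert (HN1 : 1 <= N) by (unfold N; rewrite S_INR; pose proof (pos_INR n); lra).
    set (s1 := s + d / N1).
    assert (Hs1 : 0 < d / N1) by (apply Rdiv_lt_0_compat; lra).
    assert (Hs1d : d / N1 < d).
    { apply Rmult_lt_reg_r with N1; [lra |]. replace (d / N1 * N1) with d by (field; lra). rewrite EN.
      assert (0 < d * N) by now apply Rmult_lt_0_compat. lra. }
    assert (Es1 : rho - s1 = d * (N / N1)) by (unfold s1, d; rewrite EN; field; lra).
    assert (Hss : 0 < s1 < rho) by (unfold s1, d in *; lra).
    set (X := (K / d) ^ n). assert (HX : 0 < X) by (apply pow_lt, Rdiv_lt_0_compat; lra).
    set (Y := (N1 / N) ^ n). assert (HY : Y <= 3) by apply pow_succ_ratio.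
    assert (HY0 : 0 < Y) by (apply pow_lt, Rdiv_lt_0_compat; lra).
    set (A := C0 * (M * M * X * Y * (N1 / d))).
    assert (HN1d : 0 < N1 / d) by (apply Rdiv_lt_0_compat; lra).
    assert (HA : 0 < A) by (unfold A; mulpos).
    assert (Hk : forall k, (k <= n)%nat -> HB s (fun z => Qop b (coef b U0 k) (coef b U0 (n - k)) z)
      (A * (/ (INR (S k) * INR (S k)) * / (INR (S (n - k)) * INR (S (n - k)))))).
    { intros k Hk. pose proof (IH k ltac:(lia) s1 Hss) as H1. pose proof (IH (n - k)%nat ltac:(lia) s1 Hss) as H2.
      pose proof (HB_Qop b rho s1 s _ _ _ _ H1 H2 ltac:(unfold s1, d in *; lra)) as H3.
      (* The exponents k and n - k add up to n, so the geometric factor is the same for all k; [Y]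
         is the cost of the larger radius s1. *)
      assert (E : (K / (rho - s1)) ^ k * (K / (rho - s1)) ^ (n - k) = X * Y).
      { rewrite <- pow_add. replace (k + (n - k))%nat with n by lia. unfold X, Y.
        rewrite <- Rpow_mult_distr. f_equal. rewrite Es1. field. repeat split; lra. }
      eapply HB_le; [| exact H3]. right. fold C0. fold K. unfold A.
      replace (s1 - s) with (d / N1) by (unfold s1; ring).
      pose proof (INR_S_pos k). pose proof (INR_S_pos (n - k)).
      transitivity (C0 * (M * M * ((K / (rho - s1)) ^ k * (K / (rho - s1)) ^ (n - k)) * (N1 / d)) *
        (/ (INR (S k) * INR (S k)) * / (INR (S (n - k)) * INR (S (n - k))))).
      - field. repeat split; lra.
      - rewrite E. ring. }
    assert (HS := HB_csum s _ _ n Hk).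
    pose proof (INR_S_pos n) as Hpos.
    apply (HB_ext s (fun z => RtoC (/ N) * csum (fun k => Qop b (coef b U0 k) (coef b U0 (n - k)) z) n)%C).
    { intros z _. symmetry. apply coef_S. }
    apply (HB_le _ _ (/ N * sum_f_R0 (fun k => A * (/ (INR (S k) * INR (S k)) * / (INR (S (n - k)) * INR (S (n - k))))) n)).
    + rewrite sum_scal_l.
      apply Rle_trans with (/ N * (A * (8 / (N1 * N1)))).
      * apply Rmult_le_compat_l. left; now apply Rinv_0_lt_compat.
        apply Rmult_le_compat_l; [lra |]. apply sum_inv_sq_conv.
      * fold N1 d K. simpl pow. fold X.
        replace (/ N * (A * (8 / (N1 * N1)))) with ((C0 * (M * M * X * 8) / (d * (N1 * N1))) * (Y * (N1 / N)))
          by (unfold A; field; lra).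
        replace (M / (N1 * N1) * (K / d * X)) with ((C0 * (M * M * X * 8) / (d * (N1 * N1))) * 6)
          by (unfold K; field; lra).
        apply Rmult_le_compat_l.
        { left. apply Rdiv_lt_0_compat; mulpos. }
        assert (N1 / N <= 2).
        { apply Rmult_le_reg_r with N; auto. replace (N1 / N * N) with N1 by (field; lra). lra. }
        assert (0 < N1 / N) by (apply Rdiv_lt_0_compat; lra). nra.
    + apply HB_scal; auto. now apply Rinv_0_lt_compat.
      rewrite Cmod_R, Rabs_pos_eq. lra. left. now apply Rinv_0_lt_compat.
Qed.

(** * Power series in time: difference quotients, derivative and equation *)

Lemma pow_diff_bound (T s t : R) (n : nat) : 0 <= s <= T -> 0 <= t <= T ->
  T * Rabs (s ^ n - t ^ n) <= INR n * T ^ n * Rabs (s - t).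
Proof.
  intros Hs Ht. induction n.
  - simpl. replace (1 - 1) with 0 by ring. rewrite Rabs_R0. lra.
  - rewrite S_INR. simpl pow.
    replace (s * s ^ n - t * t ^ n) with (s * (s ^ n - t ^ n) + t ^ n * (s - t)) by ring.
    pose proof (Rabs_triang (s * (s ^ n - t ^ n)) (t ^ n * (s - t))) as K. rewrite !Rabs_mult in K.
    rewrite (Rabs_pos_eq s), (Rabs_pos_eq (t ^ n)) in K by (try apply pow_le; lra).
    assert (t ^ n <= T ^ n) by (apply pow_incr; lra).
    assert (0 <= t ^ n) by (apply pow_le; lra).
    pose proof (Rabs_pos (s - t)). pose proof (Rabs_pos (s ^ n - t ^ n)).
    assert (s * (T * Rabs (s ^ n - t ^ n)) <= T * (INR n * T ^ n * Rabs (s - t))).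
    { apply Rmult_le_compat; auto; try lra. apply Rmult_le_pos; lra. }
    assert (T * (t ^ n * Rabs (s - t)) <= T * (T ^ n * Rabs (s - t))).
    { apply Rmult_le_compat_l; [lra |]. now apply Rmult_le_compat_r. }
    assert (T * Rabs (s * (s ^ n - t ^ n) + t ^ n * (s - t)) <=
      T * (s * Rabs (s ^ n - t ^ n) + t ^ n * Rabs (s - t))) by (apply Rmult_le_compat_l; lra).
    lra.
Qed.

Lemma INR_pow_pred (T t : R) (n : nat) : 0 <= t <= T -> INR n * (T * t ^ pred n) <= INR n * T ^ n.
Proof.
  intros Ht. destruct n; [simpl; lra |]. apply Rmult_le_compat_l; [apply pos_INR |].
  simpl. apply Rmult_le_compat_l; [lra |]. apply pow_incr; lra.
Qed.

Lemma INR_pow_S (t : R) (n : nat) : INR n * t ^ pred n * t = INR n * t ^ n.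
Proof. destruct n; simpl; ring. Qed.

(** The Taylor remainder of t^n is of order n^2 T^(n-2) (s-t)^2; multiplying by T^2 avoids negative
    exponents for n = 0 and n = 1. *)
Lemma pow_taylor_bound (T s t : R) (n : nat) : 0 <= s <= T -> 0 <= t <= T ->
  T * T * Rabs (s ^ n - t ^ n - INR n * t ^ pred n * (s - t)) <= INR n * INR n * T ^ n * ((s - t) * (s - t)).
Proof.
  intros Hs Ht. assert (Hq : 0 <= (s - t) * (s - t)) by apply Rle_0_sqr.
  induction n.
  - simpl. replace (1 - 1 - 0 * 1 * (s - t)) with 0 by ring. rewrite Rabs_R0. lra.
  - set (r := s ^ n - t ^ n - INR n * t ^ pred n * (s - t)) in *.
    (* Recursion for the remainder: r_(n+1) = s r_n + n t^(n-1) (s-t)^2. *)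
    assert (E : s ^ S n - t ^ S n - INR (S n) * t ^ pred (S n) * (s - t)
      = s * r + INR n * t ^ pred n * ((s - t) * (s - t))).
    { unfold r. rewrite S_INR. simpl pow. simpl pred. pose proof (INR_pow_S t n) as P.
      set (w := INR n * t ^ pred n) in *.
      replace (s * (s ^ n - t ^ n - w * (s - t)) + w * ((s - t) * (s - t)))
        with (s * (s ^ n - t ^ n) - (w * t) * (s - t)) by ring.
      rewrite P. ring. }
    rewrite E. set (w := INR n * t ^ pred n).
    assert (Hw : 0 <= w) by (apply Rmult_le_pos; [apply pos_INR | apply pow_le; lra]).
    assert (HwT : T * w <= INR n * T ^ n).
    { unfold w. pose proof (INR_pow_pred T t n Ht). lra. }
    pose proof (Rabs_triang (s * r) (w * ((s - t) * (s - t)))) as K. rewrite !Rabs_mult in K.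
    rewrite (Rabs_pos_eq s), (Rabs_pos_eq w), <- Rabs_mult, (Rabs_pos_eq ((s - t) * (s - t))) in K by lra.
    pose proof (Rabs_pos r). set (q := (s - t) * (s - t)) in *.
    assert (K1 : s * (T * T * Rabs r) <= T * (INR n * INR n * T ^ n * q)).
    { apply Rmult_le_compat; auto; try lra. apply Rmult_le_pos; nra. }
    assert (K2 : T * (T * w) * q <= T * (INR n * T ^ n) * q).
    { apply Rmult_le_compat_r; auto. apply Rmult_le_compat_l; lra. }
    assert (K3 : T * T * Rabs (s * r + w * q) <= T * T * (s * Rabs r + w * q)) by (apply Rmult_le_compat_l; nra).
    assert (HT : 0 <= T * T ^ n * q) by (apply Rmult_le_pos; auto; apply Rmult_le_pos; [lra | apply pow_le; lra]).
    rewrite S_INR. simpl pow. pose proof (pos_INR n).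
    assert (0 <= INR n * (T * T ^ n * q)) by (apply Rmult_le_pos; lra).
    lra.
Qed.

Lemma sq_le_pow2 (n : nat) : INR n * INR n <= 2 * 2 ^ n.
Proof.
  (* From 3 on even (n+1)^2 <= 2 * 2^n, with equality at 3; the smaller n are checked directly. *)
  assert (H : forall k, (INR (k + 3) + 1) * (INR (k + 3) + 1) <= 2 * 2 ^ (k + 3)).
  { induction k; [simpl; lra |].
    replace (S k + 3)%nat with (S (k + 3)) by lia. rewrite S_INR. simpl pow.
    assert (3 <= INR (k + 3)) by (rewrite plus_INR; pose proof (pos_INR k); simpl; lra). nra. }
  destruct n as [| [| [| n]]]; [simpl; lra | simpl; lra | simpl; lra |].
  specialize (H n). replace (S (S (S n))) with (n + 3)%nat by lia. pose proof (pos_INR (n + 3)). nra.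
Qed.

Lemma INR_le_pow2 (n : nat) : INR n <= 2 ^ n.
Proof.
  induction n; [simpl; lra |]. rewrite S_INR. simpl.
  assert (1 <= 2 ^ n) by (apply pow_R1_Rle; lra). lra.
Qed.

(** The ratio 1/(4T) makes the series converge like 4^(-n) for t <= T. Two time differences or
    derivatives cost a factor n^2 <= 2 * 2^n, and 2^(-n) still remains. *)
Definition coef_bound (rho M T : R) (U : nat -> C -> C) : Prop :=
  0 < T /\ 0 < M /\ forall n, HB rho (U n) (M * (/ (4 * T)) ^ n).

(** The scalar coefficients are left general so that difference quotients and time derivatives of
    the solution are again series of this kind, estimated by one lemma as soon as [c n] is at most A
    (2T)^n. *)
Definition pser (U : nat -> C -> C) (c : nat -> R) : C -> C := cser (fun n z => RtoC (c n) * U n z)%C.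

Lemma ratio_half (T : R) (n : nat) : 0 < T -> (2 * T) ^ n * (/ (4 * T)) ^ n = (1 / 2) ^ n.
Proof. intros HT. rewrite <- Rpow_mult_distr. f_equal. field. lra. Qed.

Lemma ratio_quarter (T : R) (n : nat) : 0 < T -> T ^ n * (/ (4 * T)) ^ n = (1 / 4) ^ n.
Proof. intros HT. rewrite <- Rpow_mult_distr. f_equal. field. lra. Qed.

Lemma pser_HB_terms (rho M T A : R) (U : nat -> C -> C) (c : nat -> R) : coef_bound rho M T U -> 0 < A ->
  (forall n, Rabs (c n) <= A * (2 * T) ^ n) ->
  forall n, HB rho (fun z => RtoC (c n) * U n z)%C (A * M * (1 / 2) ^ n).
Proof.
  intros (HT & HM & HU) HA Hc n. rewrite <- (ratio_half T n HT).
  replace (A * M * ((2 * T) ^ n * (/ (4 * T)) ^ n)) with (A * (2 * T) ^ n * (M * (/ (4 * T)) ^ n)) by ring.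
  apply HB_scal; auto.
  - apply Rmult_lt_0_compat; auto. apply pow_lt. lra.
  - now rewrite Cmod_R.
Qed.

Lemma pser_HB (rho M T A : R) (U : nat -> C -> C) (c : nat -> R) : coef_bound rho M T U -> 0 < A ->
  (forall n, Rabs (c n) <= A * (2 * T) ^ n) ->
  HB rho (pser U c) (2 * (A * M)) /\
  forall z : C, Rabs (snd z) < rho -> forall n,
    Cmod (pser U c z - csum (fun j => RtoC (c j) * U j z)%C n)%C <= 4 * (A * M) * (1 / 2) ^ n.
Proof.
  intros HU HA Hc. destruct (HB_geom rho (A * M) _ (pser_HB_terms rho M T A U c HU HA Hc)) as (H1 & _ & H3).
  split; auto.
Qed.

(** The combination is the one of a difference quotient minus a derivative, with k = 1/(s-t). *)
Lemma pser_linear (rho M T A A1 A2 A3 k : R) (U : nat -> C -> C) (c c1 c2 c3 : nat -> R) (z : C) :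
  coef_bound rho M T U -> 0 < A -> 0 < A1 -> 0 < A2 -> 0 < A3 ->
  (forall n, Rabs (c n) <= A * (2 * T) ^ n) -> (forall n, Rabs (c1 n) <= A1 * (2 * T) ^ n) ->
  (forall n, Rabs (c2 n) <= A2 * (2 * T) ^ n) -> (forall n, Rabs (c3 n) <= A3 * (2 * T) ^ n) ->
  (forall n, c n = k * (c1 n - c2 n) - c3 n) -> Rabs (snd z) < rho ->
  pser U c z = (RtoC k * (pser U c1 z - pser U c2 z) - pser U c3 z)%C.
Proof.
  intros HU HA HA1 HA2 HA3 Hc Hc1 Hc2 Hc3 E Hz.
  apply (cser_unique rho (A * M) (Rabs k * (4 * (A1 * M) + 4 * (A2 * M)) + 4 * (A3 * M))); auto.
  { now apply (pser_HB_terms rho M T A). }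
  intros n.
  destruct (pser_HB rho M T A1 U c1 HU HA1 Hc1) as [_ K1].
  destruct (pser_HB rho M T A2 U c2 HU HA2 Hc2) as [_ K2].
  destruct (pser_HB rho M T A3 U c3 HU HA3 Hc3) as [_ K3].
  specialize (K1 z Hz n). specialize (K2 z Hz n). specialize (K3 z Hz n).
  set (s1 := csum (fun j => RtoC (c1 j) * U j z)%C n) in *.
  set (s2 := csum (fun j => RtoC (c2 j) * U j z)%C n) in *.
  set (s3 := csum (fun j => RtoC (c3 j) * U j z)%C n) in *.
  replace (csum (fun j => RtoC (c j) * U j z)%C n) with (RtoC k * (s1 + (- (1)) * s2) + (- (1)) * s3)%C.
  2:{ unfold s1, s2, s3. rewrite <- !csum_scal, <- csum_plus, <- csum_scal, <- csum_plus.
      apply csum_ext. intros j _. rewrite E, RtoC_minus, RtoC_mult, RtoC_minus. ring. }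
  replace (RtoC k * (pser U c1 z - pser U c2 z) - pser U c3 z - (RtoC k * (s1 + (- (1)) * s2) + (- (1)) * s3))%C
    with (RtoC k * ((pser U c1 z - s1) - (pser U c2 z - s2)) - (pser U c3 z - s3))%C by ring.
  eapply Rle_trans; [apply Cmod_minus |]. rewrite Cmod_RtoC_mult.
  pose proof (Cmod_minus (pser U c1 z - s1)%C (pser U c2 z - s2)%C) as K.
  pose proof (Rabs_pos k).
  assert (Rabs k * Cmod (pser U c1 z - s1 - (pser U c2 z - s2))%C <=
    Rabs k * (4 * (A1 * M) * (1 / 2) ^ n + 4 * (A2 * M) * (1 / 2) ^ n)) by (apply Rmult_le_compat_l; lra).
  lra.
Qed.

Lemma pow_coef_bound (T t : R) (n : nat) : 0 <= t <= T -> Rabs (t ^ n) <= 1 * (2 * T) ^ n.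
Proof.
  intros Ht. rewrite Rabs_pos_eq by (apply pow_le; lra). rewrite Rmult_1_l. apply pow_incr. lra.
Qed.

Lemma dpow_coef_bound (T t : R) (n : nat) : 0 < T -> 0 <= t <= T ->
  Rabs (INR n * t ^ pred n) <= / T * (2 * T) ^ n.
Proof.
  intros HT Ht. rewrite Rabs_pos_eq by (apply Rmult_le_pos; [apply pos_INR | apply pow_le; lra]).
  apply Rmult_le_reg_l with T; auto.
  replace (T * (/ T * (2 * T) ^ n)) with (2 ^ n * T ^ n) by (rewrite <- Rpow_mult_distr; field; lra).
  pose proof (INR_pow_pred T t n Ht). apply Rle_trans with (INR n * T ^ n); [lra |].
  apply Rmult_le_compat_r; [apply pow_le; lra | apply INR_le_pow2].
Qed.

Lemma sq_coef_bound (T D x : R) (n : nat) : 0 < T -> 0 <= D ->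
  T * T * x <= INR n * INR n * T ^ n * D -> x <= 2 * D / (T * T) * (2 * T) ^ n.
Proof.
  intros HT HD H. assert (HTT : 0 < T * T) by now apply Rmult_lt_0_compat.
  apply Rmult_le_reg_l with (T * T); auto.
  replace (T * T * (2 * D / (T * T) * (2 * T) ^ n)) with (2 * 2 ^ n * (T ^ n * D))
    by (rewrite Rpow_mult_distr; field; lra).
  eapply Rle_trans; [exact H |]. rewrite Rmult_assoc. apply Rmult_le_compat_r; [| apply sq_le_pow2].
  apply Rmult_le_pos; auto. apply pow_le. lra.
Qed.

Definition usol (U : nat -> C -> C) (t : R) : C -> C := pser U (fun n => t ^ n).

(** The termwise time derivative of [usol]; at n = 0 the value of [pred 0] is harmless because
    [INR n] vanishes. *)
Definition vsol (U : nat -> C -> C) (t : R) : C -> C := pser U (fun n => INR n * t ^ pred n).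

(** The error of the difference quotient is itself a series, with coefficients of order n^2 T^(n-2)
    |s-t|, so its norm is proportional to delta. *)
Lemma usol_diff_quot (rho M T s t delta : R) (U : nat -> C -> C) : coef_bound rho M T U ->
  0 <= s <= T -> 0 <= t <= T -> s <> t -> Rabs (s - t) < delta ->
  exists F, HB rho F (4 * M / (T * T) * delta) /\ forall z : C, Rabs (snd z) < rho ->
    F z = (RtoC (/ (s - t)) * (usol U s z - usol U t z) - vsol U t z)%C.
Proof.
  intros HU Hs Ht Hst Hd. assert (HT := proj1 HU). assert (HM := proj1 (proj2 HU)).
  assert (Hdp : 0 < delta) by (pose proof (Rabs_pos (s - t)); lra).
  assert (HTT : 0 < T * T) by now apply Rmult_lt_0_compat.
  assert (HA : 0 < 2 * delta / (T * T)) by (apply Rdiv_lt_0_compat; lra).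
  set (c := fun n => / (s - t) * (s ^ n - t ^ n) - INR n * t ^ pred n).
  assert (Hc : forall n, Rabs (c n) <= 2 * delta / (T * T) * (2 * T) ^ n).
  { intros n. apply sq_coef_bound; auto; [lra |].
    pose proof (pow_taylor_bound T s t n Hs Ht) as K.
    assert (Hp : 0 < Rabs (s - t)) by (apply Rabs_pos_lt; lra).
    apply Rmult_le_reg_r with (Rabs (s - t)); auto.
    replace (T * T * Rabs (c n) * Rabs (s - t))
      with (T * T * Rabs (s ^ n - t ^ n - INR n * t ^ pred n * (s - t))).
    2:{ rewrite (Rmult_assoc (T * T) (Rabs (c n))), <- Rabs_mult. do 2 f_equal. unfold c. field. lra. }
    eapply Rle_trans; [exact K |]. rewrite <- (Rabs_mul_self (s - t)), <- Rmult_assoc.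
    apply Rmult_le_compat_r; [lra |]. apply Rmult_le_compat_l; [| lra].
    apply Rmult_le_pos; [| apply pow_le; lra]. apply Rmult_le_pos; apply pos_INR. }
  exists (pser U c). split.
  - replace (4 * M / (T * T) * delta) with (2 * (2 * delta / (T * T) * M)) by (field; lra).
    now apply (pser_HB rho M T).
  - intros z Hz. apply (pser_linear rho M T (2 * delta / (T * T)) 1 1 (/ T)); auto; try lra.
    + now apply Rinv_0_lt_compat.
    + intros n. now apply pow_coef_bound.
    + intros n. now apply pow_coef_bound.
    + intros n. now apply dpow_coef_bound.
Qed.

Lemma vsol_continuous (rho M T s t delta : R) (U : nat -> C -> C) : coef_bound rho M T U ->
  0 <= s <= T -> 0 <= t <= T -> Rabs (s - t) < delta ->
  exists F, HB rho F (4 * M / (T * T) * delta) /\ forall z : C, Rabs (snd z) < rho ->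
    F z = (vsol U s z - vsol U t z)%C.
Proof.
  intros HU Hs Ht Hd. assert (HT := proj1 HU). assert (HM := proj1 (proj2 HU)).
  assert (Hdp : 0 < delta) by (pose proof (Rabs_pos (s - t)); lra).
  assert (HTT : 0 < T * T) by now apply Rmult_lt_0_compat.
  assert (HA : 0 < 2 * delta / (T * T)) by (apply Rdiv_lt_0_compat; lra).
  set (c := fun n => INR n * s ^ pred n - INR n * t ^ pred n).
  assert (Hc : forall n, Rabs (c n) <= 2 * delta / (T * T) * (2 * T) ^ n).
  { intros n. apply sq_coef_bound; auto; [lra |].
    unfold c. replace (INR n * s ^ pred n - INR n * t ^ pred n) with (INR n * (s ^ pred n - t ^ pred n)) by ring.
    rewrite Rabs_mult, (Rabs_pos_eq (INR n)) by apply pos_INR.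
    pose proof (pow_diff_bound T s t (pred n) Hs Ht) as K.
    destruct n; [simpl; lra |]. simpl pred in *.
    replace (T * T * (INR (S n) * Rabs (s ^ n - t ^ n))) with (INR (S n) * T * (T * Rabs (s ^ n - t ^ n))) by ring.
    pose proof (INR_S_pos n). pose proof (pow_lt T n HT).
    apply Rle_trans with (INR (S n) * T * (INR n * T ^ n * Rabs (s - t))).
    - apply Rmult_le_compat_l; auto. apply Rmult_le_pos; lra.
    - replace (INR (S n) * INR (S n) * T ^ S n * delta) with (INR (S n) * T * (INR (S n) * T ^ n * delta)) by (simpl pow; ring).
      apply Rmult_le_compat_l; [apply Rmult_le_pos; lra |].
      rewrite S_INR. pose proof (pos_INR n).
      apply Rmult_le_compat; [apply Rmult_le_pos; lra | apply Rabs_pos | apply Rmult_le_compat_r; lra | lra]. }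
  exists (pser U c). split.
  - replace (4 * M / (T * T) * delta) with (2 * (2 * delta / (T * T) * M)) by (field; lra).
    now apply (pser_HB rho M T).
  - intros z Hz.
    assert (HiT : 0 < / T) by now apply Rinv_0_lt_compat.
    (* Here k = 1 and the third series has zero coefficients. *)
    rewrite (pser_linear rho M T (2 * delta / (T * T)) (/ T) (/ T) 1 1 U c (fun n => INR n * s ^ pred n)
      (fun n => INR n * t ^ pred n) (fun _ => 0) z); auto; try lra.
    + replace (pser U (fun _ => 0) z) with (RtoC 0).
      * unfold vsol. ring.
      * symmetry. apply (cser_unique rho (1 * M) 0); auto.
        -- apply (pser_HB_terms rho M T 1); auto; [lra |]. intros n. rewrite Rabs_R0.
           apply Rmult_le_pos; [lra |]. apply pow_le. lra.
        -- intros n. rewrite csum_scal. replace (0 - RtoC 0 * csum (fun k => U k z) n)%C with (RtoC 0) by ring.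
           rewrite Cmod_0. lra.
    + intros n. now apply dpow_coef_bound.
    + intros n. now apply dpow_coef_bound.
    + intros n. rewrite Rabs_R0. apply Rmult_le_pos; [lra |]. apply pow_le. lra.
    + intros n. unfold c. ring.
Qed.

Lemma usol_0 (rho M T : R) (U : nat -> C -> C) (z : C) : coef_bound rho M T U -> Rabs (snd z) < rho ->
  usol U 0 z = U O z.
Proof.
  intros HU Hz. assert (HT := proj1 HU). apply (cser_unique rho (1 * M) 0); auto.
  - apply (pser_HB_terms rho M T 1); auto; [lra |]. intros n. apply pow_coef_bound. lra.
  (* As [0 ^ 0] is 1, every partial sum at time 0 reduces to the term of index 0. *)
  - intros n. replace (csum (fun j => RtoC (0 ^ j) * U j z)%C n) with (U O z).
    + replace (U O z - U O z)%C with (RtoC 0) by ring. rewrite Cmod_0. lra.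
    + induction n; simpl csum. simpl pow. ring. rewrite <- IHn. simpl pow. rewrite Rmult_0_l. ring.
Qed.

Lemma Qop_csum_l (b s : R) (F : nat -> C -> C) (G : C -> C) (z : C) (n : nat) :
  (forall k, reg s (F k)) -> reg s G -> Rabs (snd z) < s ->
  Qop b (fun z => csum (fun k => F k z) n) G z = csum (fun k => Qop b (F k) G z) n.
Proof.
  intros HF HG Hz. induction n; [reflexivity |]. cbn [csum]. rewrite <- IHn.
  apply (Qop_plus_l b s (fun z => csum (fun k => F k z) n) (F (S n))); auto.
  clear IHn. induction n; [apply HF |]. cbn [csum]. now apply (reg_plus s (fun z => csum (fun k => F k z) n)).
Qed.

Lemma Qop_csum_r (b s : R) (F : C -> C) (G : nat -> C -> C) (z : C) (n : nat) :
  reg s F -> (forall k, reg s (G k)) -> Rabs (snd z) < s ->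
  Qop b F (fun z => csum (fun k => G k z) n) z = csum (fun k => Qop b F (G k) z) n.
Proof.
  intros HF HG Hz. induction n; [reflexivity |]. cbn [csum]. rewrite <- IHn.
  apply (Qop_plus_r b s F (fun z => csum (fun k => G k z) n) (G (S n))); auto.
  clear IHn. induction n; [apply HG |]. cbn [csum]. now apply (reg_plus s (fun z => csum (fun k => G k z) n)).
Qed.

Lemma csum_shift (f : nat -> C) (n : nat) : f O = 0 -> csum f (S n) = csum (fun k => f (S k)) n.
Proof.
  intros H. induction n; [simpl; rewrite H; ring |].
  change (csum f (S n) + f (S (S n)) = csum (fun k => f (S k)) n + f (S (S n)))%C. now rewrite IHn.
Qed.

(** By the recursion, the partial sums of [vsol] are triangular sums of the terms Q(f_k, f_l),
    whereas Q of a partial sum S_n with itself is the square sum; [cauchy_product] compares them.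
    Finally Q(F,F) - Q(S_n,S_n) tends to zero because F - S_n, and by Cauchy's estimate its
    x-derivative on the line of z, decay like 2^(-n). *)
Lemma usol_equation (b rho M T t : R) (U : nat -> C -> C) (z : C) : coef_bound rho M T U ->
  (forall n z, U (S n) z = (RtoC (/ INR (S n)) * csum (fun j => Qop b (U j) (U (n - j)%nat) z) n)%C) ->
  0 <= t <= T -> Rabs (snd z) < rho -> vsol U t z = Qop b (usol U t) (usol U t) z.
Proof.
  intros HU HR Ht Hz. assert (HT := proj1 HU). assert (HM := proj1 (proj2 HU)).
  (* A radius strictly between |Im z| and rho: all functions involved are [reg] there, and [Qop]
     loses only the width rho - s. *)
  set (y := Rabs (snd z)) in *. set (s := (y + rho) / 2). assert (Hs : y < s < rho) by (unfold s; lra).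
  assert (Hy : 0 <= y) by apply Rabs_pos.
  assert (Hzs : Rabs (snd z) < s) by apply Hs.
  set (F := usol U t). set (f := fun n z => (RtoC (t ^ n) * U n z)%C).
  set (S_ := fun n z => csum (fun k => f k z) n).
  assert (Hc : forall n, Rabs (t ^ n) <= 1 * (2 * T) ^ n) by (intros n; now apply pow_coef_bound).
  assert (Hf : forall n, HB rho (f n) (1 * M * (1 / 2) ^ n)) by (apply (pser_HB_terms rho M T 1); auto; lra).
  assert (Hf4 : forall n, HB rho (f n) (M * (1 / 4) ^ n)).
  { intros n. rewrite <- (ratio_quarter T n HT).
    replace (M * (T ^ n * (/ (4 * T)) ^ n)) with (T ^ n * (M * (/ (4 * T)) ^ n)) by ring.
    apply HB_scal; [now apply pow_lt | | apply HU].
    rewrite Cmod_R, Rabs_pos_eq by (apply pow_le; lra). apply pow_incr. lra. }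
  destruct (pser_HB rho M T 1 U (fun n => t ^ n) HU ltac:(lra) Hc) as [HF Hnear].
  fold (usol U t) in HF, Hnear. fold F in HF, Hnear.
  assert (HS : forall n, HB rho (S_ n) (2 * (1 * M))).
  { intros n. apply (HB_le _ _ (sum_f_R0 (fun k => 1 * M * (1 / 2) ^ k) n)).
    - rewrite sum_geom_half. pose proof (half_pow_pos n). nra.
    - apply HB_csum. intros; apply Hf. }
  set (D := fun n z => (F z + (- (1)) * S_ n z)%C).
  assert (HDhol : forall n, hol rho (D n)).
  { intros n. apply hol_plus; [apply HF |]. apply hol_scal. apply HS. }
  assert (HDb : forall n, bnd rho (4 * (1 * M) * (1 / 2) ^ n) (D n)).
  { intros n w Hw. unfold D. replace (F w + (- (1)) * S_ n w)%C with (F w - S_ n w)%C by ring. now apply Hnear. }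
  assert (rF : reg s F) by (apply (HB_reg rho s F _ HF); lra).
  assert (rS : forall n, reg s (S_ n)) by (intros n; apply (HB_reg rho s _ _ (HS n)); lra).
  assert (rf : forall n, reg s (f n)) by (intros n; apply (HB_reg rho s _ _ (Hf n)); lra).
  assert (rD : forall n, reg s (D n)) by (intros n; apply reg_plus; auto; now apply reg_scal).
  set (B := 4 * M). set (B' := 4 * M / (rho - y)).
  set (K1 := 4 * M * B' + (Rabs (b / 2) * (4 * M * B) + Rabs ((3 - b) / 2) * (B' * B'))).
  set (K2 := B * B' + (Rabs (b / 2) * (B * (4 * M)) + Rabs ((3 - b) / 2) * (B' * B'))).
  assert (Hdiff : forall n, Cmod (Qop b F F z - Qop b (S_ n) (S_ n) z)%C <= (K1 + K2) * (1 / 2) ^ n).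
  { intros n. set (e := (1 / 2) ^ n).
    assert (E1 : Qop b F F z = (Qop b (S_ n) F z + Qop b (D n) F z)%C).
    { rewrite <- (Qop_plus_l b s); auto. apply (Qop_ext b s); auto.
      intros w _. unfold D. ring. }
    assert (E2 : Qop b (S_ n) F z = (Qop b (S_ n) (S_ n) z + Qop b (S_ n) (D n) z)%C).
    { rewrite <- (Qop_plus_r b s); auto. apply (Qop_ext b s); auto.
      intros w _. unfold D. ring. }
    rewrite E1, E2.
    replace (Qop b (S_ n) (S_ n) z + Qop b (S_ n) (D n) z + Qop b (D n) F z - Qop b (S_ n) (S_ n) z)%C
      with (Qop b (S_ n) (D n) z + Qop b (D n) F z)%C by ring.
    eapply Rle_trans; [apply Cmod_triangle |].
    assert (LD : forall x, Cmod (D n (x, snd z)) <= 4 * M * e).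
    { intros x. eapply Rle_trans; [now apply HDb |]. unfold e. lra. }
    assert (LD' : forall x, Cmod (Cd (D n) (x, snd z)) <= B' * e).
    { intros x. eapply Rle_trans; [now apply (hol_Cd_bound rho _ (D n) (x, snd z) (HDhol n) (HDb n)) |].
      right. simpl snd. unfold B', e. fold y. field. lra. }
    assert (LF : forall G, HB rho G (2 * (1 * M)) -> (forall x, Cmod (G (x, snd z)) <= B) /\
      forall x, Cmod (Cd G (x, snd z)) <= B').
    { intros G HG. pose proof (HB_bnd _ _ _ HG) as BG. split; intros x.
      - unfold B. eapply Rle_trans; [now apply BG | lra].
      - eapply Rle_trans; [now apply (hol_Cd_bound rho _ G (x, snd z) (proj1 (proj2 HG)) BG) |].
        right. simpl snd. unfold B'. fold y. field. lra. }
    destruct (LF F HF) as [LF1 LF2]. destruct (LF (S_ n) (HS n)) as [LS1 LS2].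
    pose proof (Qop_bound_line b rho _ _ _ _ (D n) F z (HDhol n) (proj1 (proj2 HF)) Hz LD LD' LF1 LF2) as Q1.
    pose proof (Qop_bound_line b rho _ _ _ _ (S_ n) (D n) z (proj1 (proj2 (HS n))) (HDhol n) Hz LS1 LS2 LD LD') as Q2.
    unfold K1, K2. lra. }
  set (q := fun k l => Qop b (f k) (f l) z).
  set (Kq := 2 * (CQ b rho * (M * M / (rho - s)))).
  assert (Hq : forall k l, Cmod (q k l) <= Kq * (1 / 4) ^ k * (1 / 4) ^ l).
  { intros k l.
    pose proof (HB_Qop b rho rho s _ _ _ _ (Hf4 k) (Hf4 l) ltac:(lra)) as H1.
    eapply Rle_trans; [apply (HB_bnd _ _ _ H1 z); fold y; lra |]. right. unfold Kq. field. lra. }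
  assert (Hsq : forall n, Qop b (S_ n) (S_ n) z = csum (fun k => csum (fun l => q k l) n) n).
  { intros n. unfold S_ at 1. rewrite (Qop_csum_l b s f (S_ n)); auto.
    apply csum_ext. intros k _. apply (Qop_csum_r b s (f k) f); auto. }
  (* The derived series starts at index 1, hence the shift; the factor j+1 from differentiation
     cancels the division in the recursion. *)
  assert (Htri : forall n, csum (fun j => RtoC (INR j * t ^ pred j) * U j z)%C (S n)
    = csum (fun j => csum (fun k => q k (j - k)%nat) j) n).
  { intros n. rewrite csum_shift by (simpl; rewrite Rmult_0_l; ring).
    apply csum_ext. intros j _. rewrite HR. simpl pred.
    replace (RtoC (INR (S j) * t ^ j) * (RtoC (/ INR (S j)) * csum (fun k => Qop b (U k) (U (j - k)%nat) z) j))%C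
      with (RtoC (t ^ j) * csum (fun k => Qop b (U k) (U (j - k)%nat) z) j)%C.
    2:{ rewrite Cmult_assoc, <- RtoC_mult. do 2 f_equal. pose proof (INR_S_pos j). field. lra. }
    rewrite <- csum_scal. apply csum_ext. intros k Hk. unfold q, f.
    assert (rU : forall n, reg s (U n)) by (intros i; apply (HB_reg rho s _ _ (proj2 (proj2 HU) i)); lra).
    rewrite (Qop_scal_l b s (RtoC (t ^ k)) (U k)), (Qop_scal_r b s (RtoC (t ^ (j - k))) (U k));
      auto using reg_scal.
    rewrite Cmult_assoc, <- RtoC_mult, <- pow_add. replace (k + (j - k))%nat with j by lia. reflexivity. }
  destruct (pser_HB rho M T (/ T) U (fun n => INR n * t ^ pred n) HU) as [_ HV].
  { now apply Rinv_0_lt_compat. } { intros n. now apply dpow_coef_bound. }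
  fold (vsol U t) in HV.
  apply (eq_half_pow _ _ (4 * (/ T * M) + (Kq + (K1 + K2)))). intros n.
  specialize (HV z Hz (S n)). rewrite Htri in HV.
  pose proof (cauchy_product q Kq Hq n) as HP. rewrite <- Hsq in HP. specialize (Hdiff n).
  assert (HiT : 0 < / T * M) by (apply Rmult_lt_0_compat; auto; now apply Rinv_0_lt_compat).
  pose proof (half_pow_pos n) as Hhp.
  assert (HV' : 4 * (/ T * M) * (1 / 2) ^ S n <= 4 * (/ T * M) * (1 / 2) ^ n).
  { apply Rmult_le_compat_l; [lra |]. apply half_pow_le. lia. }
  set (tri := csum (fun j => csum (fun k => q k (j - k)%nat) j) n) in *.
  pose proof (Cmod_dist_triangle (vsol U t z) tri (Qop b F F z)) as D1.
  pose proof (Cmod_dist_triangle tri (Qop b (S_ n) (S_ n) z) (Qop b F F z)) as D2.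
  rewrite (Cmod_minus_sym tri (Qop b (S_ n) (S_ n) z)) in D2. rewrite (Cmod_minus_sym (Qop b (S_ n) (S_ n) z) (Qop b F F z)) in D2.
  lra.
Qed.

Lemma solution_exists (b rho M T : R) (U : nat -> C -> C) (u0 : R -> Cx) : 0 < rho -> coef_bound rho M T U ->
  (forall n z, U (S n) z = (RtoC (/ INR (S n)) * csum (fun j => Qop b (U j) (U (n - j)%nat) z) n)%C) ->
  (forall x, U O (x, 0) = u0 x) ->
  is_solution b rho T u0 (fun t x => usol U t (x, 0)) (fun t x => vsol U t (x, 0)).
Proof.
  intros Hrho HU HR H0. assert (HT := proj1 HU). assert (HM := proj1 (proj2 HU)).
  assert (HTT : 0 < T * T) by now apply Rmult_lt_0_compat.
  assert (Hr : forall x : R, Rabs (snd (x, 0)) < rho) by (intros x; simpl; rewrite Rabs_R0; auto).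
  assert (Hu : forall t, 0 <= t <= T -> HB rho (usol U t) (2 * (1 * M))).
  { intros t Ht. apply (pser_HB rho M T); auto; [lra |]. intros n. now apply pow_coef_bound. }
  assert (Hv : forall t, 0 <= t <= T -> HB rho (vsol U t) (2 * (/ T * M))).
  { intros t Ht. apply (pser_HB rho M T); auto; [now apply Rinv_0_lt_compat |]. intros n. now apply dpow_coef_bound. }
  assert (Hdelta : forall eps, 0 < eps -> 0 < eps * (T * T) / (4 * M) /\
    4 * M / (T * T) * (eps * (T * T) / (4 * M)) = eps).
  { intros eps He. split; [apply Rdiv_lt_0_compat; nra | field; lra]. }
  split; [| split; [| split; [| split]]].
  - intros x. rewrite (usol_0 rho M T); auto.
  - intros t Ht. split; apply in_H1_HB; eauto.
  - intros t Ht eps He. destruct (Hdelta eps He) as [D1 D2].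
    exists (eps * (T * T) / (4 * M)). split; auto. intros s Hs Hst Hd.
    destruct (usol_diff_quot rho M T s t _ U HU Hs Ht Hst Hd) as (F & HF & E).
    rewrite D2 in HF. apply H1_le_HB; auto. exists F. split; auto.
    intros x. rewrite E, Cx_Cscal by auto. reflexivity.
  - intros t Ht eps He. destruct (Hdelta eps He) as [D1 D2].
    exists (eps * (T * T) / (4 * M)). split; auto. intros s Hs Hd.
    destruct (vsol_continuous rho M T s t _ U HU Hs Ht Hd) as (F & HF & E).
    rewrite D2 in HF. apply H1_le_HB; auto. exists F. split; [exact HF |].
    intros x. now apply E.
  - intros t Ht. apply (bfam_reg b (rho / 2) (usol U t)); auto; [lra | |].
    + apply (HB_reg rho _ _ _ (Hu t Ht)). lra.
    + intros x. now apply (usol_equation b rho M T).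
Qed.

(** * Uniqueness *)

(** What uniqueness uses of a solution, transported to the strip: time differentiability in sup
    norm, one-sided at 0 and T, and the equation at every complex point. The bounds may depend on t
    without any uniformity. *)
Definition ext_solution (b rho T : R) (U V : R -> C -> C) (mu mv : R -> R) : Prop :=
  forall t, 0 <= t <= T ->
    HB rho (U t) (mu t) /\ HB rho (V t) (mv t) /\
    (forall eps, 0 < eps -> exists delta, 0 < delta /\ forall s, 0 <= s <= T -> Rabs (s - t) < delta ->
       forall z : C, Rabs (snd z) < rho ->
         Cmod (U s z - U t z - V t z * RtoC (s - t))%C <= eps * Rabs (s - t)) /\
    (forall z : C, Rabs (snd z) < rho -> V t z = Qop b (U t) (U t) z).

Lemma HB_comb (s m m' : R) (c : C) (F G : C -> C) : HB s F m -> HB s G m' ->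
  exists m'', HB s (fun z => F z + c * G z)%C m''.
Proof.
  intros HF HG. eexists. apply HB_plus; [exact HF |].
  apply (HB_scal s c G (Cmod c + 1) m'); auto; pose proof (Cmod_ge_0 c); lra.
Qed.

(** An extension is chosen at each time, with no relation between different times or to the
    extensions inside [H1_le]; [HB_real_unique] reconciles them, and it spreads the equation from
    the real line. *)
Lemma solution_extend (b rho T : R) (u0 : R -> Cx) (u v : R -> R -> Cx) : 0 < rho ->
  is_solution b rho T u0 u v ->
  exists U V mu mv, ext_solution b rho T U V mu mv /\
    forall t, 0 <= t <= T -> forall x, U t (x, 0) = u t x.
Proof.
  intros Hrho (_ & HH & Hd & _ & He).
  assert (Hch : forall w : R -> R -> Cx, (forall t, 0 <= t <= T -> in_H1 rho (w t)) ->
    exists (W : R -> C -> C) (m : R -> R), forall t, 0 <= t <= T ->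
      HB rho (W t) (m t) /\ forall x, W t (x, 0) = w t x).
  { intros w Hw.
    assert (Hex : forall t, exists p : (C -> C) * R, 0 <= t <= T ->
      HB rho (fst p) (snd p) /\ forall x, fst p (x, 0) = w t x).
    (* Outside [0,T] the chosen pair is an arbitrary default. *)
    { intros t. destruct (classic (0 <= t <= T)) as [Ht | Ht].
      - destruct (proj1 (in_H1_HB _ _) (Hw t Ht)) as (F & m & H1 & H2). exists (F, m). auto.
      - exists (fun _ => RtoC 0, 0). tauto. }
    exists (fun t => fst (proj1_sig (constructive_indefinite_description _ (Hex t)))),
      (fun t => snd (proj1_sig (constructive_indefinite_description _ (Hex t)))).
    intros t. apply (proj2_sig (constructive_indefinite_description _ (Hex t))). }
  destruct (Hch u (fun t Ht => proj1 (HH t Ht))) as (U & mu & HU).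
  destruct (Hch v (fun t Ht => proj2 (HH t Ht))) as (V & mv & HV).
  exists U, V, mu, mv. split; [| intros t Ht; now apply HU].
  intros t Ht. destruct (HU t Ht) as [HU1 HU2], (HV t Ht) as [HV1 HV2].
  split; [auto | split; [auto | split]].
  (* Halving eps compensates the factor 2 between norm and supremum in [HB_bnd]. *)
  - intros eps Heps. destruct (Hd t Ht (eps / 2)) as (delta & Hdelta & K); [lra |].
    exists delta. split; auto. intros s Hs Hst z Hz.
    destruct (Req_dec s t) as [-> | N].
    { replace (t - t) with 0 by ring. replace (U t z - U t z - V t z * RtoC 0)%C with (RtoC 0) by ring.
      rewrite Cmod_0, Rabs_R0. lra. }
    specialize (K s Hs N Hst). apply H1_le_HB in K; [| lra]. destruct K as (F & HF & EF).
    destruct (HU s Hs) as [HUs1 HUs2].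
    destruct (HB_comb rho _ _ (- (1))%C _ _ HUs1 HU1) as [m1 H1].
    destruct (HB_comb rho _ _ (- RtoC (s - t))%C _ _ H1 HV1) as [m2 H2].
    assert (H3 := HB_scal rho (RtoC (s - t)) F (Rabs (s - t)) _ ltac:(apply Rabs_pos_lt; lra)
      ltac:(rewrite Cmod_R; lra) HF).
    assert (E := HB_real_unique rho _ _ _ _ H2 H3).
    assert (E0 : forall x : R, (U s (x, 0) + (- (1)) * U t (x, 0) + - RtoC (s - t) * V t (x, 0))%C
      = (RtoC (s - t) * F (x, 0))%C).
    { intros x. rewrite EF, Cx_Cscal, HUs2, HU2, HV2.
      change (u s x + (- (1)) * u t x + - RtoC (s - t) * v t x =
        RtoC (s - t) * (RtoC (/ (s - t)) * (u s x - u t x) - v t x))%C.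
      replace (RtoC (s - t) * (RtoC (/ (s - t)) * (u s x - u t x) - v t x))%C
        with ((RtoC (s - t) * RtoC (/ (s - t))) * (u s x - u t x) - RtoC (s - t) * v t x)%C by ring.
      rewrite <- RtoC_mult, Rinv_r by lra. ring. }
    specialize (E E0 z Hz). cbv beta in E.
    replace (U s z - U t z - V t z * RtoC (s - t))%C
      with (U s z + (- (1)) * U t z + - RtoC (s - t) * V t z)%C by ring.
    rewrite E, Cmod_RtoC_mult, Rmult_comm. apply Rmult_le_compat_r; [apply Rabs_pos |].
    eapply Rle_trans; [apply (HB_bnd rho F _ HF z Hz) | lra].
  (* The right-hand side has finite norm only on smaller strips, so the identity theorem is applied
     at a radius s between |Im z| and rho. *)
  - intros z Hz. set (s := (Rabs (snd z) + rho) / 2).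
    assert (Hs : Rabs (snd z) < s < rho) by (unfold s; lra).
    assert (Hs0 : 0 < s) by (pose proof (Rabs_pos (snd z)); lra).
    assert (HQ := HB_Qop b rho rho s _ _ _ _ HU1 HU1 ltac:(lra)).
    apply (HB_real_unique s _ _ _ _ (HB_strip rho s _ _ ltac:(lra) HV1) HQ); [| lra].
    intros x. rewrite HV2.
    apply (bfam_reg b s (U t) (u t) (v t)); auto.
    apply (HB_reg rho s _ _ HU1). lra.
Qed.

Lemma Rabs_clamp (a c s t : R) : a <= c ->
  Rabs (Rmax a (Rmin s c) - Rmax a (Rmin t c)) <= Rabs (s - t).
Proof.
  intros H. unfold Rmax, Rmin. repeat destruct Rle_dec; unfold Rabs; repeat destruct Rcase_abs; lra.
Qed.

Lemma clamp_in (a c s : R) : a <= c -> a <= Rmax a (Rmin s c) <= c.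
Proof. intros H. unfold Rmax, Rmin. repeat destruct Rle_dec; lra. Qed.

Lemma clamp_id (a c s : R) : a <= s <= c -> Rmax a (Rmin s c) = s.
Proof. intros H. rewrite Rmin_left, Rmax_right; lra. Qed.

(** At the ends of [a,c] only one-sided information is available. Composing with the projection of
    the line onto [a,c], which is 1-Lipschitz, extends f continuously and leaves it unchanged
    inside, so [pder_mvt] applies. *)
Lemma onesided_mvt (f df : R -> C) (g dg : R -> R) (a c t : R) : a <= t <= c ->
  (forall s, a <= s <= c -> forall eps, 0 < eps -> exists delta, 0 < delta /\
     forall s', a <= s' <= c -> Rabs (s' - s) < delta ->
       Cmod (f s' - f s - df s * RtoC (s' - s))%C <= eps * Rabs (s' - s)) ->
  (forall s, a <= s <= c -> is_derive g s (dg s) /\ Cmod (df s) <= dg s) ->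
  Cmod (f t - f a)%C <= g t - g a.
Proof.
  intros Ht Hf Hg. set (cl := fun s => Rmax a (Rmin s c)).
  assert (Hac : a <= c) by lra.
  pose proof (pder_mvt (fun s => f (cl s)) df g dg a t ltac:(lra)) as K. cbv beta in K.
  unfold cl in K. rewrite (clamp_id a c t), (clamp_id a c a) in K by lra. apply K; clear K.
  - intros s Hs. split; [| apply Hg; lra]. apply pder_eps. intros eps He.
    destruct (Hf s ltac:(lra) eps He) as (d & Hd & K).
    exists (Rmin d (Rmin (s - a) (t - s))). split; [repeat apply Rmin_pos; lra |].
    intros h Hh. pose proof (Rmin_l d (Rmin (s - a) (t - s))). pose proof (Rmin_r d (Rmin (s - a) (t - s))).
    pose proof (Rmin_l (s - a) (t - s)). pose proof (Rmin_r (s - a) (t - s)).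
    assert (Hh' : Rabs h < s - a /\ Rabs h < t - s) by lra.
    destruct Hh' as [Hh1 Hh2]. apply Rabs_lt_between in Hh1. apply Rabs_lt_between in Hh2.
    rewrite !clamp_id by lra. specialize (K (s + h) ltac:(lra)).
    replace (s + h - s) with h in K by ring. apply K. lra.
  - intros s Hs. split; [| eapply derive_continuous, Hg; lra].
    apply ccont_eps. intros eps He.
    destruct (Hf s ltac:(lra) 1 ltac:(lra)) as (d & Hd & K). pose proof (Cmod_ge_0 (df s)) as Hdf.
    exists (Rmin d (eps / (Cmod (df s) + 1))). split.
    { apply Rmin_pos; auto. apply Rdiv_lt_0_compat; lra. }
    intros h Hh. pose proof (Rmin_l d (eps / (Cmod (df s) + 1))). pose proof (Rmin_r d (eps / (Cmod (df s) + 1))).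
    rewrite (clamp_id a c s) by lra. set (s' := Rmax a (Rmin (s + h) c)).
    assert (Hs' : Rabs (s' - s) <= Rabs h).
    { pose proof (Rabs_clamp a c (s + h) s Hac) as R1. rewrite (clamp_id a c s) in R1 by lra.
      replace (s + h - s) with h in R1 by ring. exact R1. }
    specialize (K s' (clamp_in a c (s + h) Hac) ltac:(lra)).
    pose proof (Cmod_triangle_minus (f s' - f s)%C (df s * RtoC (s' - s))%C) as Tr.
    rewrite Cmod_mult, Cmod_R in Tr.
    assert (B : (Cmod (df s) + 1) * Rabs (s' - s) <= eps); [| lra].
    apply Rle_trans with ((Cmod (df s) + 1) * (eps / (Cmod (df s) + 1))); [| right; field; lra].
    apply Rmult_le_compat_l; lra.
Qed.

Lemma Rabs_snd_near (z w : C) (r : R) : Cmod (w - z)%C < r -> Rabs (snd w) < Rabs (snd z) + r.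
Proof. intros H. pose proof (snd_dist z w). lra. Qed.

(* Uniqueness in the abstract Cauchy-Kovalevskaya theorem; [dD] is the time derivative of [D].
   The n-th step bounds the x-derivative by Cauchy's estimate on discs of radius (r0 - |y|)/(n + 2). *)
Lemma ck_iteration (D dD : R -> C -> C) (r0 S K t0 t1 : R) : 0 < r0 -> 0 <= S -> 0 <= K ->
  (forall t, t0 <= t <= t1 -> hol r0 (D t)) ->
  (forall t, t0 <= t <= t1 -> bnd r0 S (D t)) ->
  (forall z : C, Rabs (snd z) < r0 -> D t0 z = 0) ->
  (forall z : C, Rabs (snd z) < r0 -> forall t, t0 <= t <= t1 -> forall eps, 0 < eps ->
     exists delta, 0 < delta /\ forall s, t0 <= s <= t1 -> Rabs (s - t) < delta ->
       Cmod (D s z - D t z - dD t z * RtoC (s - t))%C <= eps * Rabs (s - t)) ->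
  (forall t (z : C) d0 d1, t0 <= t <= t1 -> Rabs (snd z) < r0 ->
     (forall x, Cmod (D t (x, snd z)) <= d0) -> (forall x, Cmod (Cd (D t) (x, snd z)) <= d1) ->
     Cmod (dD t z) <= K * (d0 + d1)) ->
  forall n t (z : C), t0 <= t <= t1 -> Rabs (snd z) < r0 ->
    Cmod (D t z) <= S * (K * (r0 + 6) * (t - t0) / (r0 - Rabs (snd z))) ^ n.
Proof.
  intros Hr0 HS HK Hhol Hbnd Hinit Hder Heq. set (L := K * (r0 + 6)).
  assert (HL : 0 <= L) by (apply Rmult_le_pos; lra).
  induction n; intros t z Ht Hz.
  - simpl. rewrite Rmult_1_r. now apply Hbnd.
  - set (y := Rabs (snd z)) in *. set (d := r0 - y). assert (Hd : 0 < d) by (unfold d; lra).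
    assert (Hy : 0 <= y) by apply Rabs_pos.
    set (N := INR (Datatypes.S n)). set (N1 := INR (Datatypes.S (Datatypes.S n))).
    assert (HN : 0 < N) by apply INR_S_pos.
    assert (EN : N1 = N + 1) by apply S_INR.
    assert (HN1 : 1 <= N) by (unfold N; rewrite S_INR; pose proof (pos_INR n); lra).
    assert (HdD : forall s, t0 <= s <= t1 -> Cmod (dD s z) <= S * (L / d) ^ Datatypes.S n * (N * (s - t0) ^ n)).
    { intros s Hs. set (X := (L * (s - t0) / d) ^ n).
      assert (Hq : 0 <= L * (s - t0) / d) by (apply Rdiv_le_0_compat; auto; apply Rmult_le_pos; lra).
      assert (HX : 0 <= X) by now apply pow_le.
      assert (HSX : 0 <= S * X) by now apply Rmult_le_pos.
      assert (B0 : forall x, Cmod (D s (x, snd z)) <= S * X).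
      { intros x. apply (IHn s (x, snd z)); auto. }
      (* The factor 3 is [pow_succ_ratio]: on a disc of radius d/(n+2) the distance to the edge of
         the strip shrinks at most by the factor (n+1)/(n+2). *)
      assert (B1 : forall x, Cmod (Cd (D s) (x, snd z)) <= 3 * (S * X) / (d / N1)).
      { intros x. set (w := (x, snd z) : C). assert (Hw : Rabs (snd w) = y) by reflexivity.
        assert (Hrad : 0 < d / N1) by (apply Rdiv_lt_0_compat; lra).
        assert (Hrad2 : d - d / N1 = d * (N / N1)) by (rewrite EN; field; lra).
        assert (HNN : 0 < N / N1) by (apply Rdiv_lt_0_compat; lra).
        assert (Hrad3 : d / N1 < d).
        { assert (0 < d * (N / N1)) by now apply Rmult_lt_0_compat. lra. }
        apply (Cd_bound (D s) w (3 * (S * X)) (d / N1) (d / N1)); auto.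
        - apply (hol_holb r0); auto. rewrite Hw. unfold d in *. lra.
        - intros w' Hw'. apply Rabs_snd_near in Hw'. rewrite Hw in Hw'.
          assert (Hw'' : d * (N / N1) <= r0 - Rabs (snd w')) by (rewrite <- Hrad2; unfold d in *; lra).
          assert (HdN : 0 < d * (N / N1)) by now apply Rmult_lt_0_compat.
          eapply Rle_trans; [apply IHn; auto; lra |]. fold L.
          replace (3 * (S * X)) with (S * (X * 3)) by ring. apply Rmult_le_compat_l; auto.
          apply Rle_trans with (X * (N1 / N) ^ n).
          + unfold X. rewrite <- Rpow_mult_distr. apply pow_incr. split.
            * apply Rdiv_le_0_compat; [apply Rmult_le_pos; lra | lra].
            * replace (L * (s - t0) / d * (N1 / N)) with (L * (s - t0) / (d * (N / N1))) by (field; lra).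
              unfold Rdiv. apply Rmult_le_compat_l; [apply Rmult_le_pos; lra |].
              apply Rinv_le_contravar; auto.
          + apply Rmult_le_compat_l; auto. apply pow_succ_ratio.
        - replace (w - w)%C with (RtoC 0) by ring. rewrite Cmod_0. lra. }
      eapply Rle_trans; [apply (Heq s z _ _ Hs Hz B0 B1) |].
      replace (S * (L / d) ^ Datatypes.S n * (N * (s - t0) ^ n)) with (K * ((S * X) * (N * (r0 + 6) / d))).
      2:{ replace X with ((L / d) ^ n * (s - t0) ^ n)
            by (unfold X; rewrite <- Rpow_mult_distr; f_equal; field; lra).
          simpl pow. set (P := (L / d) ^ n). unfold L. field. lra. }
      apply Rmult_le_compat_l; auto.
      (* Origin of r0 + 6 in [L]: d <= r0 and N + 1 <= 2N give d + 3(N+1) <= N (r0 + 6). *)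
      replace (S * X + 3 * (S * X) / (d / N1)) with ((S * X) * ((d + 3 * N1) / d)) by (field; lra).
      apply Rmult_le_compat_l; auto. unfold Rdiv. apply Rmult_le_compat_r.
      + left. now apply Rinv_0_lt_compat.
      + rewrite EN. unfold d. nra. }
    (* Integration in time: the comparison function has the bound on [dD] as its derivative, and the
       factor N = n+1 produced by Cauchy's estimate is exactly the one that differentiation of the
       power creates. *)
    assert (M := onesided_mvt (fun s => D s z) (fun s => dD s z)
      (fun s => S * (L / d) ^ Datatypes.S n * (s - t0) ^ Datatypes.S n)
      (fun s => S * (L / d) ^ Datatypes.S n * (N * (s - t0) ^ n)) t0 t1 t Ht (Hder z Hz)).
    cbv beta in M. rewrite Hinit in M by auto.
    replace (D t z - 0)%C with (D t z) in M by ring.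
    fold y d. replace (L * (t - t0) / d) with ((L / d) * (t - t0)) by (field; lra).
    rewrite Rpow_mult_distr.
    replace (S * ((L / d) ^ Datatypes.S n * (t - t0) ^ Datatypes.S n))
      with (S * (L / d) ^ Datatypes.S n * (t - t0) ^ Datatypes.S n - S * (L / d) ^ Datatypes.S n * (t0 - t0) ^ Datatypes.S n)
      by (simpl pow; ring).
    apply M. intros s Hs. split; [| now apply HdD].
    apply is_derive_scal with (f := fun s => (s - t0) ^ Datatypes.S n).
    replace (N * (s - t0) ^ n) with (N * 1 * (s - t0) ^ pred (Datatypes.S n)) by (simpl pred; ring).
    apply (is_derive_pow (fun s => s - t0) (Datatypes.S n) s 1). auto_derive; auto.
Qed.

(** Differentiability at t0 in sup norm bounds U(t) near t0 through U(t0) and V(t0), which supplies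
    the local uniformity in time absent from [ext_solution]. *)
Lemma ext_solution_local_bound (b rho T : R) (U V : R -> C -> C) (mu mv : R -> R) (t0 : R) :
  ext_solution b rho T U V mu mv -> 0 <= t0 <= T ->
  exists S delta, 0 < S /\ 0 < delta /\ forall t, 0 <= t <= T -> Rabs (t - t0) < delta -> bnd rho S (U t).
Proof.
  intros H Ht0. destruct (H t0 Ht0) as (HU & HV & Hd & _).
  destruct (Hd 1 ltac:(lra)) as (d & Hd0 & K).
  pose proof (proj1 HU) as Hmu. pose proof (proj1 HV) as Hmv.
  exists (2 * mu t0 + 2 * mv t0 + 1), (Rmin d 1). split; [lra | split; [apply Rmin_pos; lra |]].
  intros t Ht Htd z Hz. pose proof (Rmin_l d 1). pose proof (Rmin_r d 1).
  specialize (K t Ht ltac:(lra) z Hz). pose proof (HB_bnd _ _ _ HU z Hz). pose proof (HB_bnd _ _ _ HV z Hz) as BV.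
  pose proof (Cmod_triangle_minus (U t z - U t0 z)%C (V t0 z * RtoC (t - t0))%C) as T1.
  pose proof (Cmod_triangle_minus (U t z) (U t0 z)) as T2.
  rewrite Cmod_mult, Cmod_R in T1. pose proof (Rabs_pos (t - t0)).
  assert (Cmod (V t0 z) * Rabs (t - t0) <= 2 * mv t0 * 1).
  { apply Rmult_le_compat; auto using Cmod_ge_0; lra. }
  lra.
Qed.

Lemma hol_sub (s : R) (F G : C -> C) : hol s F -> hol s G ->
  hol s (fun z => F z - G z)%C /\
  forall z : C, Rabs (snd z) < s -> Cd (fun z => F z - G z)%C z = (Cd F z - Cd G z)%C.
Proof.
  intros HF HG. apply (hol_intro s _ (fun z => Cd F z - Cd G z)%C). intros z Hz.
  apply cdiff_minus; eapply hol_cdiff; eauto.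
Qed.

(** Bilinearity: with D = F - G, Q(F,F) - Q(G,G) = Q(G,D) + Q(D,F). *)
Lemma Qop_difference (b s S S1 d0 d1 : R) (F G : C -> C) (z : C) : reg s F -> reg s G ->
  Rabs (snd z) < s -> bnd s S F -> bnd s S G -> bnd s S1 (Cd F) -> bnd s S1 (Cd G) ->
  (forall x, Cmod (F (x, snd z) - G (x, snd z))%C <= d0) ->
  (forall x, Cmod (Cd (fun z => F z - G z)%C (x, snd z)) <= d1) ->
  Cmod (Qop b F F z - Qop b G G z)%C
    <= (S + S1 + 2 * Rabs (b / 2) * S + 2 * Rabs ((3 - b) / 2) * S1) * (d0 + d1).
Proof.
  intros HF HG Hz BF BG BF' BG' H0 H1. set (D := fun z => (F z - G z)%C).
  assert (rD : reg s D).
  { assert (K := reg_plus s F (fun z => - (1) * G z)%C HF (reg_scal s (- (1))%C G HG)).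
    destruct K as [K1 [M [K2 K3]]].
    assert (E : forall w, (F w + - (1) * G w)%C = D w) by (intros; unfold D; ring).
    apply (reg_intro s M M).
    - apply (hol_ext s _ D (fun w _ => E w) K1).
    - intros w Hw. rewrite <- E. now apply K2.
    - intros w Hw. rewrite <- (Cd_ext (fun z => F z + - (1) * G z)%C D w (fun x => E (x, snd w))). now apply K3. }
  assert (E1 : Qop b F F z = (Qop b G F z + Qop b D F z)%C).
  { rewrite <- (Qop_plus_l b s); auto. apply (Qop_ext b s); auto. intros w _. unfold D. ring. }
  assert (E2 : Qop b G F z = (Qop b G G z + Qop b G D z)%C).
  { rewrite <- (Qop_plus_r b s); auto. apply (Qop_ext b s); auto. intros w _. unfold D. ring. }
  rewrite E1, E2.
  replace (Qop b G G z + Qop b G D z + Qop b D F z - Qop b G G z)%C with (Qop b G D z + Qop b D F z)%C by ring.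
  eapply Rle_trans; [apply Cmod_triangle |].
  pose proof (Qop_bound_line b s S S1 d0 d1 G D z (proj1 HG) (proj1 rD) Hz
    (bnd_line s S G z BG Hz) (bnd_line s S1 _ z BG' Hz) H0 H1) as Q1.
  pose proof (Qop_bound_line b s d0 d1 S S1 D F z (proj1 rD) (proj1 HF) Hz H0 H1
    (bnd_line s S F z BF Hz) (bnd_line s S1 _ z BF' Hz)) as Q2.
  assert (HS : 0 <= S) by (eapply Rle_trans; [apply (Cmod_ge_0 (F z)) | now apply BF]).
  assert (HS1 : 0 <= S1) by (eapply Rle_trans; [apply (Cmod_ge_0 (Cd F z)) | now apply BF']).
  assert (Hd0 : 0 <= d0) by (eapply Rle_trans; [apply (Cmod_ge_0 (F (0, snd z) - G (0, snd z))%C) | apply H0]).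
  assert (Hd1 : 0 <= d1) by (eapply Rle_trans; [apply Cmod_ge_0 | apply (H1 0)]).
  set (b1 := Rabs (b / 2)) in *. set (b2 := Rabs ((3 - b) / 2)) in *.
  assert (Hb1 : 0 <= b1) by apply Rabs_pos. assert (Hb2 : 0 <= b2) by apply Rabs_pos.
  assert (0 <= S * d0) by now apply Rmult_le_pos. assert (0 <= S1 * d1) by now apply Rmult_le_pos.
  assert (0 <= b1 * (S * d1)) by (apply Rmult_le_pos; auto; now apply Rmult_le_pos).
  assert (0 <= b2 * (S1 * d0)) by (apply Rmult_le_pos; auto; now apply Rmult_le_pos).
  lra.
Qed.

Lemma local_uniqueness (b rho T : R) (U V U' V' : R -> C -> C) (mu mv mu' mv' : R -> R) (t0 : R) : 0 < rho ->
  ext_solution b rho T U V mu mv -> ext_solution b rho T U' V' mu' mv' -> 0 <= t0 <= T ->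
  (forall x, U t0 (x, 0) = U' t0 (x, 0)) ->
  exists tau, 0 < tau /\ forall t, t0 <= t <= Rmin T (t0 + tau) -> forall x, U t (x, 0) = U' t (x, 0).
Proof.
  intros Hrho H H' Ht0 E0.
  destruct (ext_solution_local_bound b rho T U V mu mv t0 H Ht0) as (Sa & da & HSa & Hda & Ba).
  destruct (ext_solution_local_bound b rho T U' V' mu' mv' t0 H' Ht0) as (Sb & db & HSb & Hdb & Bb).
  set (S := Sa + Sb). assert (HS : 0 < S) by (unfold S; lra).
  (* On the strip of half width rho/2, Cauchy's estimate bounds the x-derivatives of both solutions
     by S/(rho - r0), which is S/r0. *)
  set (r0 := rho / 2). set (S1 := S / r0). assert (Hr0 : 0 < r0) by (unfold r0; lra).
  assert (HS1 : 0 < S1) by now apply Rdiv_lt_0_compat.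
  set (K := S + S1 + 2 * Rabs (b / 2) * S + 2 * Rabs ((3 - b) / 2) * S1).
  assert (HK : 0 < K).
  { pose proof (Rabs_pos (b / 2)) as b1. pose proof (Rabs_pos ((3 - b) / 2)) as b2. unfold K.
    assert (0 <= 2 * Rabs (b / 2) * S) by (apply Rmult_le_pos; lra).
    assert (0 <= 2 * Rabs ((3 - b) / 2) * S1) by (apply Rmult_le_pos; lra). lra. }
  set (L := K * (r0 + 6)). assert (HL : 0 < L) by (apply Rmult_lt_0_compat; lra).
  (* The first two terms keep t where the local bounds hold; the third makes L (t - t0)/r0 at most
     1/2, so that the iteration tends to zero on the real axis. *)
  set (tau := Rmin (Rmin (da / 2) (db / 2)) (r0 / (2 * L))).
  assert (Htau : 0 < tau) by (repeat apply Rmin_pos; try lra; apply Rdiv_lt_0_compat; lra).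
  assert (Ht1 : tau <= da / 2 /\ tau <= db / 2 /\ tau <= r0 / (2 * L)).
  { unfold tau. pose proof (Rmin_l (Rmin (da / 2) (db / 2)) (r0 / (2 * L))).
    pose proof (Rmin_r (Rmin (da / 2) (db / 2)) (r0 / (2 * L))).
    pose proof (Rmin_l (da / 2) (db / 2)). pose proof (Rmin_r (da / 2) (db / 2)). lra. }
  destruct Ht1 as (Hta & Htb & Htc).
  exists tau. split; auto. set (t1 := Rmin T (t0 + tau)).
  assert (Hin : forall t, t0 <= t <= t1 -> 0 <= t <= T /\ t - t0 <= tau).
  { intros t Ht. pose proof (Rmin_l T (t0 + tau)). pose proof (Rmin_r T (t0 + tau)). unfold t1 in Ht. lra. }
  assert (BU : forall t, t0 <= t <= t1 -> bnd rho S (U t)).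
  { intros t Ht. destruct (Hin t Ht). apply (bnd_le _ Sa); [unfold S; lra |].
    apply Ba; auto. rewrite Rabs_pos_eq; lra. }
  assert (BU' : forall t, t0 <= t <= t1 -> bnd rho S (U' t)).
  { intros t Ht. destruct (Hin t Ht). apply (bnd_le _ Sb); [unfold S; lra |].
    apply Bb; auto. rewrite Rabs_pos_eq; lra. }
  assert (HB1 : forall t, t0 <= t <= t1 -> HB rho (U t) (mu t)) by (intros t Ht; apply H; now apply Hin).
  assert (HB2 : forall t, t0 <= t <= t1 -> HB rho (U' t) (mu' t)) by (intros t Ht; apply H'; now apply Hin).
  assert (BC : forall F, hol rho F -> bnd rho S F -> bnd r0 S1 (Cd F)).
  { intros F HF HBF z Hz. eapply Rle_trans; [apply (hol_Cd_bound rho S); auto; unfold r0 in *; lra |].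
    unfold S1, Rdiv. apply Rmult_le_compat_l; [lra |]. apply Rinv_le_contravar; unfold r0 in *; lra. }
  pose proof (ck_iteration (fun t z => U t z - U' t z)%C (fun t z => V t z - V' t z)%C
    r0 (2 * S) K t0 t1 Hr0 ltac:(lra) ltac:(lra)) as I.
  intros t Ht x. apply (eq_half_pow _ _ (2 * S)). intros n.
  assert (Hx : Rabs (snd (x, 0)) < r0) by (simpl; rewrite Rabs_R0; auto).
  eapply Rle_trans; [apply (I) with (n := n); auto |].
  - intros s Hs. apply (hol_le rho); [unfold r0; lra |]. apply hol_sub; [apply (HB1 s Hs) | apply (HB2 s Hs)].
  - intros s Hs z Hz. eapply Rle_trans; [apply Cmod_minus |].
    assert (Hz' : Rabs (snd z) < rho) by (unfold r0 in Hz; lra).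
    pose proof (BU s Hs z Hz'). pose proof (BU' s Hs z Hz'). lra.
  - intros z Hz. assert (Ht00 : t0 <= t0 <= t1) by (destruct Ht; lra).
    rewrite (HB_real_unique rho _ _ _ _ (HB1 t0 Ht00) (HB2 t0 Ht00) E0 z); [ring |]. unfold r0 in Hz; lra.
  - intros z Hz s Hs eps He. assert (Hz' : Rabs (snd z) < rho) by (unfold r0 in Hz; lra).
    destruct (H s (proj1 (Hin s Hs))) as (_ & _ & D1 & _). destruct (H' s (proj1 (Hin s Hs))) as (_ & _ & D2 & _).
    destruct (D1 (eps / 2) ltac:(lra)) as (d1 & Hd1 & K1). destruct (D2 (eps / 2) ltac:(lra)) as (d2 & Hd2 & K2).
    exists (Rmin d1 d2). split; [now apply Rmin_pos |]. intros s' Hs' Hss.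
    pose proof (Rmin_l d1 d2). pose proof (Rmin_r d1 d2).
    specialize (K1 s' (proj1 (Hin s' Hs')) ltac:(lra) z Hz'). specialize (K2 s' (proj1 (Hin s' Hs')) ltac:(lra) z Hz').
    replace (U s' z - U' s' z - (U s z - U' s z) - (V s z - V' s z) * RtoC (s' - s))%C
      with ((U s' z - U s z - V s z * RtoC (s' - s)) - (U' s' z - U' s z - V' s z * RtoC (s' - s)))%C by ring.
    eapply Rle_trans; [apply Cmod_minus |]. lra.
  - intros s z d0 d1 Hs Hz L0 L1. assert (Hz' : Rabs (snd z) < rho) by (unfold r0 in Hz; lra).
    destruct (H s (proj1 (Hin s Hs))) as (_ & _ & _ & Q1). destruct (H' s (proj1 (Hin s Hs))) as (_ & _ & _ & Q2).
    rewrite Q1, Q2 by auto.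
    assert (Hlt : r0 < rho) by (unfold r0; lra).
    apply (Qop_difference b r0 S S1); auto.
    + apply (HB_reg rho r0 _ _ (HB1 s Hs) Hlt).
    + apply (HB_reg rho r0 _ _ (HB2 s Hs) Hlt).
    + intros w Hw. apply (BU s Hs). lra.
    + intros w Hw. apply (BU' s Hs). lra.
    + apply BC; [apply (HB1 s Hs) | now apply BU].
    + apply BC; [apply (HB2 s Hs) | now apply BU'].
  - apply Rmult_le_compat_l; [lra |]. apply pow_incr. destruct (Hin t Ht) as [_ Htt].
    fold L. simpl snd. rewrite Rabs_R0, Rminus_0_r. split.
    + apply Rdiv_le_0_compat; auto. apply Rmult_le_pos; lra.
    + apply Rmult_le_reg_r with r0; auto. replace (L * (t - t0) / r0 * r0) with (L * (t - t0)) by (field; lra).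
      apply Rle_trans with (L * (r0 / (2 * L))); [| right; field; lra]. apply Rmult_le_compat_l; lra.
Qed.

Lemma ext_solution_unique (b rho T : R) (U V U' V' : R -> C -> C) (mu mv mu' mv' : R -> R) : 0 < rho ->
  ext_solution b rho T U V mu mv -> ext_solution b rho T U' V' mu' mv' -> 0 <= T ->
  (forall x, U 0 (x, 0) = U' 0 (x, 0)) ->
  forall t, 0 <= t <= T -> forall x, U t (x, 0) = U' t (x, 0).
Proof.
  intros Hrho H H' HT E0.
  set (E := fun t => 0 <= t <= T /\ forall s, 0 <= s <= t -> forall x, U s (x, 0) = U' s (x, 0)).
  assert (HE0 : E 0).
  { split; [lra |]. intros s Hs x. replace s with 0 by lra. apply E0. }
  destruct (completeness E) as [ts [Hub Hlub]].
  { exists T. intros t [Ht _]. lra. } { now exists 0. }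
  assert (Hts : 0 <= ts <= T).
  { split; [now apply Hub |]. apply Hlub. intros t [Ht _]. lra. }
  assert (Hbelow : forall s, 0 <= s < ts -> forall x, U s (x, 0) = U' s (x, 0)).
  { intros s Hs. apply NNPP. intros N.
    assert (Hs' : ts <= s); [| lra]. apply Hlub. intros t [Ht Et]. apply Rnot_lt_le. intros Hst.
    apply N. apply Et. lra. }
  (* Agreement extends to the supremum by continuity: both functions are compared with their common
     value at ts - h. *)
  assert (Hat : forall x, U ts (x, 0) = U' ts (x, 0)).
  { destruct (Req_dec ts 0) as [-> | Nz]; [exact E0 |]. intros x.
    assert (Hx : Rabs (snd (x, 0)) < rho) by (simpl; rewrite Rabs_R0; auto).
    destruct (H ts Hts) as (_ & _ & D1 & _). destruct (H' ts Hts) as (_ & _ & D2 & _).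
    destruct (D1 1 ltac:(lra)) as (d1 & Hd1 & K1). destruct (D2 1 ltac:(lra)) as (d2 & Hd2 & K2).
    set (z := (x, 0) : C) in *.
    set (A := Cmod (V ts z) + Cmod (V' ts z) + 2).
    assert (HA : 0 < A) by (unfold A; pose proof (Cmod_ge_0 (V ts z)); pose proof (Cmod_ge_0 (V' ts z)); lra).
    apply (eq_half_pow _ _ 0). intros n. rewrite Rmult_0_l. apply le_epsilon. intros e He. rewrite Rplus_0_l.
    (* h stays within both differentiability ranges, keeps ts - h nonnegative and makes the
       first-order errors A h at most e. *)
    set (h := Rmin (Rmin (d1 / 2) (d2 / 2)) (Rmin ts (e / A))).
    assert (Hh : 0 < h).
    { repeat apply Rmin_pos; try lra. apply Rdiv_lt_0_compat; lra. }
    assert (Hh' : h <= d1 / 2 /\ h <= d2 / 2 /\ h <= ts /\ h <= e / A).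
    { unfold h. pose proof (Rmin_l (Rmin (d1 / 2) (d2 / 2)) (Rmin ts (e / A))).
      pose proof (Rmin_r (Rmin (d1 / 2) (d2 / 2)) (Rmin ts (e / A))).
      pose proof (Rmin_l (d1 / 2) (d2 / 2)). pose proof (Rmin_r (d1 / 2) (d2 / 2)).
      pose proof (Rmin_l ts (e / A)). pose proof (Rmin_r ts (e / A)). lra. }
    destruct Hh' as (h1 & h2 & h3 & h4).
    assert (Habs : Rabs (ts - h - ts) = h) by (rewrite Rabs_left; lra).
    specialize (K1 (ts - h) ltac:(lra) ltac:(lra) z Hx). specialize (K2 (ts - h) ltac:(lra) ltac:(lra) z Hx).
    assert (Hb : U (ts - h) z = U' (ts - h) z) by (apply Hbelow; lra).
    rewrite Hb in K1. rewrite Habs in K1, K2.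
    pose proof (Cmod_minus (U' (ts - h)%R z - U' ts z - V' ts z * RtoC (ts - h - ts))%C
      (U' (ts - h)%R z - U ts z - V ts z * RtoC (ts - h - ts))%C) as T1.
    pose proof (Cmod_triangle_minus (U ts z - U' ts z)%C ((V' ts z - V ts z) * RtoC (ts - h - ts))%C) as T2.
    replace (U ts z - U' ts z - (V' ts z - V ts z) * RtoC (ts - h - ts))%C
      with (U' (ts - h)%R z - U' ts z - V' ts z * RtoC (ts - h - ts) -
        (U' (ts - h)%R z - U ts z - V ts z * RtoC (ts - h - ts)))%C in T2 by ring.
    rewrite Cmod_mult, Cmod_R, Habs in T2.
    pose proof (Cmod_minus (V' ts z) (V ts z)) as T3.
    apply (Rmult_le_compat_r h) in T3; [| lra].
    assert (A * h <= e); [| unfold A in *; lra].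
    apply Rle_trans with (A * (e / A)); [apply Rmult_le_compat_l; lra | right; field; lra]. }
  destruct (local_uniqueness b rho T U V U' V' mu mv mu' mv' ts Hrho H H' Hts Hat) as (tau & Htau & Hloc).
  assert (Hext : E (Rmin T (ts + tau))).
  { split.
    - split; [apply Rmin_glb; lra | apply Rmin_l].
    - intros s Hs. destruct (Rlt_dec s ts) as [L | L]; [apply Hbelow; lra | apply Hloc; lra]. }
  (* If ts were below T, agreement would persist beyond ts. *)
  assert (Hle := Hub _ Hext).
  assert (HtsT : ts = T).
  { unfold Rmin in Hle. destruct (Rle_dec T (ts + tau)); lra. }
  intros t Ht. destruct (Req_dec t ts) as [-> | N]; [exact Hat |]. apply Hbelow. lra.
Qed.

Lemma solution_unique (b rho T : R) (u0 : R -> Cx) (u v u' v' : R -> R -> Cx) : 0 < rho -> 0 <= T ->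
  is_solution b rho T u0 u v -> is_solution b rho T u0 u' v' ->
  forall t, 0 <= t <= T -> forall x, u' t x = u t x.
Proof.
  intros Hrho HT H H' t Ht x.
  destruct (solution_extend b rho T u0 u v Hrho H) as (U & V & mu & mv & HU & EU).
  destruct (solution_extend b rho T u0 u' v' Hrho H') as (U' & V' & mu' & mv' & HU' & EU').
  rewrite <- EU, <- EU' by auto. symmetry.
  apply (ext_solution_unique b rho T U V U' V' mu mv mu' mv'); auto.
  intros y. rewrite EU, EU' by lra. destruct H as [-> _], H' as [-> _]. reflexivity.
Qed.

(* T = (rho0 - rho)/beta with beta = 4 K, so that K T/(rho0 - rho) = 1/4. *)
Lemma in_H1_coef_bound (b rho0 rho M : R) (U0 : C -> C) : 0 < rho < rho0 -> HB rho0 U0 M ->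
  coef_bound rho M ((rho0 - rho) / (4 * (48 * CQ b rho0 * M))) (coef b U0).
Proof.
  intros Hr HU. assert (HM : 0 < M) by apply HU. assert (HC := CQ_pos b rho0 ltac:(lra)).
  set (K := 48 * CQ b rho0 * M). assert (HK : 0 < K) by (unfold K; mulpos).
  split; [apply Rdiv_lt_0_compat; lra | split; auto]. intros n.
  eapply HB_le; [| apply (coef_HB b rho0 M U0 ltac:(lra) HU n rho Hr)]. fold K.
  replace (/ (4 * ((rho0 - rho) / (4 * K)))) with (K / (rho0 - rho)) by (field; lra).
  apply Rmult_le_compat_r. { apply pow_le. apply Rdiv_le_0_compat; lra. }
  assert (Hn : 1 <= INR (S n)) by (rewrite S_INR; pose proof (pos_INR n); lra).
  generalize dependent (INR (S n)). intros x Hx.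
  assert (Hxx : 1 <= x * x) by nra.
  apply Rmult_le_reg_r with (x * x); [lra |].
  replace (M / (x * x) * (x * x)) with M by (field; lra). nra.
Qed.
Theorem theorem2 (b rho0 : R) (u0 : R -> Cx) :
  0 < rho0 -> in_H1 rho0 u0 ->
  exists beta, 0 < beta /\
    forall rho, 0 < rho < rho0 ->
      exists u v : R -> R -> Cx,
        is_solution b rho ((rho0 - rho) / beta) u0 u v /\
        forall u' v' : R -> R -> Cx,
          is_solution b rho ((rho0 - rho) / beta) u0 u' v' ->
          forall t, 0 <= t <= (rho0 - rho) / beta -> forall x, u' t x = u t x.
Proof.
  intros Hrho0 Hu0. destruct (proj1 (in_H1_HB rho0 u0) Hu0) as (U0 & M & HU & E0).
  assert (HM : 0 < M) by apply HU. assert (HC := CQ_pos b rho0 Hrho0).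
  assert (Hbeta : 0 < 4 * (48 * CQ b rho0 * M)) by mulpos.
  (* [M] bounds the extension of [u0] on the full strip, so this value is independent of [rho]. *)
  exists (4 * (48 * CQ b rho0 * M)). split; [exact Hbeta |]. intros rho Hrho.
  assert (HS : is_solution b rho ((rho0 - rho) / (4 * (48 * CQ b rho0 * M))) u0
    (fun t x => usol (coef b U0) t (x, 0)) (fun t x => vsol (coef b U0) t (x, 0))).
  { apply (solution_exists b rho M); [lra | now apply in_H1_coef_bound | apply coef_S | exact E0]. }
  eexists _, _. split; [exact HS |]. intros u' v' HS'.
  refine (solution_unique b rho _ u0 _ _ u' v' ltac:(lra) _ HS HS').
  apply Rdiv_le_0_compat; lra.
Qed.
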